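(* Suppose $P$ has a Lebesgue density $f$, the MCD functional $\theta_0=(\mu_0,\Gamma_0,\rho_0)$ is uniquely defined at $P$, $P$ satisfies condition (B), and $f$ is half-space symmetric: for every $i=1,\dots,k$ and $\omega\in\partial B(0,\rho_0)$, $f(\Gamma_0\omega_{(-i)}+\mu_0)=f(\Gamma_0\omega+\mu_0)$, where $\omega_{(-i)}=(\omega_1,\dots,\omega_{i-1},-\omega_i,\omega_{i+1},\dots,\omega_k)$. Assume further that (a) $\int_{\partial B(0,\rho_0)}\omega_i^2\,\nu(d\omega)\ne\gamma\rho_0$ for all $i=1,\dots,k$; (b) $\int_{\partial B(0,\rho_0)}\omega_i^2\omega_j^2\,\nu(d\omega)\ne\gamma\rho_0$ for all $i\ne j$; (c) the $k\times k$ matrix $M$ with entries \[ M_{ij}=\int_{\partial B(0,\rho_0)}\omega_i^2\omega_j^2\,\nu(d\omega)-\frac1{\nu_0}\int_{\partial B(0,\rho_0)}\omega_i^2\,\nu(d\omega)\int_{\partial B(0,\rho_0)}\omega_j^2\,\nu(d\omega)-2\gamma\rho_0\mathds{1}_{\{i=j\}}, \] where $\nu_0=\nu(\partial B(0,\rho_0))$, has the property that for $x\in\mathbb{R}^k$, $Mx=0$ and $x_1+\cdots+x_k=0$ imply $x=0$. Then $\Lambda'(\theta_0)$ is non-singular (injective, hence invertible) as a linear map on $\mathbb{R}^k\times S(k)\times\mathbb{R}$.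
   Context: Fix $k\ge1$ and $0<\gamma\le1$. For $\mu\in\mathbb{R}^k$, $\Sigma$ symmetric positive definite and $\rho>0$ let $E(\mu,\Sigma,\rho)=\{x:(x-\mu)'\Sigma^{-1}(x-\mu)\le\rho^2\}$ and $B(\mu,\rho)=\{x:\|x-\mu\|\le\rho\}$. $\mathrm{PDS}(k)$ is the set of symmetric positive definite $k\times k$ matrices and $S(k)$ the space of symmetric $k\times k$ matrices. Let $P$ be a probability distribution on $\mathbb{R}^k$ with Lebesgue density $f$. For measurable $\phi:\mathbb{R}^k\to[0,1]$ with $\int\phi\,dP\ge\gamma$ and $\int\|x\|^2\phi(x)P(dx)<\infty$ put $T_P(\phi)=\int x\phi(x)P(dx)/\int\phi\,dP$ and $C_P(\phi)=\int(x-T_P(\phi))(x-T_P(\phi))'\phi(x)P(dx)/\int\phi\,dP$. If $\phi_P$ minimizes $\det C_P(\phi)$ over all such $\phi$, $(T_P(\phi_P),C_P(\phi_P))$ is an MCD functional; it is assumed unique, and we write $\mu_0=T_P(\phi_P)$, $\Sigma_0=C_P(\phi_P)$ (positive definite), $\Gamma_0=\Sigma_0^{1/2}$, $\rho_0=\inf\{s>0:P(E(\mu_0,\Sigma_0,s))\ge\gamma\}$, $\theta_0=(\mu_0,\Gamma_0,\rho_0)$. Known fact (prior work): $\phi_P=\mathds{1}_{E(\mu_0,\Sigma_0,\rho_0)}$ and $P(E(\mu_0,\Sigma_0,\rho_0))=\gamma$. Condition (B): $f$ is continuous and strictly positive on an open neighborhood of the boundary of $E(\mu_0,\Sigma_0,\rho_0)$.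 For $\theta=(m,G,r)\in\mathbb{R}^k\times\mathrm{PDS}(k)\times(0,\infty)$, with $\mathds{1}=\mathds{1}_{\{\|G^{-1}(y-m)\|\le r\}}$: $\Psi_1(y,\theta)=\mathds{1}\,G^{-1}(y-m)$, $\Psi_2(y,\theta)=\mathds{1}\,(G^{-1}(y-m)(y-m)'G^{-1}-I_k)$, $\Psi_3(y,\theta)=\mathds{1}-\gamma$, $\Lambda_j(\theta)=\int\Psi_j(y,\theta)P(dy)$, $\Lambda=(\Lambda_1,\Lambda_2,\Lambda_3)$; $\Lambda'(\theta_0)$ is its Fréchet derivative at $\theta_0$ as a linear map on $\mathbb{R}^k\times S(k)\times\mathbb{R}$. $\sigma_0$ is the Lebesgue surface measure on $\partial B(0,\rho_0)$ and $\nu(d\omega)=\det(\Gamma_0)f(\Gamma_0\omega+\mu_0)\sigma_0(d\omega)$ for $\omega\in\partial B(0,\rho_0)$. *)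

(* Defs.v *)
(* R^k is represented by column
   vectors 'cV[R]_k (for linear algebra / topology) and, for measure theory,
   by k.-tuple R (which carries the product Borel sigma-algebra);
   tup2cV identifies the two. *)
From HB Require Import structures.
From mathcomp Require Import all_boot all_order all_algebra.
From mathcomp Require Import all_classical all_reals all_analysis.
Set Implicit Arguments. Unset Strict Implicit. Unset Printing Implicit Defensive.
Import Order.TTheory GRing.Theory Num.Theory.
Import numFieldNormedType.Exports.
Local Open Scope classical_set_scope.
Local Open Scope ring_scope.

Section MCD.
Variables (R : realType) (k : nat).

Definition tup2cV (t : k.-tuple R) : 'cV[R]_k := \col_i tnth t i.

Definition enorm (x : 'cV[R]_k) : R := Num.sqrt (\sum_i x i 0 ^+ 2).

(* lam is (k-dim.) Lebesgue measure: it gives every closed box its volume.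
   On the product Borel sigma-algebra this characterizes Lebesgue measure. *)
Definition is_lebesgue (lam : {measure set (k.-tuple R) -> \bar R}) : Prop :=
  forall a b : k.-tuple R, (forall i, tnth a i <= tnth b i) ->
    lam [set x | forall i, tnth a i <= tnth x i <= tnth b i] =
    (\prod_i (tnth b i - tnth a i))%:E.

Variables (lam : {measure set (k.-tuple R) -> \bar R}) (f : 'cV[R]_k -> R).

Definition Pmeas (A : set 'cV[R]_k) : \bar R :=
  (\int[lam]_(t in tup2cV @^-1` A) (f (tup2cV t))%:E)%E.

Definition Pint (g : 'cV[R]_k -> R) : \bar R :=
  (\int[lam]_t (g (tup2cV t) * f (tup2cV t))%:E)%E.

(* \int g dP, real valued (for P-integrable g) *)
Definition PRint (g : 'cV[R]_k -> R) : R := fine (Pint g).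

Definition is_sym (A : 'M[R]_k) : Prop := A^T = A.
Definition is_PD (A : 'M[R]_k) : Prop :=
  is_sym A /\ forall x : 'cV[R]_k, x != 0 -> 0 < (x^T *m A *m x) 0 0.

Definition Ell (mu : 'cV[R]_k) (Sigma : 'M[R]_k) (rho : R) : set 'cV[R]_k :=
  [set x | ((x - mu)^T *m invmx Sigma *m (x - mu)) 0 0 <= rho ^+ 2].
Definition Ball (mu : 'cV[R]_k) (rho : R) : set 'cV[R]_k :=
  [set x | enorm (x - mu) <= rho].

Variable gamma : R.

Definition admissible (phi : 'cV[R]_k -> R) : Prop :=
  [/\ measurable_fun setT (phi \o tup2cV),
      (forall x, 0 <= phi x <= 1),
      (gamma%:E <= Pint phi)%E &
      (Pint (fun x => (enorm x ^+ 2 * phi x)%R) < +oo)%E].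

Definition TP (phi : 'cV[R]_k -> R) : 'cV[R]_k :=
  \col_i (PRint (fun x => x i 0 * phi x) / PRint phi).

Definition CP (phi : 'cV[R]_k -> R) : 'M[R]_k :=
  \matrix_(i, j) (PRint (fun x => (x - TP phi) i 0 * (x - TP phi) j 0 * phi x)
                  / PRint phi).

Definition MCD_minimizer (phi : 'cV[R]_k -> R) : Prop :=
  admissible phi /\ forall psi, admissible psi -> \det (CP phi) <= \det (CP psi).

Definition unique_MCD (mu0 : 'cV[R]_k) (Sigma0 : 'M[R]_k) : Prop :=
  (exists phi, [/\ MCD_minimizer phi, TP phi = mu0 & CP phi = Sigma0]) /\
  (forall phi, MCD_minimizer phi -> TP phi = mu0 /\ CP phi = Sigma0).

Definition condB (mu0 : 'cV[R]_k) (Sigma0 : 'M[R]_k) (rho0 : R) : Prop :=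
  exists U : set 'cV[R]_k,
    [/\ open U,
        closure (Ell mu0 Sigma0 rho0) `\` interior (Ell mu0 Sigma0 rho0) `<=` U &
        forall x, U x -> {for x, continuous f} /\ 0 < f x].

Definition flip (i : 'I_k) (w : 'cV[R]_k) : 'cV[R]_k :=
  \col_j (if j == i then - w j 0 else w j 0).

(* integral over the sphere dB(0,rho) against the surface measure sigma_rho,
   via the cone formula  sigma_rho(A) = (k/rho) Leb{ t w : w in A, 0 < t <= 1 }:
   \int h dsigma_rho = (k/rho) \int_{0 < |x| <= rho} h(rho x/|x|) dx *)
Definition sphere_int (rho : R) (h : 'cV[R]_k -> R) : R :=
  (k%:R / rho) *
  fine (\int[lam]_(t in [set t | (0 < enorm (tup2cV t) <= rho)%R])
          (h ((rho / enorm (tup2cV t))%R *: tup2cV t))%:E)%E.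

Definition nu_int (mu0 : 'cV[R]_k) (Gamma0 : 'M[R]_k) (rho0 : R)
  (h : 'cV[R]_k -> R) : R :=
  \det Gamma0 * sphere_int rho0 (fun w => h w * f (Gamma0 *m w + mu0)).

Definition Mmat (mu0 : 'cV[R]_k) (Gamma0 : 'M[R]_k) (rho0 : R) : 'M[R]_k :=
  let nu := nu_int mu0 Gamma0 rho0 in
  \matrix_(i, j)
    (nu (fun w => w i 0 ^+ 2 * w j 0 ^+ 2)
     - (nu (fun w => w i 0 ^+ 2)) * (nu (fun w => w j 0 ^+ 2)) / nu (fun _ => 1)
     - 2 * gamma * rho0 * (i == j)%:R).

Definition Theta := ('cV[R]_k * 'M[R]_k * R)%type.

Definition ind (th : Theta) (y : 'cV[R]_k) : bool :=
  enorm (invmx th.1.2 *m (y - th.1.1)) <= th.2.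

Definition Psi1 (th : Theta) (y : 'cV[R]_k) : 'cV[R]_k :=
  if ind th y then invmx th.1.2 *m (y - th.1.1) else 0.
Definition Psi2 (th : Theta) (y : 'cV[R]_k) : 'M[R]_k :=
  if ind th y then
    invmx th.1.2 *m (y - th.1.1) *m (y - th.1.1)^T *m invmx th.1.2 - 1%:M
  else 0.
Definition Psi3 (th : Theta) (y : 'cV[R]_k) : R := (ind th y)%:R - gamma.

Definition Lambda (th : Theta) : Theta :=
  (\col_i PRint (fun y => Psi1 th y i 0),
   \matrix_(i, j) PRint (fun y => Psi2 th y i j),
   PRint (Psi3 th)).

End MCD.

Definition in_sub (R : realType) (k : nat) (h : Theta R k) : Prop :=
  is_sym h.1.2.

(* L is the Frechet derivative of F at x, as a linear map on the subspace
   R^k x S(k) x R (L is given as a linear map on the ambient space; only its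
   restriction to the subspace matters) *)
Definition frechet_deriv_sub (R : realType) (k : nat)
    (F : Theta R k -> Theta R k) (x : Theta R k) (L : Theta R k -> Theta R k) : Prop :=
  (forall (a : R) (u v : Theta R k), L (a *: u + v) = a *: L u + L v) /\
  (forall eps : R, 0 < eps -> exists2 delta : R, 0 < delta &
     forall h : Theta R k, in_sub h -> `|h| < delta ->
       `|F (x + h) - F x - L h| <= eps * `|h|).

(* Main.v *)
(** In the coordinates [z = Gamma0^-1 (y - mu0)] a perturbation [(a, H, t)] of
    [theta0] turns the ball [|z| <= rho0] into [|w z| <= rho0 + t], where
    [w z + K (w z) = z - b], [K = Gamma0^-1 H] and [b = Gamma0^-1 a].  To first order
    the sphere moves along its normal by [ell w = t + (w'Kw + w'b) / rho0], so each
    moment changes by a volume term, read off from the moments of the MCD ball, plus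
    the surface integral of [ell] against [nu].

    The MCD ball has mass [gamma], mean [0] and covariance [I]: among weights of mass
    at least [gamma] the ellipsoid minimizes the mean squared Mahalanobis distance, so
    its standardized covariance has trace at most [k], hence determinant at most [1]
    by Hadamard and AM-GM; its indicator is therefore a minimizer and uniqueness applies.

    Half-space symmetry annihilates the odd moments of [nu], which decouples the linear
    system: (a) gives [b = 0], (b) the off-diagonal part of [K + K'], and (c) its
    diagonal and then [t].  Finally [Gamma0^-1 H + H Gamma0^-1 = 0] forces [H = 0]. *)
From HB Require Import structures.
From mathcomp Require Import perm.
From mathcomp Require Import all_boot all_order all_algebra.
From mathcomp Require Import all_classical all_reals all_analysis.
From mathcomp Require Import measurable_realfun.
From mathcomp Require Import ring lra.
Require Import Defs.

Set Implicit Arguments. Unset Strict Implicit. Unset Printing Implicit Defensive.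
Import Order.TTheory GRing.Theory Num.Theory.
Import numFieldNormedType.Exports.
Local Open Scope classical_set_scope.
Local Open Scope ring_scope.

(** * Lebesgue measure and linear maps *)

Section LebesgueTuple.
Variables (R : realType) (k : nat).
Implicit Types (a b x : k.-tuple R).

(** Condition (B) gives continuity of [f] only, and only near the boundary, so no derivative may
    fall on the density. The coordinates z are therefore fixed once and for all: the density [q]
    stays in place, and the perturbation acts on a smooth integrand and on the domain. Continuity of
    [q] at the sphere is also what limits the remainder to o(|h|). [is_lebesgue] fixes the volume of
    boxes and nothing else, so the determinant formula and polar coordinates have to be derived.
    Uniqueness of translation-invariant measures makes every invertible linear map scale volume by a
    constant, an LUP factorization identifies that constant, and the exact scaling of cones replaces
    integration along rays. Since the surface measure is itself defined through cones, the sphere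
    never has to be parametrized. *)

Definition box a b : set (k.-tuple R) :=
  [set x | forall i, tnth a i <= tnth x i <= tnth b i].

Definition boxes : set (set (k.-tuple R)) := [set A | exists a b, A = box a b].

Lemma measurable_box a b : measurable (box a b).
Proof.
have -> : box a b = \bigcap_(i in [set: 'I_k])
    ((@tnth _ R ^~ i) @^-1` `[tnth a i, tnth b i]).
  apply/seteqP; split=> x /= h; first by move=> i _ /=; rewrite in_itv /=; exact: h.
  by move=> i; have := h i I; rewrite /= in_itv.
apply: fin_bigcap_measurable; first exact: finite_finset.
by move=> i _; rewrite -[X in measurable X]setTI; exact: measurable_tnth.
Qed.

Lemma setI_closed_boxes : setI_closed boxes.
Proof.
move=> _ _ [a [b ->]] [c [d ->]].
exists [tuple Num.max (tnth a i) (tnth c i) | i < k].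
exists [tuple Num.min (tnth b i) (tnth d i) | i < k].
apply/seteqP; split => x /=.
  by move=> [h1 h2] i; rewrite !tnth_mktuple ge_max le_min;
    move: (h1 i) (h2 i) => /andP[-> ->] /andP[-> ->].
by move=> h; split=> i; move: (h i);
  rewrite !tnth_mktuple ge_max le_min => /andP[/andP[? ?] /andP[? ?]];
  apply/andP; split.
Qed.

Definition cube (n : nat) := box [tuple - n%:R : R | i < k] [tuple n%:R : R | i < k].

Lemma bigcup_cube : \bigcup_n cube n = setT.
Proof.
apply/seteqP; split => // x _.
exists (\max_i Num.bound `|tnth x i|)%N => // i.
rewrite !tnth_mktuple -ler_norml ltW//.
apply: (lt_le_trans (archi_boundP (normr_ge0 _))).
by rewrite ler_nat; exact: leq_bigmax.
Qed.

(** Coordinate half-spaces generate the product sigma-algebra, and each is a countable union of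
    boxes whose remaining sides are [-n, n]. *)
Lemma tuple_measurableE : (measurable : set (set (k.-tuple R))) = <<s boxes >>.
Proof.
apply/seteqP; split; last first.
  apply: smallest_sub; first exact: sigma_algebra_measurable.
  by move=> _ [a [b ->]]; exact: measurable_box.
have -> : (measurable : set (set (k.-tuple R))) =
   g_sigma_preimage (fun (i : 'I_k) (x : k.-tuple R) => tnth x i) by [].
apply: smallest_sub; first exact: smallest_sigma_algebra.
suff h (i : 'I_k) : preimage_set_system setT (fun x : k.-tuple R => tnth x i) measurable
    `<=` <<s boxes >>.
  apply: (big_ind (fun X : set (set _) => X `<=` <<s boxes >>)) => //.
  by move=> A B hA hB; rewrite subUset.
rewrite [X in preimage_set_system _ _ X](_ : _ = (@measurable_realfun.RGenCInfty.G R).-sigma.-measurable);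
  last exact: measurable_realfun.RGenCInfty.measurableE.
rewrite -g_sigma_preimageE; apply: smallest_sub; first exact: smallest_sigma_algebra.
move=> _ [_ [a ->] <-]; rewrite setTI.
have -> : (fun x : k.-tuple R => tnth x i) @^-1` `[a, +oo[ =
  \bigcup_n box [tuple if j == i then a else - n%:R | j < k] [tuple n%:R | j < k].
  apply/seteqP; split => x /=.
    rewrite in_itv /= andbT => ax.
    have : (\bigcup_n cube n) x by rewrite bigcup_cube.
    move=> [n _ hx]; exists n => // j; move: (hx j).
    by rewrite !tnth_mktuple => /andP[? ->]; rewrite andbT; case: eqP => // ->.
  move=> [n _ /(_ i)]; rewrite !tnth_mktuple eqxx in_itv /= andbT.
  by case/andP.
have [_ _ hU] := @smallest_sigma_algebra _ setT boxes.
by apply: hU => n; apply: sub_sigma_algebra; eexists; eexists.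
Qed.

(** Boxes form a generating pi-system and the cubes exhaust the space with finite measure. A box
    with a reversed side is empty, so ordered corners suffice. *)
Lemma measure_unique_boxes (m1 m2 : {measure set (k.-tuple R) -> \bar R}) :
  (forall a b, (forall i, tnth a i <= tnth b i) -> m1 (box a b) = m2 (box a b)) ->
  (forall n, (m1 (cube n) < +oo)%E) ->
  forall A, measurable A -> m1 A = m2 A.
Proof.
move=> h hfin; apply: (measure_unique boxes cube) => //.
- exact: tuple_measurableE.
- exact: setI_closed_boxes.
- by move=> n; eexists; eexists.
- exact: bigcup_cube.
- move=> _ [a [b ->]].
  case: (pselect (forall i, tnth a i <= tnth b i)) => [/h//|/existsNP[i hi]].
  suff -> : box a b = set0 by rewrite !measure0.
  apply/seteqP; split => x //= /(_ i) /andP[h1 h2].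
  by apply: hi; exact: le_trans h2.
Qed.

Definition cV2tup (x : 'cV[R]_k) : k.-tuple R := [tuple x i 0 | i < k].
Lemma tup2cVK : cancel (@tup2cV R k) cV2tup.
Proof. by move=> t; apply: eq_from_tnth => i; rewrite tnth_mktuple mxE. Qed.
Lemma cV2tupK : cancel cV2tup (@tup2cV R k).
Proof. by move=> x; apply/colP => i; rewrite mxE tnth_mktuple. Qed.

Definition afft (A : 'M[R]_k) (v : 'cV[R]_k) (t : k.-tuple R) : k.-tuple R :=
  cV2tup (A *m tup2cV t + v).

Lemma tnth_afft A v t i : tnth (afft A v t) i = \sum_j A i j * tnth t j + v i 0.
Proof.
by rewrite tnth_mktuple !mxE; congr (_ + _); apply: eq_bigr => j _; rewrite mxE.
Qed.

Lemma measurable_afft A v : measurable_fun setT (afft A v).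
Proof.
apply/measurable_fun_tnthP => i.
rewrite (_ : _ \o _ = fun t => \sum_j A i j * tnth t j + v i 0); last first.
  by apply/funext => t; exact: tnth_afft.
apply: measurable_funD => //; apply: measurable_sum => j.
by apply: measurable_funM => //; exact: measurable_tnth.
Qed.

End LebesgueTuple.

Definition image_measure d (T : measurableType d) (R : realType)
  (m : {measure set T -> \bar R}) (g : T -> T) (mg : measurable_fun setT g) :
  set T -> \bar R := pushforward m g.

Section ImageMeasure.
Context d (T : measurableType d) (R : realType).
Variables (m : {measure set T -> \bar R}) (g : T -> T).
Hypothesis mg : measurable_fun setT g.

Let mgm (A : set T) : measurable A -> measurable (g @^-1` A).
Proof. by move=> mA; rewrite -[X in measurable X]setTI; exact: mg. Qed.

Let im0 : image_measure m mg set0 = 0%E.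
Proof. by rewrite /image_measure /pushforward preimage_set0 measure0. Qed.

Let im_ge0 A : (0 <= image_measure m mg A)%E.
Proof. exact: measure_ge0. Qed.

Let im_sadd : semi_sigma_additive (image_measure m mg).
Proof.
move=> F mF tF mUF; rewrite /image_measure /pushforward preimage_bigcup.
apply: measure_semi_sigma_additive.
- by move=> n; exact: mgm.
- apply/trivIsetP => /= i j _ _ ij; rewrite -preimage_setI.
  by move/trivIsetP : tF => /(_ _ _ _ _ ij) ->//; rewrite preimage_set0.
- by rewrite -preimage_bigcup; exact: mgm.
Qed.

HB.instance Definition _ := isMeasure.Build _ _ _ (image_measure m mg) im0 im_ge0 im_sadd.

End ImageMeasure.

(** A separate name for [m] to which the sigma-finite structure demanded by Fubini can be
    attached. *)
Definition sigma_finite_copy d (T : measurableType d) (R : realType)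
  (m : {measure set T -> \bar R}) (sm : sigma_finite setT m) : set T -> \bar R := m.

Section SigmaFiniteCopy.
Context d (T : measurableType d) (R : realType).
Variables (m : {measure set T -> \bar R}) (sm : sigma_finite setT m).
HB.instance Definition _ := Measure.copy (sigma_finite_copy sm) m.
HB.instance Definition _ := Measure_isSigmaFinite.Build _ _ _ (sigma_finite_copy sm) sm.
End SigmaFiniteCopy.

(** * Uniqueness of translation-invariant measures *)

Section Haar.
Variables (R : realType) (k : nat).
Notation T := (k.-tuple R).
Notation tr := (afft (1%:M : 'M[R]_k)).

Lemma measurable_preimage_afft (A : 'M[R]_k) v (X : set T) :
  measurable X -> measurable (afft A v @^-1` X).
Proof. by move=> mX; rewrite -[Y in measurable Y]setTI; exact: measurable_afft. Qed.

Lemma afft_comp (A B : 'M[R]_k) v w (t : T) :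
  afft A v (afft B w t) = afft (A *m B) (A *m w + v) t.
Proof. by rewrite /afft cV2tupK mulmxDr mulmxA addrA. Qed.

Lemma afft10 : afft (1%:M : 'M[R]_k) 0 = id.
Proof. by apply/funext => t; rewrite /afft mul1mx addr0 tup2cVK. Qed.

Definition translation_invariant (m : set T -> \bar R) :=
  forall v A, measurable A -> m (tr v @^-1` A) = m A.

Lemma measurable_addt d (X : measurableType d) (f g : X -> T) :
  measurable_fun setT f -> measurable_fun setT g ->
  measurable_fun setT (fun z => tr (tup2cV (f z)) (g z)).
Proof.
move=> /measurable_fun_tnthP mf /measurable_fun_tnthP mg.
apply/measurable_fun_tnthP => i.
rewrite (_ : _ \o _ = fun z => tnth (g z) i + tnth (f z) i).
  by apply: measurable_funD; [exact: mg|exact: mf].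
by apply/funext => z /=; rewrite /afft tnth_mktuple mul1mx !mxE.
Qed.

Lemma integral_translation (m : {measure set T -> \bar R}) (v : 'cV[R]_k) (f : T -> \bar R) :
  translation_invariant m -> measurable_fun setT f -> (forall x, (0 <= f x)%E) ->
  (\int[m]_x f (tr v x) = \int[m]_x f x)%E.
Proof.
move=> tm mf f0.
have := ge0_integral_pushforward (measurable_afft 1%:M v) m measurableT mf (in1W f0).
rewrite preimage_setT => <-.
pose m' : {measure set T -> \bar R} := image_measure m (measurable_afft 1%:M v).
rewrite -[LHS]/(\int[m']_x f x)%E.
by apply: eq_measure_integral => A mA _; exact: tm.
Qed.

Lemma integral_indic_translation (m : {measure set T -> \bar R}) (v : 'cV[R]_k) (c : R) C :
  translation_invariant m -> 0 <= c -> measurable C ->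
  (\int[m]_y (c * \1_C (tr v y))%:E = c%:E * m C)%E.
Proof.
move=> tm c0 mC.
have mE : measurable_fun setT (EFin \o (\1_C : T -> R)).
  by apply/measurable_EFinP; exact: measurable_indic.
have i0 x : (0 <= (EFin \o (\1_C : T -> R)) x)%E by rewrite lee_fin.
under eq_integral do rewrite EFinM.
have mf : measurable_fun setT (fun y => (\1_C (tr v y) : R)%:E).
  exact: (measurableT_comp mE (measurable_afft 1%:M v)).
rewrite (ge0_integralZl _ measurableT mf)//.
by rewrite (integral_translation _ tm mE i0) /= integral_indic// setIT.
Qed.

(** Integrate 1_B(x) 1_A(x + y) in both orders. Invariance of [m] gives the left side; the
    substitutions x -> x - y and then y -> x + y give the right side, where the reflection of [B]
    remains. *)
Lemma haar_unique (m l : {measure set T -> \bar R}) :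
  sigma_finite setT m -> sigma_finite setT l ->
  translation_invariant m -> translation_invariant l ->
  forall A B, measurable A -> measurable B ->
  (l B * m A = l A * m (afft (- 1%:M) 0 @^-1` B))%E.
Proof.
move=> sm sl tm tl A B mA mB.
pose mm : {sigma_finite_measure set T -> \bar R} := sigma_finite_copy sm.
pose ll : {sigma_finite_measure set T -> \bar R} := sigma_finite_copy sl.
have mI (X : set T) : measurable X -> measurable_fun setT (\1_X : T -> R).
  by move=> mX; exact: measurable_indic.
have mE (X : set T) : measurable X -> measurable_fun setT (EFin \o (\1_X : T -> R)).
  by move=> mX; apply/measurable_EFinP; exact: mI.
have i0 (X : set T) : forall x, (0 <= (EFin \o (\1_X : T -> R)) x)%E.
  by move=> x; rewrite lee_fin.
have E1 : (\int[ll]_x \int[mm]_y (\1_B x * \1_A (tr (tup2cV x) y))%:E = l B * m A)%E.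
  transitivity (\int[ll]_x ((\1_B x)%:E * m A))%E.
    by apply: eq_integral => x _; rewrite integral_indic_translation.
  rewrite (ge0_integralZr _ measurableT (mE _ mB) (fun x _ => i0 B x) (measure_ge0 _ _)).
  by rewrite integral_indic// setIT.
(* Invariance of [l] under x -> x - y moves the shift from the argument of [A] to that of [B]. *)
have E2 : (\int[mm]_y \int[ll]_x (\1_B x * \1_A (tr (tup2cV x) y))%:E =
   \int[mm]_y \int[ll]_x (\1_A x * \1_B (tr (tup2cV x) (afft (- 1%:M) 0 y)))%:E)%E.
  apply: eq_integral => y _.
  have h x : \1_A x * \1_B (tr (tup2cV x) (afft (- 1%:M) 0 y)) =
     (fun x => \1_B x * \1_A (tr (tup2cV x) y)) (tr (- tup2cV y) x) :> R.
    rewrite /= mulrC; congr (_ * _); congr (\1_ _ _).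
      by rewrite /afft cV2tupK !mul1mx mulNmx mul1mx addr0 addrC.
    by rewrite /afft !cV2tupK !mul1mx addrC subrK tup2cVK.
  under [in RHS]eq_integral do rewrite h.
  rewrite -(@integral_translation l (- tup2cV y) (fun x => (\1_B x * \1_A (tr (tup2cV x) y))%:E))//.
  apply/measurable_EFinP; apply: measurable_funM; first exact: mI.
  apply: (measurableT_comp (mI _ mA)).
  by apply: measurable_addt.
(* For fixed x, the points y with x - y in [B] form a translate of -B, whose [m]-measure does not
   depend on x. *)
have E3 : (\int[ll]_x \int[mm]_y (\1_A x * \1_B (tr (tup2cV x) (afft (- 1%:M) 0 y)))%:E
   = l A * m (afft (- 1%:M) 0 @^-1` B))%E.
  transitivity (\int[ll]_x ((\1_A x)%:E * m (afft (- 1%:M) 0 @^-1` B)))%E.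
    apply: eq_integral => x _.
    pose C := afft (- 1%:M) 0 @^-1` B.
    have mC : measurable C by exact: measurable_preimage_afft.
    have h y : \1_B (tr (tup2cV x) (afft (- 1%:M) 0 y)) = \1_C (tr (- tup2cV x) y) :> R.
      rewrite !indicE; congr (nat_of_bool _)%:R; apply/idP/idP; rewrite !inE /C /=;
      by rewrite !afft_comp !mul1mx !mulmx1 mulNmx mul1mx opprK !addr0 add0r.
    under eq_integral do rewrite h.
    by rewrite integral_indic_translation.
  rewrite (ge0_integralZr _ measurableT (mE _ mA) (fun x _ => i0 A x) (measure_ge0 _ _)).
  by rewrite (integral_indic _ measurableT mA) setIT.
have m1 : measurable_fun setT (fun p : T * T => (\1_B p.1 * \1_A (tr (tup2cV p.1) p.2) : R)%:E).
  apply/measurable_EFinP; apply: measurable_funM.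
    by apply: (measurableT_comp (mI _ mB)); exact: measurable_fst.
  apply: (measurableT_comp (mI _ mA)).
  by apply: measurable_addt; [exact: measurable_fst|exact: measurable_snd].
have m2 : measurable_fun setT (fun p : T * T =>
    (\1_A p.1 * \1_B (tr (tup2cV p.1) (afft (- 1%:M) 0 p.2)) : R)%:E).
  apply/measurable_EFinP; apply: measurable_funM.
    by apply: (measurableT_comp (mI _ mA)); exact: measurable_fst.
  apply: (measurableT_comp (mI _ mB)).
  apply: measurable_addt; first exact: measurable_fst.
  exact: (measurableT_comp (measurable_afft (- 1%:M) 0) measurable_snd).
have p1 (p : T * T) : (0 <= (\1_B p.1 * \1_A (tr (tup2cV p.1) p.2) : R)%:E)%E.
  by rewrite lee_fin mulr_ge0.
have p2 (p : T * T) : (0 <= (\1_A p.1 * \1_B (tr (tup2cV p.1) (afft (- 1%:M) 0 p.2)) : R)%:E)%E.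
  by rewrite lee_fin mulr_ge0.
have F1 := fubini_tonelli (m1 := ll) (m2 := mm) _ m1 p1.
have F2 := fubini_tonelli (m1 := ll) (m2 := mm) _ m2 p2.
simpl in F1, F2.
exact: (etrans (esym E1) (etrans F1 (etrans E2 (etrans (esym F2) E3)))).
Qed.

End Haar.

(** * Linear maps scale Lebesgue measure by the determinant *)

Section LinearChange.
Variables (R : realType) (k : nat).
Notation T := (k.-tuple R).
Variables (lam : {measure set T -> \bar R}) (hlam : is_lebesgue lam).

Lemma lebesgue_box (a b : T) : (forall i, tnth a i <= tnth b i) ->
  lam (box a b) = (\prod_i (tnth b i - tnth a i))%:E.
Proof. exact: hlam. Qed.

Lemma lebesgue_symbox (s : 'I_k -> R) : (forall i, 0 <= s i) ->
  lam (box [tuple - s i | i < k] [tuple s i | i < k]) = (\prod_i (2 * s i))%:E.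
Proof.
move=> s0; rewrite lebesgue_box; last by move=> i; rewrite !tnth_mktuple ge0_cp.
by congr _%:E; apply: eq_bigr => i _; rewrite !tnth_mktuple; ring.
Qed.

Lemma lebesgue_cube n : lam (@cube R k n) = (\prod_(i < k) (2 * n%:R : R))%:E.
Proof. by rewrite -lebesgue_symbox. Qed.

Lemma lebesgue_cube_lty n : (lam (@cube R k n) < +oo)%E.
Proof. by rewrite lebesgue_cube ltry. Qed.

Lemma sigma_finite_lebesgue : sigma_finite setT lam.
Proof.
exists (@cube R k); first by rewrite bigcup_cube.
by move=> n; split; [exact: measurable_box|exact: lebesgue_cube_lty].
Qed.

Lemma lebesgue_translation_invariant : translation_invariant lam.
Proof.
move=> v A mA.
rewrite -[LHS]/(image_measure lam (measurable_afft 1%:M v) A).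
apply/esym; move: A mA; apply: measure_unique_boxes => [a b ab|n]; last exact: lebesgue_cube_lty.
rewrite -[RHS]/(lam (afft 1%:M v @^-1` box a b)).
have -> : afft 1%:M v @^-1` box a b =
  box [tuple tnth a i - v i 0 | i < k] [tuple tnth b i - v i 0 | i < k].
  by apply/seteqP; split => x /= h i; move: (h i);
    rewrite !tnth_mktuple mul1mx !mxE lerBlDr lerBrDr.
rewrite !lebesgue_box//; last first.
  by move=> i; rewrite !tnth_mktuple lerD2r.
by congr _%:E; apply: eq_bigr => i _; rewrite !tnth_mktuple; ring.
Qed.

(** The constant by which taking preimages under an invertible [A] scales volume, measured on the
    cube [-1, 1]^k; [vol_factorE] identifies it with |det A|^-1. *)
Definition vol_factor (A : 'M[R]_k) : R :=
  fine (lam (afft A 0 @^-1` @cube R k 1)) / \prod_(i < k) 2.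

Lemma cube1_opp : afft (- 1%:M) 0 @^-1` @cube R k 1 = @cube R k 1.
Proof.
apply/seteqP; split => x /= h i; move: (h i);
  by rewrite !tnth_mktuple mulNmx mul1mx !mxE addr0 lerN2 lerNl andbC.
Qed.

Lemma preimage_cube_bounded (A : 'M[R]_k) : A \in unitmx ->
  exists n, afft A 0 @^-1` @cube R k 1 `<=` @cube R k n.
Proof.
move=> uA.
pose M := \sum_i \sum_j `|invmx A i j|.
have M0 : 0 <= M by apply: sumr_ge0 => i _; apply: sumr_ge0.
exists (Num.bound M) => x /= h i; rewrite !tnth_mktuple -ler_norml.
have -> : x = afft (invmx A) 0 (afft A 0 x).
  by rewrite afft_comp mulVmx// mulmx0 addr0 afft10.
rewrite tnth_afft mxE addr0 (le_trans (ler_norm_sum _ _ _))//.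
apply: (@le_trans _ _ M); last by rewrite ltW//; exact: archi_boundP.
rewrite /M [leRHS](bigD1 i)//=; apply: ler_wpDr.
  by apply: sumr_ge0 => j _; apply: sumr_ge0.
apply: ler_sum => j _; rewrite normrM ler_piMr//.
by move: (h j); rewrite !tnth_mktuple -ler_norml.
Qed.

(** The push-forward of [lam] by [A] is again translation invariant, hence proportional to [lam].
    The reflection in [haar_unique] disappears because the test cube is symmetric. *)
Lemma lebesgue_linear (A : 'M[R]_k) : A \in unitmx -> forall B, measurable B ->
  lam (afft A 0 @^-1` B) = ((vol_factor A)%:E * lam B)%E.
Proof.
move=> uA B mB.
pose m : {measure set T -> \bar R} := image_measure lam (measurable_afft A 0).
have sm : sigma_finite setT m.
  exists (fun n => afft (invmx A) 0 @^-1` @cube R k n).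
    by rewrite -preimage_bigcup bigcup_cube.
  move=> n; split; first by apply: measurable_preimage_afft; exact: measurable_box.
  rewrite -[X in (X < _)%E]/(lam (afft A 0 @^-1` (afft (invmx A) 0 @^-1` @cube R k n))).
  have -> : afft A 0 @^-1` (afft (invmx A) 0 @^-1` @cube R k n) = @cube R k n.
    by apply/funext => t; rewrite /preimage /mkset afft_comp mulVmx// mulmx0 addr0 afft10.
  exact: lebesgue_cube_lty.
have tm : translation_invariant m.
  move=> v C mC.
  rewrite -[LHS]/(lam (afft A 0 @^-1` (afft 1%:M v @^-1` C))) -[RHS]/(lam (afft A 0 @^-1` C)).
  rewrite -[RHS](lebesgue_translation_invariant (invmx A *m v) (measurable_preimage_afft A 0 mC)).
  have E t : afft 1%:M v (afft A 0 t) = afft A 0 (afft 1%:M (invmx A *m v) t).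
    by rewrite !afft_comp mul1mx mulmx1 addr0 mulmx0 add0r mulmxA mulmxV// mul1mx.
  have E' : afft A 0 @^-1` (afft 1%:M v @^-1` C) =
      afft 1%:M (invmx A *m v) @^-1` (afft A 0 @^-1` C).
    by apply/funext => t; rewrite /preimage /mkset E.
  exact: (congr1 lam E').
have := haar_unique sm sigma_finite_lebesgue tm lebesgue_translation_invariant mB
  (measurable_box _ _ : measurable (@cube R k 1)).
rewrite cube1_opp lebesgue_cube mulr1.
have -> : m B = lam (afft A 0 @^-1` B) by [].
have -> : m (@cube R k 1) = lam (afft A 0 @^-1` @cube R k 1) by [].
have p0 : 0 < \prod_(i < k) (2 : R) by apply: prodr_gt0.
have fn : lam (afft A 0 @^-1` @cube R k 1) \is a fin_num.
  rewrite ge0_fin_numE//.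
  have [n hn] := preimage_cube_bounded uA.
  apply: le_lt_trans (lebesgue_cube_lty n); apply: le_measure; rewrite ?inE//.
    by apply: measurable_preimage_afft; exact: measurable_box.
  exact: measurable_box.
move=> h; rewrite /vol_factor EFinM fineK// [RHS]muleC [RHS]muleA [RHS]muleC -h.
by rewrite muleA -EFinM mulVf ?mul1e// gt_eqF.
Qed.

Lemma vol_factorM (A B : 'M[R]_k) : A \in unitmx -> B \in unitmx ->
  vol_factor (A *m B) = vol_factor A * vol_factor B.
Proof.
move=> uA uB.
have uAB : A *m B \in unitmx by rewrite unitmx_mul uA.
have mc : measurable (@cube R k 1) by exact: measurable_box.
have := lebesgue_linear uAB mc.
have -> : afft (A *m B) 0 @^-1` @cube R k 1 = afft B 0 @^-1` (afft A 0 @^-1` @cube R k 1).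
  by apply/funext => t; rewrite /preimage /mkset afft_comp mulmx0 addr0.
rewrite lebesgue_linear//; last exact: measurable_preimage_afft.
rewrite lebesgue_linear// lebesgue_cube -!EFinM => -[].
rewrite mulrA => /mulIf <-; first by rewrite mulrC.
by rewrite gt_eqF//; apply: prodr_gt0 => i _; rewrite mulr1.
Qed.

Lemma vol_factor1 : vol_factor 1%:M = 1.
Proof.
rewrite /vol_factor afft10 preimage_id lebesgue_cube /= mulr1 mulfV// gt_eqF//.
by apply: prodr_gt0.
Qed.

(** The row condition says that [A] maps the centred box of half-sides [r] into the one of
    half-sides [s]; comparing volumes gives the bound. *)
Lemma vol_factor_ge (A : 'M[R]_k) (r s : 'I_k -> R) : A \in unitmx ->
  (forall i, 0 <= r i) -> (forall i, 0 < s i) ->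
  (forall i, \sum_j `|A i j| * r j <= s i) -> \prod_i (r i / s i) <= vol_factor A.
Proof.
move=> uA r0 s0 h.
pose Bx (u : 'I_k -> R) := box [tuple - u i | i < k] [tuple u i | i < k].
have : (lam (Bx r) <= lam (afft A 0 @^-1` Bx s))%E.
  apply: le_measure; rewrite ?inE; first exact: measurable_box.
    by apply: measurable_preimage_afft; exact: measurable_box.
  move=> x /= hx i; rewrite !tnth_mktuple -ler_norml !mxE addr0.
  apply: le_trans (h i); apply: le_trans (ler_norm_sum _ _ _) _.
  apply: ler_sum => j _; rewrite mxE normrM ler_wpM2l//.
  by move: (hx j); rewrite !tnth_mktuple -ler_norml.
rewrite lebesgue_linear//; last exact: measurable_box.
rewrite !lebesgue_symbox// => [|i]; last exact: ltW.
rewrite -EFinM lee_fin -ler_pdivrMr; last by apply: prodr_gt0 => i _; rewrite mulr_gt0.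
rewrite -prodf_div; apply: le_trans; rewrite le_eqVlt; apply/orP; left; apply/eqP.
apply: eq_bigr => i _; have := s0 i => /lt0r_neq0 si; field; rewrite si //.
Qed.

Lemma bernoulli_onem (e : R) n : 0 <= e <= 1 -> 1 - n%:R * e <= (1 - e) ^+ n.
Proof.
move=> /andP[e0 e1]; elim: n => [|n IH]; first by rewrite mul0r subr0 expr0.
rewrite exprS; apply: le_trans (ler_wpM2l _ IH); last by rewrite subr_ge0.
rewrite -natr1; have : 0 <= n%:R * (e * e) by rewrite mulr_ge0// mulr_ge0.
by nra.
Qed.

(* Boxes whose sides grow along the order in which [A] is triangular are almost
   contained in preimages of boxes scaled by the diagonal of [A]. *)
Lemma vol_factor_trig_ge (A : 'M[R]_k) (e : 'I_k -> nat) : A \in unitmx ->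
  (forall i, A i i != 0) ->
  (forall i j, i != j -> A i j != 0 -> (e j < e i)%N) ->
  \prod_i `|A i i|^-1 <= vol_factor A.
Proof.
move=> uA d0 tA.
pose X := \prod_i `|A i i|^-1.
have X0 : 0 <= X by apply: prodr_ge0 => i _; rewrite invr_ge0.
suff h (eps : R) : 0 < eps < 1 -> X - X * k%:R * eps <= vol_factor A.
  apply/ler_addgt0Pl => eta eta0.
  pose eps := Num.min (1/2) (eta / (X * k%:R + 1)).
  have Y0 : 0 < X * k%:R + 1 by rewrite ltr_wpDl// mulr_ge0.
  have e01 : 0 < eps < 1.
    rewrite /eps lt_min gt_min; apply/andP; split; last by apply/orP; left; lra.
    by apply/andP; split; [lra|rewrite divr_gt0].
  have := h _ e01.
  suff : X * k%:R * eps <= eta by rewrite -/X => h1 h2; clearbody X; lra.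
  have : eps * (X * k%:R + 1) <= eta.
    by rewrite -ler_pdivlMr// /eps ge_min lexx orbT.
  case/andP: e01 => e0 _; rewrite mulrDr mulr1 => h'; apply: le_trans h'.
  by rewrite [leLHS]mulrC lerDl ltW.
move=> /andP[e0 e1].
pose C := \sum_i \sum_j `|A i j| / `|A j j|.
have C0 : 0 <= C by apply: sumr_ge0 => i _; apply: sumr_ge0 => j _; rewrite divr_ge0.
(* Every nonzero off-diagonal entry meets a side shorter by at least one power of [M], so the
   off-diagonal part of a row uses at most the fraction C / M <= eps of the target side. *)
pose M := C / eps + 1.
have M1 : 1 <= M by rewrite /M lerDr divr_ge0// ltW.
have M0 : 0 < M by apply: lt_le_trans M1.
pose s i := M ^+ e i.
pose r i := (1 - eps) * M ^+ e i / `|A i i|.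
have s0 i : 0 < s i by rewrite exprn_gt0.
have r0 i : 0 <= r i.
  by rewrite !mulr_ge0 ?invr_ge0// ?(ltW (s0 _))// subr_ge0 ltW.
have := vol_factor_ge uA r0 s0.
have -> : \prod_i (r i / s i) = (1 - eps) ^+ k * X.
  have -> : (1 - eps) ^+ k = \prod_(i < k) (1 - eps) by rewrite prodr_const card_ord.
  rewrite -big_split; apply: eq_bigr => i _ /=.
  by rewrite /r /s; field; rewrite normr_eq0 d0 expf_neq0// gt_eqF.
move=> hge; apply: (@le_trans _ _ ((1 - eps) ^+ k * X)).
  have h : 1 - k%:R * eps <= (1 - eps) ^+ k by apply: bernoulli_onem; rewrite !ltW.
  rewrite [leRHS]mulrC; apply: le_trans (ler_wpM2l X0 h).
  by rewrite mulrBr mulr1 mulrA.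
apply: hge => i; rewrite (bigD1 i)//= /r /s.
have -> : `|A i i| * ((1 - eps) * M ^+ e i / `|A i i|) = (1 - eps) * M ^+ e i.
  by field; rewrite normr_eq0.
suff : \sum_(j | j != i) `|A i j| * ((1 - eps) * M ^+ e j / `|A j j|) <= eps * M ^+ e i by lra.
rewrite -(ler_pM2r M0).
apply: (@le_trans _ _ (C * M ^+ e i)); last first.
  rewrite [leRHS]mulrAC; apply: ler_wpM2r; first exact: (ltW (s0 i)).
  by rewrite /M mulrDr mulrCA mulfV ?gt_eqF// !mulr1 lerDl ltW.
rewrite mulr_suml.
apply: (@le_trans _ _ ((\sum_j `|A i j| / `|A j j|) * M ^+ e i)); last first.
  apply: ler_wpM2r; first exact: (ltW (s0 i)).
  rewrite /C [leRHS](bigD1 i)//= lerDl; apply: sumr_ge0 => j _.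
  by apply: sumr_ge0 => l _; rewrite divr_ge0.
rewrite mulr_suml [leRHS](bigD1 i)//= ler_wpDl//.
  by rewrite mulr_ge0 ?divr_ge0// (ltW (s0 i)).
apply: ler_sum => j ji.
have [->|Aij] := eqVneq (A i j) 0; first by rewrite normr0 !mul0r.
have -> : `|A i j| * ((1 - eps) * M ^+ e j / `|A j j|) * M =
   `|A i j| / `|A j j| * ((1 - eps) * M ^+ (e j).+1).
  by rewrite exprSr; field; rewrite normr_eq0.
apply: ler_wpM2l; first by rewrite divr_ge0.
apply: (@le_trans _ _ (1 * M ^+ (e j).+1)).
  by apply: ler_wpM2r; [rewrite exprn_ge0 // ltW|lra].
by rewrite mul1r ler_weXn2l// tA// eq_sym.
Qed.

End LinearChange.

(** In the factorization A = P^T L U each factor is triangular for some ordering of the coordinates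
    or permutes them, so box comparison bounds each factor from below and multiplicativity combines
    the bounds. *)
Lemma vol_factor_ge_det (R : realType) (n : nat)
    (lam : {measure set (n.+1.-tuple R) -> \bar R}) (hlam : is_lebesgue lam)
    (A : 'M[R]_n.+1) : A \in unitmx -> `|\det A|^-1 <= vol_factor lam A.
Proof.
move=> uA.
have := cormen_lup_correct A; have := cormen_lup_perm A.
have := @cormen_lup_upper _ _ A; have := @cormen_lup_lower _ _ A.
have := @cormen_lup_detL _ _ A.
case: (cormen_lup A) => [[P L] U] /= dL lL uU /is_perm_mxP [s Ps] E.
have uP : P \in unitmx by rewrite Ps unitmx_perm.
have uL : L \in unitmx by rewrite unitmxE dL unitr1.
have uU' : U \in unitmx.
  have : P * A \in unitmx by rewrite unitmx_mul uP.
  by rewrite E unitmx_mul uL.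
have detU : \det U = \prod_i U i i.
  rewrite -det_tr det_trig; last first.
    by apply/is_trig_mxP => i j ij; rewrite mxE uU.
  by apply: eq_bigr => i _; rewrite mxE.
have U0 i : U i i != 0.
  move: uU'; rewrite unitmxE detU unitfE; apply: contraNneq => Ui.
  by rewrite (bigD1 i)//= Ui mul0r.
have h1 : 1 <= vol_factor lam L.
  apply: le_trans (vol_factor_trig_ge hlam (e := id) uL _ _).
  - by rewrite big1 // => i _; rewrite lL// eqxx normr1 invr1.
  - by move=> i; rewrite lL// eqxx oner_neq0.
  - move=> i j ij; apply: contraNT; rewrite -leqNgt => h.
    by rewrite lL// (negbTE ij).
(* An upper triangular matrix is triangular for the reversed order, hence the exponents [n - i]. *)
have h2 : `|\det U|^-1 <= vol_factor lam U.
  apply: le_trans (vol_factor_trig_ge hlam (e := fun i : 'I_n.+1 => (n - i)%N) uU' _ _) => //.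
    rewrite detU normr_prod -prodfV//.
  move=> i j ij; apply: contraNT; rewrite -leqNgt => h.
  rewrite uU// ltn_neqAle eq_sym ij /=.
  have := ltn_ord i; have := ltn_ord j; rewrite !ltnS => hj hi.
  by move: h; rewrite leq_sub2lE.
(* A permutation matrix maps the cube [-1, 1]^k into itself. *)
have h3 : 1 <= vol_factor lam P^T.
  have := @vol_factor_ge _ _ _ hlam P^T (fun=> 1) (fun=> 1).
  rewrite big1 => [|i _]; last by rewrite divr1.
  apply => // [|i]; first by rewrite unitmx_tr.
  rewrite (bigD1 (s^-1%g i))//= big1 => [|j ji]; last first.
    rewrite mulr1 Ps !mxE.
    case: eqP => [h|]; last by rewrite normr0.
    by move: ji; rewrite -h permK eqxx.
  by rewrite Ps !mxE permKV eqxx normr1 addr0 mulr1.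
have PtP : P^T *m P = 1%:M.
  by rewrite Ps tr_perm_mx -perm_mxM mulVg perm_mx1.
have -> : A = P^T *m L *m U.
  by rewrite -mulmxA -[L *m U]/(L * U) -E -[P * A]/(P *m A) mulmxA PtP mul1mx.
rewrite !vol_factorM// ?unitmx_mul ?unitmx_tr ?uP ?uL//.
rewrite !det_mulmx det_tr dL Ps det_perm mulr1 normrM normrX normrN1 expr1n mul1r.
have i0 : 0 <= `|\det U|^-1 by rewrite invr_ge0.
apply: (le_trans h2); rewrite -[leLHS]mul1r.
apply: (ler_wpM2r (le_trans i0 h2)).
by rewrite -Ps; apply: (le_trans h3); rewrite ler_peMr// (le_trans ler01 h3).
Qed.

(** Lower bounds suffice: those for [A] and for its inverse multiply to 1, as do the two factors
    themselves, so both bounds are equalities. *)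
Lemma vol_factorE (R : realType) (k : nat) (lam : {measure set (k.-tuple R) -> \bar R})
    (hlam : is_lebesgue lam) (A : 'M[R]_k) : (0 < k)%N ->
  A \in unitmx -> vol_factor lam A = `|\det A|^-1.
Proof.
case: k lam hlam A => // n lam hlam A _ uA.
have uV : invmx A \in unitmx by rewrite unitmx_inv.
have h1 := vol_factor_ge_det hlam uA.
have h2 := vol_factor_ge_det hlam uV.
have := vol_factorM hlam uA uV; rewrite mulmxV// vol_factor1//.
move: h2; rewrite det_inv normfV invrK => h2 h3.
have d0 : 0 < `|\det A| by rewrite normr_gt0 -unitfE -unitmxE.
apply/eqP; rewrite eq_le h1 andbT -[leRHS]mul1r ler_pdivlMr// h3.
by rewrite ler_wpM2l// (le_trans _ h1)// invr_ge0.
Qed.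

Lemma lebesgue_linear_det (R : realType) (k : nat)
    (lam : {measure set (k.-tuple R) -> \bar R})
    (hlam : is_lebesgue lam) (A : 'M[R]_k) (B : set (k.-tuple R)) : (0 < k)%N ->
  A \in unitmx -> measurable B ->
  lam (afft A 0 @^-1` B) = (`|\det A|^-1%:E * lam B)%E.
Proof. by move=> k0 uA mB; rewrite lebesgue_linear// vol_factorE. Qed.

(** * Integration over column vectors *)

Section Euclid.
Variables (R : realType) (k : nat).
Implicit Types (x y z : 'cV[R]_k) (A : 'M[R]_k).

Definition dot x y : R := \sum_i x i 0 * y i 0.

Lemma dotE x y : dot x y = (x^T *m y) 0 0.
Proof. by rewrite mxE; apply: eq_bigr => i _; rewrite mxE. Qed.
Lemma dotC x y : dot x y = dot y x.
Proof. by apply: eq_bigr => i _; rewrite mulrC. Qed.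
Lemma dotDl x y z : dot (x + y) z = dot x z + dot y z.
Proof. by rewrite -big_split; apply: eq_bigr => i _; rewrite mxE mulrDl. Qed.
Lemma dotZl a x y : dot (a *: x) y = a * dot x y.
Proof. by rewrite mulr_sumr; apply: eq_bigr => i _; rewrite mxE mulrA. Qed.
Lemma dotDr x y z : dot z (x + y) = dot z x + dot z y.
Proof. by rewrite dotC dotDl !(dotC z). Qed.
Lemma dotZr a x y : dot x (a *: y) = a * dot x y.
Proof. by rewrite dotC dotZl dotC. Qed.
Lemma dotNl x y : dot (- x) y = - dot x y.
Proof. by rewrite -scaleN1r dotZl mulN1r. Qed.
Lemma dotNr x y : dot x (- y) = - dot x y.
Proof. by rewrite dotC dotNl dotC. Qed.
Lemma dot_ge0 x : 0 <= dot x x.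
Proof. by apply: sumr_ge0 => i _; rewrite -expr2 sqr_ge0. Qed.

Lemma enormE x : enorm x = Num.sqrt (dot x x).
Proof. by congr Num.sqrt; apply: eq_bigr => i _; rewrite expr2. Qed.
Lemma sqr_enorm x : enorm x ^+ 2 = dot x x.
Proof. by rewrite enormE sqr_sqrtr// dot_ge0. Qed.
Lemma enorm_ge0 x : 0 <= enorm x.
Proof. exact: sqrtr_ge0. Qed.
Lemma enormZ a x : enorm (a *: x) = `|a| * enorm x.
Proof. by rewrite !enormE dotZl dotZr mulrA -expr2 sqrtrM ?sqr_ge0// sqrtr_sqr. Qed.
Lemma enormN x : enorm (- x) = enorm x.
Proof. by rewrite -scaleN1r enormZ normrN1 mul1r. Qed.
Lemma enorm0 : enorm (0 : 'cV[R]_k) = 0.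
Proof. by rewrite -(scale0r 0) enormZ normr0 mul0r. Qed.
Lemma enorm_eq0 x : (enorm x == 0) = (x == 0).
Proof.
apply/eqP/eqP => [h|->]; last exact: enorm0.
have : dot x x = 0 by rewrite -sqr_enorm h expr0n.
move/eqP; rewrite psumr_eq0; last by move=> i _; rewrite -expr2 sqr_ge0.
move=> /allP h'; apply/colP => i; rewrite mxE.
by have := h' i (mem_index_enum _); rewrite -expr2 sqrf_eq0 => /eqP.
Qed.

Lemma dot_le x y : dot x y <= enorm x * enorm y.
Proof.
have [->|x0] := eqVneq x 0.
  by rewrite -(scale0r 0) dotZl mul0r mulr_ge0// enorm_ge0.
have ex : 0 < enorm x by rewrite lt_def enorm_eq0 x0 enorm_ge0.
have h := dot_ge0 (enorm y *: x - enorm x *: y).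
move: h; rewrite dotDl !dotDr !dotZl !dotNl !dotNr !dotZl !dotZr.
rewrite (dotC y x) -!sqr_enorm.
have [ey|ey] := ltrP 0 (enorm y); last first.
  have : enorm y = 0 by apply/eqP; rewrite eq_le ey enorm_ge0.
  move/eqP; rewrite enorm_eq0 => /eqP -> _.
  by rewrite dotC -(scale0r 0) dotZl mul0r mulr_ge0// enorm_ge0.
move: (dot x y) (enorm x) (enorm y) ex ey => d a b a0 b0 h.
have ab : 0 < a * b by rewrite mulr_gt0.
rewrite -(ler_pM2l ab); nra.
Qed.

Lemma enormD x y : enorm (x + y) <= enorm x + enorm y.
Proof.
rewrite -ler_sqr ?nnegrE ?addr_ge0 ?enorm_ge0//.
rewrite sqr_enorm dotDl !dotDr (dotC y x) sqrrD !sqr_enorm.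
have := dot_le x y; lra.
Qed.

Lemma enormB x y : enorm (x - y) <= enorm x + enorm y.
Proof. by rewrite -(enormN y) enormD. Qed.

Lemma enorm_dist x y : `|enorm x - enorm y| <= enorm (x - y).
Proof.
rewrite ler_norml; apply/andP; split.
  have := enormB x (x - y); rewrite opprB addrC subrK; lra.
have := enormD (x - y) y; rewrite subrK; lra.
Qed.

Lemma normr_dot_le x y : `|dot x y| <= enorm x * enorm y.
Proof.
rewrite ler_norml dot_le andbT -[leRHS]opprK lerN2 -dotNl.
by rewrite (le_trans (dot_le _ _))// enormN.
Qed.

Lemma le_coord_enorm x i : `|x i 0| <= enorm x.
Proof.
rewrite -ler_sqr ?nnegrE ?enorm_ge0// real_normK ?num_real// sqr_enorm.
rewrite /dot (bigD1 i)//= -expr2 lerDl.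
by apply: sumr_ge0 => j _; rewrite -expr2 sqr_ge0.
Qed.

Lemma enorm_le_sum x : enorm x <= \sum_i `|x i 0|.
Proof.
have h0 : 0 <= \sum_i `|x i 0| by apply: sumr_ge0.
rewrite -ler_sqr ?nnegrE ?enorm_ge0// sqr_enorm expr2 mulr_sumr.
apply: ler_sum => i _; rewrite (le_trans (ler_norm _))// normrM ler_wpM2r//.
by rewrite (bigD1 i)//= lerDl sumr_ge0.
Qed.

(** A crude substitute for the operator norm: it dominates it ([enorm_mulmx]) and is itself
    controlled by the max norm of the matrix space. *)
Definition msum A : R := \sum_i \sum_j `|A i j|.
Lemma msum_ge0 A : 0 <= msum A.
Proof. by apply: sumr_ge0 => i _; apply: sumr_ge0. Qed.

Lemma enorm_mulmx A x : enorm (A *m x) <= msum A * enorm x.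
Proof.
apply: le_trans (enorm_le_sum _) _; rewrite mulr_suml; apply: ler_sum => i _.
rewrite mxE (le_trans (ler_norm_sum _ _ _))// mulr_suml; apply: ler_sum => j _.
by rewrite normrM ler_wpM2l// le_coord_enorm.
Qed.

Lemma le_entry_mx_norm m n (B : 'M[R]_(m, n)) i j : `|B i j| <= `|B|.
Proof.
rewrite [leRHS]/Num.norm/= mx_normrE.
by apply: le_trans (le_bigmax _ (fun ij => `|B ij.1 ij.2|) (i, j)).
Qed.

Lemma enorm_le_norm x : enorm x <= k%:R * `|x|.
Proof.
apply: le_trans (enorm_le_sum _) _.
apply: (@le_trans _ _ (\sum_(i < k) `|x|)); last by rewrite sumr_const card_ord mulr_natl.
by apply: ler_sum => i _; exact: le_entry_mx_norm.
Qed.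

Lemma msum_le_norm A : msum A <= k%:R ^+ 2 * `|A|.
Proof.
apply: (@le_trans _ _ (\sum_(i < k) \sum_(j < k) `|A|)).
  by apply: ler_sum => i _; apply: ler_sum => j _; exact: le_entry_mx_norm.
by rewrite !sumr_const card_ord expr2 -mulrA !mulr_natl.
Qed.

Lemma mx_norm_le m n (B : 'M[R]_(m, n)) c : 0 <= c ->
  (forall i j, `|B i j| <= c) -> `|B| <= c.
Proof.
move=> c0 h; rewrite [leLHS]/Num.norm/= mx_normrE.
by apply/bigmax_leP; split => // -[i j] _ /=; exact: h.
Qed.

End Euclid.

Section Integration.
Variables (R : realType) (k : nat) (k_gt0 : (0 < k)%N).
Notation V := 'cV[R]_k.
Variables (lam : {measure set (k.-tuple R) -> \bar R}) (hlam : is_lebesgue lam).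
Implicit Types (g h : V -> R).

Definition mea g := measurable_fun setT (g \o @tup2cV R k).
Definition meaV (F : V -> V) := forall i, mea (fun x => F x i 0).
Definition itg g := lam.-integrable setT (EFin \o (g \o @tup2cV R k)).
Definition int g : R := \int[lam]_t g (tup2cV t).

Lemma mea_cst c : mea (fun=> c). Proof. exact: measurable_cst. Qed.
Lemma mea_coord i : mea (fun x => x i 0).
Proof.
rewrite /mea (_ : _ \o _ = fun t => tnth t i); first exact: measurable_tnth.
by apply/funext => t /=; rewrite mxE.
Qed.
Lemma meaD g h : mea g -> mea h -> mea (fun x => g x + h x).
Proof. exact: measurable_funD. Qed.
Lemma meaB g h : mea g -> mea h -> mea (fun x => g x - h x).
Proof. exact: measurable_funB. Qed.
Lemma meaM g h : mea g -> mea h -> mea (fun x => g x * h x).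
Proof. exact: measurable_funM. Qed.
Lemma meaX g n : mea g -> mea (fun x => g x ^+ n).
Proof. exact: measurable_funX. Qed.
Lemma mea_sum I (s : seq I) (g : I -> V -> R) :
  (forall i, mea (g i)) -> mea (fun x => \sum_(i <- s) g i x).
Proof. by move=> mg; apply: measurable_sum. Qed.

Lemma mea_nat_of_bool (b : V -> bool) :
  measurable_fun setT (b \o @tup2cV R k) -> mea (fun x => (b x)%:R).
Proof.
move=> mb; rewrite /mea (_ : _ \o _ = fun t => if b (tup2cV t) then 1 else 0).
  by apply: measurable_fun_ifT.
by apply/funext => t /=; case: (b _).
Qed.

Lemma mea_le g h : mea g -> mea h -> mea (fun x => (g x <= h x)%R%:R).
Proof. by move=> mg mh; apply: mea_nat_of_bool; exact: measurable_fun_ler. Qed.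
Lemma mea_lt g h : mea g -> mea h -> mea (fun x => (g x < h x)%R%:R).
Proof. by move=> mg mh; apply: mea_nat_of_bool; exact: measurable_fun_ltr. Qed.

Lemma mea_comp g F : mea g -> meaV F -> mea (g \o F).
Proof.
move=> mg mF.
rewrite /mea (_ : _ \o _ = (g \o @tup2cV R k) \o (@cV2tup R k \o F \o @tup2cV R k)); last first.
  by apply/funext => t /=; rewrite cV2tupK.
apply: (measurableT_comp mg); apply/measurable_fun_tnthP => i.
rewrite (_ : _ \o _ = (fun x => F x i 0) \o @tup2cV R k); first exact: mF.
by apply/funext => t /=; rewrite tnth_mktuple.
Qed.

Lemma meaV_id : meaV id. Proof. by move=> i; exact: mea_coord. Qed.
Lemma meaV_cst v : meaV (fun=> v). Proof. by move=> i; exact: mea_cst. Qed.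
Lemma meaVD F G : meaV F -> meaV G -> meaV (fun x => F x + G x).
Proof.
move=> mF mG i; rewrite (_ : (fun x => _) = fun x => F x i 0 + G x i 0).
  exact: meaD.
by apply/funext => x; rewrite mxE.
Qed.
Lemma meaVZ g F : mea g -> meaV F -> meaV (fun x => g x *: F x).
Proof.
move=> mg mF i; rewrite (_ : (fun x => _) = fun x => g x * F x i 0).
  exact: meaM.
by apply/funext => x; rewrite mxE.
Qed.
Lemma meaV_mul (A : 'M[R]_k) F : meaV F -> meaV (fun x => A *m F x).
Proof.
move=> mF i; rewrite (_ : (fun x => _) = fun x => \sum_j A i j * F x j 0).
  by apply: mea_sum => j; apply: meaM => //; exact: mea_cst.
by apply/funext => x; rewrite mxE.
Qed.
Lemma mea_dot F G : meaV F -> meaV G -> mea (fun x => dot (F x) (G x)).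
Proof. by move=> mF mG; apply: mea_sum => i; exact: meaM. Qed.

Lemma mea_enorm F : meaV F -> mea (fun x => enorm (F x)).
Proof.
move=> mF; rewrite (_ : (fun x => _) = fun x => dot (F x) (F x) `^ (2^-1)).
  exact: (measurableT_comp (@measurable_powR R 2^-1) (mea_dot mF mF)).
by apply/funext => x; rewrite enormE powR12_sqrt// dot_ge0.
Qed.

Lemma mea_inv g : mea g -> (forall x, 0 <= g x) -> mea (fun x => (g x)^-1).
Proof.
move=> mg g0; rewrite (_ : (fun x => _) = fun x => g x `^ (-1)).
  exact: (measurableT_comp (@measurable_powR R (-1)) mg).
by apply/funext => x; rewrite powR_inv1.
Qed.

Lemma itg_mea g : itg g -> mea g.
Proof. by move=> /measurable_int/measurable_EFinP. Qed.

Lemma itg_dom g h : mea g -> itg h -> (forall x, `|g x| <= h x) -> itg g.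
Proof.
move=> mg ih gh; apply: le_integrable ih => //; first exact/measurable_EFinP.
by move=> t _ /=; rewrite lee_fin (le_trans (gh _))// ler_norm.
Qed.

Lemma itgD g h : itg g -> itg h -> itg (fun x => g x + h x).
Proof. by move=> ig ih; have := integrableD measurableT ig ih. Qed.
Lemma itgB g h : itg g -> itg h -> itg (fun x => g x - h x).
Proof. by move=> ig ih; have := integrableB measurableT ig ih. Qed.
Lemma itgZ c g : itg g -> itg (fun x => c * g x).
Proof. by move=> ig; have := integrableZl measurableT c ig. Qed.
Lemma itg_norm g : itg g -> itg (fun x => `|g x|).
Proof. by move=> ig; have := integrable_norm ig. Qed.
Lemma itg0 : itg (fun=> 0).
Proof. exact: integrable0. Qed.
Lemma itg_sum I (s : seq I) (g : I -> V -> R) :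
  (forall i, itg (g i)) -> itg (fun x => \sum_(i <- s) g i x).
Proof.
move=> ig; elim: s => [|i s IH].
  by under eq_fun do rewrite big_nil; exact: itg0.
by under eq_fun do rewrite big_cons; exact: itgD.
Qed.

Lemma itgM_bounded g h M : mea g -> itg h -> (forall x, h x != 0 -> `|g x| <= M) ->
  itg (fun x => g x * h x).
Proof.
move=> mg ih gM; apply: (itg_dom (h := fun x => M * `|h x|)).
- by apply: meaM => //; exact: itg_mea.
- by apply: itgZ; exact: itg_norm.
- move=> x; rewrite normrM; have [->|h0] := eqVneq (h x) 0; first by rewrite normr0 !mulr0.
  by rewrite ler_wpM2r// gM.
Qed.

Lemma intD g h : itg g -> itg h -> int (fun x => g x + h x) = int g + int h.
Proof. by move=> ig ih; rewrite /int RintegralD. Qed.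
Lemma intB g h : itg g -> itg h -> int (fun x => g x - h x) = int g - int h.
Proof. by move=> ig ih; rewrite /int RintegralB. Qed.
Lemma intZ c g : itg g -> int (fun x => c * g x) = c * int g.
Proof. by move=> ig; rewrite /int RintegralZl. Qed.
Lemma int0 : int (fun=> 0) = 0.
Proof. by rewrite /int Rintegral_cst// mul0r. Qed.
Lemma int_sum I (s : seq I) (g : I -> V -> R) :
  (forall i, itg (g i)) -> int (fun x => \sum_(i <- s) g i x) = \sum_(i <- s) int (g i).
Proof.
move=> ig; elim: s => [|i s IH].
  by under eq_fun do rewrite big_nil; rewrite big_nil int0.
under eq_fun do rewrite big_cons.
by rewrite intD// ?IH ?big_cons//; exact: itg_sum.
Qed.
Lemma le_int g h : itg g -> itg h -> (forall x, g x <= h x) -> int g <= int h.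
Proof. by move=> ig ih gh; apply: le_Rintegral. Qed.
Lemma int_ge0 g : (forall x, 0 <= g x) -> 0 <= int g.
Proof. by move=> g0; apply: Rintegral_ge0. Qed.
Lemma normr_int_le g h : mea g -> itg h -> (forall x, `|g x| <= h x) -> `|int g| <= int h.
Proof.
move=> mg ih gh; have ig := itg_dom mg ih gh.
apply: le_trans (le_normr_Rintegral measurableT ig) _.
by apply: (@le_int (fun x => `|g x|) h) => //; exact: itg_norm.
Qed.
Lemma EFin_int g : itg g -> (int g)%:E = (\int[lam]_t (g (tup2cV t))%:E)%E.
Proof. by move=> ig; rewrite /int /Rintegral fineK//; exact: integrable_fin_num. Qed.

Lemma ge0_itg g : mea g -> (forall x, 0 <= g x) ->
  (\int[lam]_t (g (tup2cV t))%:E < +oo)%E -> itg g.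
Proof.
move=> mg g0 gfin; apply/integrableP; split; first exact/measurable_EFinP.
under eq_integral do rewrite /= ger0_norm//.
exact: gfin.
Qed.

Lemma itg_lty g : itg g -> (\int[lam]_t (g (tup2cV t))%:E < +oo)%E.
Proof. by move=> ig; rewrite -EFin_int// ltry. Qed.

Lemma ge0_integral_affine (A : 'M[R]_k) v (G : k.-tuple R -> \bar R) :
  A \in unitmx -> measurable_fun setT G -> (forall t, (0 <= G t)%E) ->
  (\int[lam]_t G (afft A v t) = `|\det A|^-1%:E * \int[lam]_t G t)%E.
Proof.
move=> uA mG G0.
have m1 := ge0_integral_pushforward (measurable_afft A v) lam measurableT mG (in1W G0).
rewrite preimage_setT in m1; rewrite -m1.
have c0 : 0 <= `|\det A|^-1 by rewrite invr_ge0.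
rewrite -(ge0_integral_mscale lam measurableT (NngNum c0) mG (fun x _ => G0 x)).
apply: (@eq_measure_integral _ _ _ setT (mscale (NngNum c0) lam)
  (image_measure lam (measurable_afft A v))) => B mB _.
have E : afft A v @^-1` B = afft A 0 @^-1` (afft 1%:M v @^-1` B).
  by apply/funext => t; rewrite /preimage /mkset afft_comp mul1mx mulmx0 add0r.
have E1 := lebesgue_linear_det hlam k_gt0 uA (measurable_preimage_afft 1%:M v mB).
have E2 := lebesgue_translation_invariant hlam v mB.
exact: (etrans (congr1 lam E) (etrans E1 (congr1 (mule _) E2))).
Qed.

Lemma int_affine (A : 'M[R]_k) v g : A \in unitmx -> itg g ->
  itg (fun x => g (A *m x + v)) /\
  int g = `|\det A| * int (fun x => g (A *m x + v)).
Proof.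
move=> uA ig; have mg := itg_mea ig.
have d0 : 0 < `|\det A| by rewrite normr_gt0 -unitfE -unitmxE.
pose G := EFin \o (g \o @tup2cV R k).
have mG : measurable_fun setT G by exact/measurable_EFinP.
have E : (fun t => (g (A *m tup2cV t + v))%:E) = fun t => G (afft A v t).
  by apply/funext => t; rewrite /G/= cV2tupK.
have mag : mea (fun x => g (A *m x + v)).
  by apply: mea_comp => //; apply: meaVD; [apply: meaV_mul; exact: meaV_id|exact: meaV_cst].
have iag : itg (fun x => g (A *m x + v)).
  apply/integrableP; split; first exact/measurable_EFinP.
  have := ge0_integral_affine v uA (measurableT_comp (@abse_measurable R setT) mG : measurable_fun setT (abse \o G)).
  move=> /(_ (fun t => abse_ge0 _)) h.
  have -> : (fun t => `|((g (A *m tup2cV t + v))%:E)%E|%E) =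
     (fun t => (abse \o G) (afft A v t)) by apply/funext => t /=; rewrite cV2tupK.
  rewrite h; have /integrableP[_ h2] := ig.
  by rewrite lte_mul_pinfty ?lee_fin ?invr_ge0 ?(ltW d0).
split=> //; rewrite /int /Rintegral E.
have E2 : (\int[lam]_t G (afft A v t) = `|\det A|^-1%:E * \int[lam]_t G t)%E.
  rewrite integralE [in RHS]integralE.
  have hp := ge0_integral_affine v uA (measurable_funepos mG) (fun t => funepos_ge0 G t).
  have hn := ge0_integral_affine v uA (measurable_funeneg mG) (fun t => funeneg_ge0 G t).
  rewrite -[fun t => G (afft A v t)]/(G \o afft A v) funepos_comp funeneg_comp /= hp hn.
  have fc : (`|\det A|^-1)%:E \is a fin_num by [].
  exact: (esym (muleBr fc (integrable_add_def measurableT ig))).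
rewrite E2 fineM//; last exact: integrable_fin_num.
by rewrite /= mulrA mulfV ?mul1r// gt_eqF.
Qed.

Lemma itg_ball (s : R) : itg (fun x => (enorm x <= s)%R%:R).
Proof.
have m1 : mea (fun x => (enorm x <= s)%R%:R).
  by apply: mea_le; [apply: mea_enorm; exact: meaV_id|exact: mea_cst].
pose n := Num.bound s.
pose C : set (k.-tuple R) := @cube R k n.
have mC : measurable C by exact: measurable_box.
have : lam.-integrable setT (EFin \o (\1_C : _ -> R)).
  apply/integrableP; split; first by apply/measurable_EFinP; exact: measurable_indic.
  under eq_integral do rewrite gee0_abs ?lee_fin//.
  by rewrite integral_indic// setIT; exact: lebesgue_cube_lty.
apply: le_integrable => //; first exact/measurable_EFinP.
move=> t _ /=; rewrite lee_fin ger0_norm// [leRHS]ger0_norm//.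
case: (lerP (enorm (tup2cV t)) s) => // h.
rewrite indicE mem_set// => i; rewrite !tnth_mktuple -ler_norml.
have := le_coord_enorm (tup2cV t) i; rewrite mxE => h1.
apply: (le_trans h1); apply: (le_trans h).
have [s0|s0] := lerP 0 s; first by rewrite ltW// archi_boundP.
by rewrite (le_trans (ltW s0)).
Qed.

End Integration.

(** * Polar coordinates *)

Section StarShaped.
Variables (R : realType) (k : nat) (k_gt0 : (0 < k)%N).
Notation V := 'cV[R]_k.
Variables (lam : {measure set (k.-tuple R) -> \bar R}) (hlam : is_lebesgue lam).
Implicit Types (g h u a : V -> R).
Local Notation itg := (itg lam).
Local Notation int := (int lam).

Definition homogeneous0 u := forall c x, 0 < c -> u (c *: x) = u x.

Lemma itg_bounded_ball g M s : mea g -> (forall x, `|g x| <= M * (enorm x <= s)%R%:R) ->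
  itg g.
Proof. by move=> mg gM; apply: itg_dom gM => //; apply: itgZ; exact: itg_ball. Qed.

Lemma int_scale c g : 0 < c -> itg g ->
  itg (fun x => g (c *: x)) /\ int g = c ^+ k * int (fun x => g (c *: x)).
Proof.
move=> c0 ig.
have uc : (c%:M : 'M[R]_k) \in unitmx by rewrite unitmxE det_scalar unitfE expf_neq0// gt_eqF.
have := int_affine k_gt0 hlam 0 uc ig.
have -> : (fun x => g (c%:M *m x + 0)) = (fun x => g (c *: x)).
  by apply/funext => x; rewrite mul_scalar_mx addr0.
by rewrite det_scalar ger0_norm// exprn_ge0// ltW.
Qed.

Lemma mea_ball s : mea (fun x : V => (enorm x <= s)%R%:R).
Proof. by apply: mea_le; [apply: mea_enorm; exact: meaV_id|exact: mea_cst]. Qed.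

(** Dilation by [s] leaves [u] unchanged and has Jacobian s^k. *)
Lemma int_homogeneous_ball u M rho s : mea u -> homogeneous0 u -> (forall x, `|u x| <= M) ->
  0 < rho -> 0 < s ->
  int (fun x => u x * (enorm x <= rho * s)%R%:R) =
  s ^+ k * int (fun x => u x * (enorm x <= rho)%R%:R).
Proof.
move=> mu hu uM rho0 s0.
have ig : itg (fun x => u x * (enorm x <= rho * s)%R%:R).
  apply: (@itg_bounded_ball _ M (rho * s)); first by apply: meaM => //; exact: mea_ball.
  by move=> x; rewrite normrM normr_nat ler_wpM2r.
have [_ ->] := int_scale s0 ig; congr (_ * int _); apply/funext => x.
by rewrite hu// enormZ gtr0_norm// [rho * s]mulrC ler_pM2l.
Qed.

Lemma sum_unit_cells (y : R) m : 0 <= y ->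
  \sum_(j < m) ((j%:R <= y)%R%:R * (y < j.+1%:R)%R%:R) = (y < m%:R)%R%:R :> R.
Proof.
move=> y0; elim: m => [|m IH]; first by rewrite big_ord0 ltNge y0.
rewrite big_ord_recr/= IH.
case: (ltrP y m%:R) => h1.
  have h2 : y < m.+1%:R by rewrite (lt_le_trans h1)// ler_nat.
  by rewrite h2 mul0r addr0.
by rewrite mul1r add0r.
Qed.

(** A Lipschitz bound for the n-th power; the 3 is the largest value of a + e. *)
Lemma exprD_le (a e : R) n : 0 <= a <= 2 -> 0 <= e <= 1 ->
  (a + e) ^+ n <= a ^+ n + n%:R * 3 ^+ n * e.
Proof.
move=> /andP[a0 a2] /andP[e0 e1]; elim: n => [|n IH]; first by rewrite !expr0; lra.
rewrite exprS.
apply: le_trans (ler_wpM2l (addr_ge0 a0 e0) IH) _.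
have h1 : a ^+ n <= 3 ^+ n by apply: lerXn2r; rewrite ?nnegrE; lra.
have h2 : 0 <= n%:R * 3 ^+ n * e by rewrite !mulr_ge0.
have h3 : a + e <= 3 by lra.
rewrite !exprS -(natr1 n).
have h0 : 0 <= a ^+ n by rewrite exprn_ge0.
have h4 : 0 <= (3 : R) ^+ n by rewrite exprn_ge0.
rewrite mulrDr.
have : (a + e) * (n%:R * 3 ^+ n * e) <= 3 * (n%:R * 3 ^+ n * e) by rewrite ler_wpM2r.
have : e * a ^+ n <= e * 3 ^+ n by rewrite ler_wpM2l.
have : 0 <= e * 3 ^+ n by rewrite mulr_ge0.
by move: (a ^+ n) (3 ^+ n : R) (n%:R : R) => A T m *; lra.
Qed.

Section Star.
Variables (u a : V -> R) (M rho : R).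
Hypotheses (mu : mea u) (hu : homogeneous0 u) (uM : forall x, 0 <= u x <= M).
Hypotheses (ma : mea a) (ha : homogeneous0 a) (a02 : forall x, 0 <= a x <= 2).
Hypothesis rho0 : 0 < rho.

Let B (x : V) : R := (enorm x <= rho)%R%:R.
(** Directions are sorted by the value of [a] up to 1/N. Each cell is a cone, so integrals over it
    scale exactly with the radius, and on it the star set lies between two balls. *)
Let cell N j (x : V) : R := (j%:R <= N%:R * a x)%R%:R * (N%:R * a x < j.+1%:R)%R%:R.

Let M0 : 0 <= M. Proof. by have /andP[h1 h2] := uM 0; exact: le_trans h2. Qed.
Let normu x : `|u x| <= M. Proof. by have /andP[h1 h2] := uM x; rewrite ger0_norm. Qed.
Let mcell N j : mea (cell N j).
Proof.
apply: meaM; [apply: mea_le|apply: mea_lt];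
  by [exact: mea_cst|apply: meaM => //; exact: mea_cst].
Qed.
Let hcell N j : homogeneous0 (cell N j).
Proof. by move=> c x c0; rewrite /cell ha. Qed.
Let cell01 N j x : 0 <= cell N j x <= 1.
Proof. by rewrite /cell -natrM mulnb ler0n lern1 leq_b1. Qed.
Let cell_sum N x : (0 < N)%N -> \sum_(j < (2 * N).+1) cell N j x = 1.
Proof.
move=> N0; rewrite sum_unit_cells; last by rewrite mulr_ge0//; case/andP: (a02 x).
have /andP[_ a2] := a02 x.
suff -> : N%:R * a x < (2 * N).+1%:R by [].
apply: (@le_lt_trans _ _ (2 * N)%:R); last by rewrite ltr_nat.
by rewrite mulnC natrM ler_wpM2l.
Qed.
Let star (x : V) : R := u x * (enorm x <= rho * a x)%R%:R.
Let power (x : V) : R := u x * a x ^+ k * B x.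

Let mstar : mea star.
Proof.
apply: meaM => //; apply: mea_le; first by apply: mea_enorm; exact: meaV_id.
by apply: meaM => //; exact: mea_cst.
Qed.
Let istar : itg star.
Proof.
apply: (@itg_bounded_ball _ M (rho * 2)) => // x.
rewrite normrM normr_nat; apply: ler_pM => //.
have /andP[a0 a2] := a02 x; rewrite ler_nat.
case: (lerP (enorm x) (rho * a x)) => // h.
by rewrite (le_trans h)// ler_pM2l.
Qed.
Let ipower : itg power.
Proof.
apply: (@itg_bounded_ball _ (M * 2 ^+ k) rho).
  by apply: meaM; [apply: meaM => //; exact: meaX|exact: mea_ball].
move=> x; rewrite /power/B normrM normr_nat ler_wpM2r// normrM normrX.
have /andP[a0 a2] := a02 x; rewrite (ger0_norm a0) ler_pM// ?exprn_ge0//.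
by rewrite ler_pXn2r ?nnegrE.
Qed.
Let iuB : itg (fun x => u x * B x).
Proof.
apply: (@itg_bounded_ball _ M rho); first by apply: meaM => //; exact: mea_ball.
by move=> x; rewrite /B normrM normr_nat ler_wpM2r.
Qed.
Let icuB N j : itg (fun x => cell N j x * u x * B x).
Proof.
apply: (itg_dom (h := fun x => u x * B x)) => //.
  by apply: meaM; [exact: meaM|exact: mea_ball].
move=> x; have /andP[c0 c1] := cell01 N j x; have /andP[u0 _] := uM x.
by rewrite !normrM !ger0_norm// /B// ler_wpM2r// ler_piMl.
Qed.
Let icub N j s : itg (fun x => cell N j x * u x * (enorm x <= s)%R%:R).
Proof.
apply: (@itg_bounded_ball _ M s).
  by apply: meaM; [exact: meaM|exact: mea_ball].
move=> x; rewrite normrM normr_nat ler_wpM2r//.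
have /andP[c0 c1] := cell01 N j x; have /andP[u0 _] := uM x.
by rewrite normrM !ger0_norm// (le_trans _ (normu x))// ger0_norm// ler_piMl.
Qed.

Let cell_ball N j s : 0 < s ->
  int (fun x => cell N j x * u x * (enorm x <= rho * s)%R%:R) =
  s ^+ k * int (fun x => cell N j x * u x * B x).
Proof.
move=> s0; apply: (@int_homogeneous_ball (fun x => cell N j x * u x) M) => //.
- exact: meaM.
- by move=> c x c0; rewrite hcell// hu.
- move=> x; have /andP[c0 c1] := cell01 N j x; have /andP[u0 _] := uM x.
  by rewrite normrM !ger0_norm// (le_trans _ (normu x))// ger0_norm// ler_piMl.
Qed.

Let K : R := k%:R * 3 ^+ k.
Let K0 : 0 <= K. Proof. by rewrite mulr_ge0// exprn_ge0. Qed.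

(** On cell j the star set lies in the ball of radius rho (j + 1)/N. There (j + 1)/N exceeds [a] by
    at most 1/N, which costs K / N after taking k-th powers. *)
Let star_upper N : (0 < N)%N -> int star <= int power + K / N%:R * int (fun x => u x * B x).
Proof.
move=> N0; have NR : 0 < N%:R :> R by rewrite ltr0n.
rewrite -intZ// -intD//; last exact: itgZ.
apply: (@le_trans _ _ (int (fun x => \sum_(j < (2 * N).+1)
    cell N j x * u x * (enorm x <= rho * (j.+1%:R / N%:R))%R%:R))).
  apply: le_int => //; first by apply: itg_sum => j; exact: icub.
  move=> x; rewrite -[leLHS]mul1r -[X in X * _ <= _](cell_sum x N0) mulr_suml; apply: ler_sum => j _.
  rewrite /star mulrA; have /andP[u0 _] := uM x.
  rewrite /cell; case: (lerP j%:R) => h1; rewrite ?mul0r//.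
  case: (ltrP _ j.+1%:R) => h2; rewrite ?mulr0 ?mul0r// !mul1r ler_wpM2l// ler_nat.
  case: (lerP (enorm x) (rho * a x)) => // h; rewrite (le_trans h)//.
  by rewrite ler_pM2l// ler_pdivlMr// mulrC ltW.
rewrite int_sum; last by move=> j; exact: icub.
under eq_bigr => j _ do rewrite cell_ball ?divr_gt0// -intZ//.
rewrite -int_sum; last by move=> j; exact: itgZ.
apply: le_int; [by apply: itg_sum => j; exact: itgZ|by apply: itgD => //; exact: itgZ|].
move=> x; rewrite -[leRHS]mul1r -[X in _ <= X * _](cell_sum x N0) mulr_suml; apply: ler_sum => j _.
have /andP[u0 _] := uM x.
rewrite /cell /power; case: (lerP j%:R) => h1; rewrite ?mul0r ?mulr0//.
case: (ltrP _ j.+1%:R) => h2; rewrite ?mulr0 ?mul0r ?mulr0// !mul1r.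
rewrite [leLHS]mulrA [X in X <= _](_ : _ = (j.+1%:R / N%:R) ^+ k * (u x * B x)); last by ring.
rewrite [leRHS](_ : _ = (a x ^+ k + K / N%:R) * (u x * B x)); last by rewrite /B; ring.
apply: ler_wpM2r; first by rewrite mulr_ge0.
apply: (@le_trans _ _ ((a x + N%:R^-1) ^+ k)).
  rewrite ler_pXn2r ?nnegrE ?divr_ge0//; last first.
    by rewrite addr_ge0 ?invr_ge0//; case/andP: (a02 x).
  by rewrite ler_pdivrMr// mulrDl mulVf ?gt_eqF// -natr1 lerD2r mulrC.
apply: exprD_le => //; rewrite invr_ge0 ler0n /= invf_le1 // ler1n //.
Qed.

Let star_lower N : (0 < N)%N -> int power - K / N%:R * int (fun x => u x * B x) <= int star.
Proof.
move=> N0; have NR : 0 < N%:R :> R by rewrite ltr0n.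
rewrite lerBlDr -intZ//.
apply: (@le_trans _ _ (int (fun x => (\sum_(j < (2 * N).+1)
    cell N j x * u x * (enorm x <= rho * (j%:R / N%:R))%R%:R) + K / N%:R * (u x * B x)))); last first.
  rewrite intD; [|by apply: itg_sum => j; exact: icub|exact: itgZ].
  rewrite lerD2r; apply: le_int => //; first by apply: itg_sum => j; exact: icub.
  move=> x; rewrite -[leRHS]mul1r -[X in _ <= X * _](cell_sum x N0) mulr_suml; apply: ler_sum => j _.
  rewrite /star [leRHS]mulrA; have /andP[u0 _] := uM x.
  rewrite /cell; case: (lerP j%:R) => h1; rewrite ?mul0r//.
  case: (ltrP _ j.+1%:R) => h2; rewrite ?mulr0 ?mul0r// !mul1r ler_wpM2l// ler_nat.
  case: (lerP (enorm x) (rho * (j%:R / N%:R))) => // h; rewrite (le_trans h)//.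
  by rewrite ler_pM2l// ler_pdivrMr// mulrC.
rewrite intD; [|by apply: itg_sum => j; exact: icub|exact: itgZ].
rewrite int_sum; last by move=> j; exact: icub.
apply: (@le_trans _ _ ((\sum_(j < (2 * N).+1) int (fun x => (j%:R / N%:R) ^+ k * (cell N j x * u x * B x)))
   + int (fun x => K / N%:R * (u x * B x)))); last first.
  rewrite lerD2r; apply: ler_sum => j _; rewrite intZ//.
  (* For j = 0 the inner ball has radius 0, which [cell_ball] excludes; the left term vanishes
     because 0 ^+ k = 0 for k > 0. *)
  case: j => -[|j] hj /=.
    rewrite mul0r expr0n eqn0Ngt k_gt0 mul0r; apply: int_ge0 => x.
    by have /andP[u0 _] := uM x; have /andP[c0 _] := cell01 N 0 x;
       apply: mulr_ge0; [apply: mulr_ge0|rewrite ler0n].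
  by rewrite cell_ball ?divr_gt0.
rewrite -int_sum; last by move=> j; exact: itgZ.
rewrite -intD; [|by apply: itg_sum => j; exact: itgZ|exact: itgZ].
apply: le_int => //; first by apply: itgD; [apply: itg_sum => j|]; exact: itgZ.
move=> x; rewrite -[X in _ <= _ + X]mul1r -[leLHS]mul1r.
rewrite -[X in X * _ <= _](cell_sum x N0) -[X in _ <= _ + X * _](cell_sum x N0) !mulr_suml -big_split.
apply: ler_sum => j _ /=.
have /andP[u0 _] := uM x; have /andP[a0 a2] := a02 x.
rewrite /cell /power; case: (lerP j%:R) => h1; rewrite ?mul0r ?mulr0 ?addr0//.
case: (ltrP _ j.+1%:R) => h2; rewrite ?mulr0 ?mul0r ?mulr0 ?addr0// !mul1r.
rewrite [X in _ <= X](_ : _ = ((j%:R / N%:R) ^+ k + K / N%:R) * (u x * B x)); last by ring.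
rewrite [leLHS](_ : _ = a x ^+ k * (u x * B x)); last by rewrite /B; ring.
apply: ler_wpM2r; first by rewrite mulr_ge0.
have jN0 : 0 <= j%:R / N%:R :> R by rewrite divr_ge0.
apply: (@le_trans _ _ ((j%:R / N%:R + N%:R^-1) ^+ k)).
  rewrite ler_pXn2r ?nnegrE ?addr_ge0 ?invr_ge0//.
  by rewrite -[X in _ + X]mul1r -mulrDl ler_pdivlMr// mulrC natr1 ltW.
apply: exprD_le => //; last by rewrite invr_ge0 ler0n /= invf_le1 // ler1n //.
rewrite jN0 /= ler_pdivrMr// (le_trans h1)// mulrC ler_wpM2r//.
Qed.

Lemma int_star_ge0 : int star = int power.
Proof.
pose D := int (fun x => u x * B x).
have D0 : 0 <= D by apply: int_ge0 => x; have /andP[? _] := uM x; rewrite mulr_ge0.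
have small (e : R) : 0 < e -> exists2 N, (0 < N)%N & K / N%:R * D <= e.
  move=> e0; exists (Num.bound (K * D / e)).+1 => //.
  rewrite mulrAC ler_pdivrMr ?ltr0n// [leRHS]mulrC -ler_pdivrMr//.
  have h : 0 <= K * D / e by rewrite divr_ge0 ?mulr_ge0// ltW.
  by rewrite (le_trans (ltW (archi_boundP h)))// ler_nat.
apply/eqP; rewrite eq_le; apply/andP; split; apply/ler_addgt0Pr => e e0;
  have [N N0 h] := small e e0.
  by apply: (le_trans (star_upper N0)); rewrite lerD2l.
by have := star_lower N0; rewrite -/D; lra.
Qed.

End Star.

(* Polar coordinates: on each cone of directions Lebesgue measure scales like [s ^+ k]. *)
Lemma int_star u a M rho : mea u -> homogeneous0 u -> (forall x, `|u x| <= M) ->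
  mea a -> homogeneous0 a -> (forall x, 0 <= a x <= 2) -> 0 < rho ->
  int (fun x => u x * (enorm x <= rho * a x)%R%:R) =
  int (fun x => u x * a x ^+ k * (enorm x <= rho)%R%:R).
Proof.
move=> mu hu uM ma ha a02 rho0.
have M0 : 0 <= M by rewrite (le_trans _ (uM 0)).
(* A signed [u] is the difference of the nonnegative homogeneous functions u + M and M. *)
pose w x := u x + M.
have mw : mea w by apply: meaD => //; exact: mea_cst.
have h1 : homogeneous0 w by move=> c x c0; rewrite /w hu.
have w02 x : 0 <= w x <= 2 * M.
  by have := uM x; rewrite ler_norml /w => /andP[? ?]; apply/andP; split; lra.
have E1 := int_star_ge0 mw h1 w02 ma ha a02 rho0.
have E2 := @int_star_ge0 (fun=> M) a M rho (mea_cst _) (fun c x _ => erefl)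
   (fun x => introT andP (conj M0 (lexx M))) ma ha a02 rho0.
have mS : mea (fun x => (enorm x <= rho * a x)%R%:R).
  apply: mea_le; first by apply: mea_enorm; exact: meaV_id.
  by apply: meaM => //; exact: mea_cst.
have gi v C : mea v -> (forall x, `|v x| <= C) -> itg (fun x => v x * (enorm x <= rho * a x)%R%:R).
  move=> mv vC; apply: (@itg_bounded_ball _ C (rho * 2)); first exact: meaM.
  move=> x; rewrite normrM normr_nat; apply: ler_pM => //.
  have /andP[a0 a2] := a02 x; rewrite ler_nat.
  by case: (lerP (enorm x) (rho * a x)) => // h; rewrite (le_trans h)// ler_pM2l.
have gp v C : mea v -> (forall x, `|v x| <= C) -> itg (fun x => v x * a x ^+ k * (enorm x <= rho)%R%:R).
  move=> mv vC; apply: (@itg_bounded_ball _ (C * 2 ^+ k) rho).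
    by apply: meaM; [apply: meaM => //; exact: meaX|exact: mea_ball].
  move=> x; rewrite normrM normr_nat ler_wpM2r// normrM normrX.
  have /andP[a0 a2] := a02 x; rewrite (ger0_norm a0) ler_pM// ?exprn_ge0//.
  by rewrite ler_pXn2r ?nnegrE.
have nw x : `|w x| <= 2 * M by have /andP[? ?] := w02 x; rewrite ger0_norm.
have nM (x : V) : `|M| <= M by rewrite ger0_norm.
rewrite [LHS](_ : _ = int (fun x => w x * (enorm x <= rho * a x)%R%:R
   - M * (enorm x <= rho * a x)%R%:R)); last first.
  by congr int; apply/funext => x; rewrite /w; ring.
rewrite [RHS](_ : _ = int (fun x => w x * a x ^+ k * (enorm x <= rho)%R%:R
   - M * a x ^+ k * (enorm x <= rho)%R%:R)); last first.
  by congr int; apply/funext => x; rewrite /w; ring.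
rewrite !intB ?E1 ?E2//.
- exact: (gp _ _ mw nw).
- exact: (gp _ _ (mea_cst _) nM).
- exact: (gi _ _ mw nw).
- exact: (gi _ _ (mea_cst _) nM).
Qed.

End StarShaped.

(** * Hadamard's inequality *)

Section Hadamard.
Variable R : realType.

Definition quad n (A : 'M[R]_n) (x : 'cV[R]_n) : R := (x^T *m A *m x) 0 0.
Definition is_psd n (A : 'M[R]_n) := A^T = A /\ forall x, 0 <= quad A x.

Lemma quad_sum n (A : 'M[R]_n) x : quad A x = \sum_i \sum_j A i j * (x i 0 * x j 0).
Proof.
rewrite /quad mxE exchange_big /=; apply: eq_bigr => j _.
rewrite mxE mulr_suml; apply: eq_bigr => i _; rewrite mxE; ring.
Qed.

Lemma quad_delta n (A : 'M[R]_n) i : quad A (delta_mx i 0) = A i i.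
Proof.
rewrite /quad trmx_delta -rowE mxE (bigD1 i)//= !mxE !eqxx mulr1 big1 ?addr0// => j ji.
by rewrite !mxE (negbTE ji) mulr0.
Qed.

Lemma psd_diag_ge0 n (A : 'M[R]_n) i : is_psd A -> 0 <= A i i.
Proof. by move=> [_ h]; rewrite -quad_delta. Qed.

Lemma quad_block n (a : 'M[R]_1) (b : 'rV[R]_n) (D : 'M[R]_n)
    (t : 'cV[R]_1) (x : 'cV[R]_n) :
  quad (block_mx a b b^T D) (col_mx t x) =
  a 0 0 * t 0 0 ^+ 2 + 2 * t 0 0 * (b *m x) 0 0 + quad D x.
Proof.
rewrite /quad tr_col_mx mul_row_block mul_row_col mulmxDl mulmxDl !mxE.
have -> : \sum_j (t^T *m a) 0 j * t j 0 = a 0 0 * t 0 0 ^+ 2.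
  by rewrite big_ord1 mxE big_ord1 mxE expr2 mulrAC mulrC mulrA mulrAC.
have -> : \sum_j (x^T *m b^T) 0 j * t j 0 = t 0 0 * \sum_j b 0 j * x j 0.
  rewrite big_ord1 mxE mulrC; congr (_ * _); apply: eq_bigr => i _.
  by rewrite !mxE mulrC.
have -> : \sum_j (t^T *m b) 0 j * x j 0 = t 0 0 * \sum_j b 0 j * x j 0.
  rewrite mulr_sumr; apply: eq_bigr => i _; rewrite mxE big_ord1 mxE; ring.
ring.
Qed.

(** Induction through the Schur complement [S] of the first entry: det A = a det S, [S] is again
    positive semidefinite, and its diagonal lies below that of [D]. A zero pivot forces its whole
    row to vanish. *)
Lemma hadamard n (A : 'M[R]_n) : is_psd A -> 0 <= \det A <= \prod_i A i i.
Proof.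
elim: n A => [|n IH] A; first by rewrite det_mx00 big_ord0 lexx ler01.
move=> pA; have [sA qA] := pA.
have prodE : \prod_i A i i = A 0 0 * \prod_i A (lift 0 i) (lift 0 i) by rewrite big_ord_recl.
pose a := ulsubmx (A : 'M[R]_(1 + n)); pose b := ursubmx (A : 'M[R]_(1 + n)).
pose D := drsubmx (A : 'M[R]_(1 + n)).
have AE : A = block_mx a b b^T D.
  by rewrite -[LHS](@submxK _ 1 n 1 n) /b trmx_ursub sA.
have a00 : a 0 0 = A 0 0 by rewrite !mxE; congr (A _ _); apply: val_inj.
have Dii i : D i i = A (lift 0 i) (lift 0 i).
  by rewrite !mxE; congr (A _ _); apply: val_inj.
have prod0 : 0 <= \prod_i A i i by apply: prodr_ge0 => i _; exact: psd_diag_ge0.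
have qb (t : 'cV[R]_1) (x : 'cV[R]_n) : 0 <= a 0 0 * t 0 0 ^+ 2 + 2 * t 0 0 * (b *m x) 0 0 + quad D x.
  by rewrite -quad_block -AE.
have a0 : 0 <= a 0 0 by rewrite a00; exact: psd_diag_ge0.
have [az|an] := eqVneq (a 0 0) 0.
  have b0 : b = 0.
    apply/rowP => j; rewrite [RHS]mxE; apply/eqP; apply: contraT => bj.
    (* With a zero pivot the form is affine in the first coordinate; this value makes it equal to
       -1. *)
    have := qb (const_mx (- (D j j + 1) / (2 * b 0 j))) (delta_mx j 0).
    rewrite az mul0r add0r quad_delta -colE [const_mx _ _ _]mxE [col _ _ _ _]mxE.
    have -> : 2 * (- (D j j + 1) / (2 * b 0 j)) * b 0 j = - (D j j + 1).
      by move: (D j j) (b 0 j) bj => d c c0; field.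
    by rewrite opprD addrAC addNr add0r oppr_ge0 ler10.
  have -> : \det A = 0.
    rewrite AE b0 (_ : a = 0) ?trmx0.
      by rewrite (@det_ublock _ 1 n) det_mx11 mxE mul0r.
    by apply/matrixP => i j; rewrite !ord1 az mxE.
  by rewrite lexx.
have ap : 0 < a 0 0 by rewrite lt_def an a0.
pose S := D - (a 0 0)^-1 *: (b^T *m b).
have detE : \det A = a 0 0 * \det S.
  have -> : A = (block_mx 1%:M 0 ((a 0 0)^-1 *: b^T) 1%:M *m block_mx a b 0 S : 'M[R]_(1 + n)).
    have e1 : (a 0 0)^-1 *: b^T *m a = b^T.
      by rewrite [X in _ *m X = _]mx11_scalar mul_mx_scalar scalerA mulfV// scale1r.
    have e2 : (a 0 0)^-1 *: b^T *m b + S = D.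
      by rewrite /S -scalemxAl addrC subrK.
    by rewrite mulmx_block !mul1mx !mul0mx !addr0 e1 e2 -AE.
  by rewrite det_mulmx (@det_lblock _ 1 n) (@det_ublock _ 1 n) !det1 !mul1r det_mx11.
have pS : is_psd S.
  split; first by rewrite /S linearB/= linearZ/= trmx_mul trmxK /D trmx_drsub sA.
  (* The first coordinate minimizing the form at given [x]; the minimum is the form of the Schur
     complement. *)
  move=> x; have := qb (const_mx (- (b *m x) 0 0 / a 0 0)) x; rewrite [const_mx _ _ _]mxE.
  suff -> : quad S x = quad D x - (a 0 0)^-1 * (b *m x) 0 0 ^+ 2.
    have -> : a 0 0 * (- (b *m x) 0 0 / a 0 0) ^+ 2 +
      2 * (- (b *m x) 0 0 / a 0 0) * (b *m x) 0 0 = - (a 0 0)^-1 * (b *m x) 0 0 ^+ 2.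
      by field.
    lra.
  have h : (x^T *m (b^T *m b) *m x) 0 0 = (b *m x) 0 0 ^+ 2.
    by rewrite mulmxA -mulmxA -trmx_mul mxE big_ord1 expr2 mxE.
  by rewrite /quad /S mulmxBr mulmxBl -scalemxAr -scalemxAl -h !mxE.
have /andP[S0 S1] := IH S pS.
rewrite detE mulr_ge0//= prodE -a00 ler_wpM2l// (le_trans S1)//.
apply: ler_prod => i _; rewrite psd_diag_ge0//= -Dii.
have -> : S i i = D i i - (a 0 0)^-1 * b 0 i ^+ 2.
  by rewrite /S !mxE big_ord1 !mxE expr2.
by rewrite gerBl mulr_ge0 ?invr_ge0// sqr_ge0.
Qed.

Lemma det_le1_of_trace n (A : 'M[R]_n) : is_psd A -> \tr A <= n%:R -> \det A <= 1.
Proof.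
case: n A => [|n] A pA tA; first by rewrite det_mx00.
have /andP[_ h] := hadamard pA; apply: (le_trans h).
have n0 : 0 < n.+1%:R :> R by rewrite ltr0n.
(* Puts the entries in the n-fold form of [leif_AGM_scaled], so that the AM-GM bound becomes a power
   of tr A / n. *)
have E i : A i i = A i i / n.+1%:R *+ n.+1.
  by rewrite -mulr_natr -mulrA mulVf ?mulr1// gt_eqF.
have h2 := @leif_AGM_scaled R 'I_n.+1 predT (fun i => A i i / n.+1%:R).
rewrite cardT size_enum_ord in h2.
have {}h2 := (h2 (fun i _ => _)).1.
rewrite (eq_bigr _ (fun i _ => E i)); apply: le_trans (h2 _) _.
  by move=> i; rewrite -E psd_diag_ge0.
rewrite -mulr_suml exprn_ile1//.
  by rewrite divr_ge0// sumr_ge0// => i _; exact: psd_diag_ge0.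
by rewrite ler_pdivrMr// mul1r.
Qed.

End Hadamard.

(** * Functions near a sphere *)

Lemma mx_continuousP (R : realType) m n (g : 'M[R]_(m, n) -> R) v :
  {for v, continuous g} <->
  forall e, 0 < e -> exists2 d, 0 < d & forall w, `|v - w| < d -> `|g v - g w| <= e.
Proof.
split=> [/(@cvgrPdist_le _ _ _ _ (nbhs_filter v)) h e e0|h].
  by have /nbhs_normP[d /= d0 hd] := h e e0; exists d.
apply/(@cvgrPdist_le _ _ _ _ (nbhs_filter v)) => e e0.
have [d d0 hd] := h e e0.
by apply/(@nbhs_normP R 'M[R]_(m, n) v (fun w => `|g v - g w| <= e)); exists d.
Qed.

Section SphereCompactness.
Variables (R : realType) (k : nat) (rho : R).
Notation V := 'cV[R]_k.

(** The sphere is written in row vectors, the form in which [bounded_closed_compact] applies. *)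
Let S : set 'rV[R]_k := [set v | enorm v^T = rho].

Let enorm_tr_dist (v w : 'rV[R]_k) : `|enorm v^T - enorm w^T| <= k%:R * `|v - w|.
Proof.
apply: le_trans (enorm_dist _ _) _; rewrite -linearB/=.
apply: le_trans (enorm_le_norm _) _; rewrite ler_wpM2l//.
by apply: mx_norm_le => // i j; rewrite mxE; exact: le_entry_mx_norm.
Qed.

Let continuous_enorm_tr : continuous (fun v : 'rV[R]_k => enorm v^T).
Proof.
move=> v; apply/mx_continuousP => e e0.
have k1 : 0 < k%:R + 1 :> R by rewrite ltr_wpDl.
exists ((k%:R + 1)^-1 * e) => /= [|w vw].
  by rewrite mulr_gt0// invr_gt0.
apply: le_trans (enorm_tr_dist _ _) _.
apply: (@le_trans _ _ ((k%:R + 1) * `|v - w|)).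
  by rewrite ler_wpM2r// lerDl.
by rewrite -ler_pdivlMl// ltW.
Qed.

Let compactS : compact S.
Proof.
apply: bounded_closed_compact.
  exists rho; split; first exact: num_real.
  move=> M rM v Sv /=; apply: mx_norm_le => [|i j].
    by rewrite (le_trans _ (ltW rM))// -[rho]Sv enorm_ge0.
  rewrite (ord1 i) (le_trans _ (ltW rM))// -[rho]Sv.
  by have := le_coord_enorm v^T j; rewrite mxE.
rewrite (_ : S = (fun v : 'rV[R]_k => enorm v^T) @^-1` [set rho])//.
by apply: preimage_closed => [v _|]; [exact: continuous_enorm_tr|exact: closed_eq].
Qed.

(** Compactness as a local-to-uniform principle. The parameter e serves in turn as a modulus of
    continuity, as a positive lower bound, and through its inverse as an upper bound. *)
Lemma sphere_cover (P : R -> V -> Prop) :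
  (forall w, enorm w = rho -> exists2 r, 0 < r & exists2 d, 0 < d &
     forall w' e, enorm (w' - w) < r -> 0 < e < d -> P e w') ->
  exists2 d, 0 < d & forall w e, enorm w = rho -> 0 < e < d -> P e w.
Proof.
move=> h.
have /compact_near_coveringP/(_ R (0^'+) (fun e v => P e v^T) _) := compactS.
case=> [v Sv|].
  have [r r0 [d d0 hP]] := h _ Sv.
  exists ([set w | `|v - w| < r / (k%:R + 1)], [set e | 0 < e < d]) => /=.
    split.
      apply/(@nbhs_normP R 'rV[R]_k v (fun w => `|v - w| < r / (k%:R + 1))).
      exists (r / (k%:R + 1)) => //=.
      by rewrite divr_gt0// ltr_wpDl.
    exists d => //= e /=; rewrite sub0r normrN => ed e0.
    by rewrite e0 -(gtr0_norm e0).
  move=> [w e] /= [vw ed]; apply: hP => //.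
  rewrite -linearB/=; apply: le_lt_trans (enorm_le_norm _) _.
  have k1 : 0 < k%:R + 1 :> R by rewrite ltr_wpDl.
  move: vw; rewrite ltr_pdivlMr// mulrC; apply: le_lt_trans.
  apply: ler_pM => //; first by rewrite lerDl.
  apply: mx_norm_le => // i j; rewrite mxE -[w - v]opprB mxE normrN.
  exact: le_entry_mx_norm.
move=> d /= d0 hd; exists d => // w e ew /andP[e0 ed].
have := hd e; rewrite /= sub0r normrN gtr0_norm// => /(_ ed e0) /(_ w^T).
by rewrite /S /= trmxK; apply.
Qed.

Lemma sphere_uniform (q : V -> R) : (forall w, enorm w = rho -> {for w, continuous q}) ->
  forall eps, 0 < eps -> exists2 d, 0 < d &
    forall w z, enorm w = rho -> enorm (z - w) < d -> `|q z - q w| <= eps.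
Proof.
move=> cq eps eps0.
case: (@sphere_cover (fun e w => forall z, enorm (z - w) < e -> `|q z - q w| <= eps) _) => [|d d0 hd].
  move=> w ew; have /mx_continuousP/(_ (eps / 2)) := cq _ ew.
  rewrite divr_gt0// => /(_ isT) [r r0 hr].
  (* Half the radius for the centre and half for the nearby point keep both within r of w. *)
  exists (r / 2); first by rewrite divr_gt0.
  exists (r / 2); first by rewrite divr_gt0.
  move=> w' e w'w /andP[e0 er] z zw'.
  have near_w y : enorm (y - w) < r -> `|q w - q y| <= eps / 2.
    move=> yw; apply: hr => /=; apply: le_lt_trans yw.
    apply: mx_norm_le => [|i j]; first exact: enorm_ge0.
    by rewrite (ord1 j) -[w - y]opprB mxE normrN; exact: le_coord_enorm.
  have h1 : `|q w - q w'| <= eps / 2 by apply: near_w; apply: lt_trans w'w _; lra.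
  have h2 : `|q w - q z| <= eps / 2.
    apply: near_w; rewrite (_ : z - w = (z - w') + (w' - w)); last by rewrite addrA subrK.
    by apply: le_lt_trans (enormD _ _) _; lra.
  rewrite (_ : q z - q w' = (q w - q w') - (q w - q z)); last by ring.
  by apply: le_trans (ler_normB _ _) _; lra.
exists (d / 2); first by rewrite divr_gt0.
by move=> w z ew zw; apply: (hd w (d / 2)) => //; apply/andP; split; lra.
Qed.

Lemma sphere_pos_lb (q : V -> R) : (forall w, enorm w = rho -> {for w, continuous q}) ->
  (forall w, enorm w = rho -> 0 < q w) ->
  exists2 c, 0 < c & forall w, enorm w = rho -> c <= q w.
Proof.
move=> cq q0.
case: (@sphere_cover (fun e w => e <= q w) _) => [|d d0 hd].
  move=> w ew; have /mx_continuousP/(_ (q w / 2)) := cq _ ew.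
  rewrite divr_gt0 ?q0// => /(_ isT) [r r0 hr].
  exists r => //; exists (q w / 2); first by rewrite divr_gt0 ?q0.
  move=> w' e w'w /andP[e0 er].
  have : `|q w - q w'| <= q w / 2.
    apply: hr => /=; apply: le_lt_trans w'w.
    apply: mx_norm_le => [|i j]; first exact: enorm_ge0.
    by rewrite (ord1 j) -[w - w']opprB mxE normrN; exact: le_coord_enorm.
  by rewrite ler_norml => /andP[h1 h2]; lra.
exists (d / 2); first by rewrite divr_gt0.
by move=> w ew; apply: hd => //; apply/andP; split; lra.
Qed.

Lemma sphere_bounded (q : V -> R) : (forall w, enorm w = rho -> {for w, continuous q}) ->
  exists2 M, 0 <= M & forall w, enorm w = rho -> `|q w| <= M.
Proof.
move=> cq.
case: (@sphere_cover (fun e w => `|q w| <= e^-1) _) => [|d d0 hd].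
  move=> w ew; have /mx_continuousP/(_ 1) := cq _ ew.
  move=> /(_ ltr01) [r r0 hr].
  exists r => //.
  have p0 : 0 < `|q w| + 1 by rewrite ltr_wpDl.
  exists (`|q w| + 1)^-1; first by rewrite invr_gt0.
  move=> w' e w'w /andP[e0 er].
  have : `|q w - q w'| <= 1.
    apply: hr => /=; apply: le_lt_trans w'w.
    apply: mx_norm_le => [|i j]; first exact: enorm_ge0.
    by rewrite (ord1 j) -[w - w']opprB mxE normrN; exact: le_coord_enorm.
  have : `|q w'| <= `|q w| + `|q w - q w'|.
    by rewrite -[X in `|X| <= _](subrK (q w)) addrC (le_trans (ler_normD _ _))// lerD2l distrC.
  have : `|q w| + 1 <= e^-1 by rewrite -[leLHS]invrK lef_pV2 ?posrE ?invr_gt0// ltW.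
  lra.
exists (d / 2)^-1; first by rewrite invr_ge0 ltW// divr_gt0.
by move=> w ew; apply: hd => //; apply/andP; split; lra.
Qed.

End SphereCompactness.

(** * Standardized coordinates *)

Section ThinShell.
Variables (R : realType) (k : nat) (k_gt0 : (0 < k)%N).
Notation V := 'cV[R]_k.
Variables (lam : {measure set (k.-tuple R) -> \bar R}) (hlam : is_lebesgue lam).
Local Notation itg := (itg lam).
Local Notation int := (int lam).

Definition ball_vol (rho : R) := int (fun x : V => (enorm x <= rho)%R%:R).

Lemma mea_star_set (a : V -> R) rho : mea a -> mea (fun x => (enorm x <= rho * a x)%R%:R).
Proof.
move=> ma; apply: mea_le; first by apply: mea_enorm; exact: meaV_id.
by apply: meaM => //; exact: mea_cst.
Qed.

Lemma itg_star_set (a : V -> R) rho : mea a -> (forall x, a x <= 2) -> 0 < rho ->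
  itg (fun x => (enorm x <= rho * a x)%R%:R).
Proof.
move=> ma a2 rho0; apply: (@itg_bounded_ball _ _ _ hlam _ 1 (rho * 2)).
  exact: mea_star_set.
move=> x; rewrite mul1r normr_nat ler_nat.
by case: (lerP (enorm x) (rho * a x)) => // h; rewrite (le_trans h)// ler_pM2l.
Qed.

(** Polar coordinates turn the volume between two star-shaped sets into a difference of k-th powers
    of their radii, hence O(eta). The bounds on [a] keep a - eta and a + eta within [0, 2], the
    range of [int_star]. *)
Lemma thin_shell (a : V -> R) rho eta : mea a -> homogeneous0 a ->
  0 < rho -> 0 <= eta <= 2^-1 -> (forall x, eta <= a x <= 3 / 2) ->
  int (fun x => (enorm x <= rho * (a x + eta))%R%:R - (enorm x <= rho * (a x - eta))%R%:R)
  <= k%:R * 3 ^+ k * (2 * eta) * ball_vol rho.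
Proof.
move=> ma ha rho0 /andP[e0 e1] a12.
have mp : mea (fun x => a x + eta) by apply: meaD => //; exact: mea_cst.
have mm : mea (fun x => a x - eta) by apply: meaB => //; exact: mea_cst.
have p02 x : 0 <= a x + eta <= 2 by have /andP[h1 h2] := a12 x; apply/andP; split; lra.
have m02 x : 0 <= a x - eta <= 2 by have /andP[h1 h2] := a12 x; apply/andP; split; lra.
have ip := itg_star_set mp (fun x => proj2 (andP (p02 x))) rho0.
have im := itg_star_set mm (fun x => proj2 (andP (m02 x))) rho0.
rewrite intB//.
have star b : mea b -> homogeneous0 b -> (forall x, 0 <= b x <= 2) ->
    int (fun x => (enorm x <= rho * b x)%R%:R) =
    int (fun x => b x ^+ k * (enorm x <= rho)%R%:R).
  move=> mb hb b02.
  have := @int_star R k k_gt0 lam hlam (fun=> 1) b 1 rho (mea_cst _) (fun c x _ => erefl) _ mb hb b02 rho0.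
  rewrite normr1 => /(_ (fun _ => lexx _)) E.
  transitivity (int (fun x => 1 * (enorm x <= rho * b x)%R%:R)).
    by congr int; apply/funext => x; rewrite mul1r.
  by rewrite E; congr int; apply/funext => x; rewrite mul1r.
have ipow b : mea b -> (forall x, 0 <= b x <= 2) -> itg (fun x => b x ^+ k * (enorm x <= rho)%R%:R).
  move=> mb b02; apply: (@itg_bounded_ball _ _ _ hlam _ (2 ^+ k) rho).
    by apply: meaM; [exact: meaX|exact: mea_ball].
  move=> x; rewrite normrM normr_nat ler_wpM2r// normrX.
  by have /andP[b0 b2] := b02 x; rewrite (ger0_norm b0) lerXn2r ?nnegrE.
rewrite !star//; [|by move=> c x c0; rewrite ha..].
rewrite /ball_vol -intB; [|exact: ipow..]; rewrite -intZ; last exact: itg_ball.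
apply: le_int; [by apply: itgB; exact: ipow|by apply: itgZ; exact: itg_ball|move=> x].
rewrite -mulrBl ler_wpM2r// lerBlDl.
have := @exprD_le R (a x - eta) (2 * eta) k (m02 x).
rewrite (_ : a x - eta + 2 * eta = a x + eta); last by ring.
by apply; apply/andP; split; lra.
Qed.

End ThinShell.

Section Standardized.
Variables (R : realType) (k : nat) (k_gt0 : (0 < k)%N).
Notation V := 'cV[R]_k.
Variables (lam : {measure set (k.-tuple R) -> \bar R}) (hlam : is_lebesgue lam).
Local Notation itg := (itg lam).
Local Notation int := (int lam).
Variables (f : V -> R) (f_ge0 : forall x, 0 <= f x).
Hypothesis (f_meas : measurable_fun setT (f \o @tup2cV R k)).
Hypothesis (f_dens : (\int[lam]_t (f (tup2cV t))%:E)%E = 1%E).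
Variables (mu0 : V) (Gamma0 : 'M[R]_k) (hG : is_PD Gamma0).

Definition std_density (z : V) := f (Gamma0 *m z + mu0).
Local Notation q := std_density.
(** The P-expectation of h in the coordinates z. The Jacobian is kept outside so that the same [q]
    also serves in the surface integrals. *)
Definition std_exp (h : V -> R) := \det Gamma0 * int (fun z => h z * q z).
Local Notation J := std_exp.

Lemma PD_psd (A : 'M[R]_k) : is_PD A -> is_psd A.
Proof.
move=> [sA pA]; split => // x; have [->|x0] := eqVneq x 0; last exact/ltW/pA.
by rewrite /quad mulmx0 mxE.
Qed.

Lemma PD_unit (A : 'M[R]_k) : is_PD A -> A \in unitmx.
Proof.
move=> [sA pA]; rewrite -unitmx_tr -row_free_unit -kermx_eq0.
apply/negPn/negP => /rowV0Pn [v]; rewrite sub_kermx => /eqP vA v0.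
have := pA v^T; rewrite trmx_eq0 v0 => /(_ isT).
by rewrite trmxK -[X in _ *m X *m _]sA vA mul0mx mxE ltxx.
Qed.

Lemma PD_det_gt0 (A : 'M[R]_k) : is_PD A -> 0 < \det A.
Proof.
move=> hA; have := PD_unit hA; rewrite unitmxE unitfE => d0.
by rewrite lt_def d0; have /andP[] := hadamard (PD_psd hA).
Qed.

Lemma uGamma : Gamma0 \in unitmx. Proof. exact: PD_unit. Qed.
Lemma det_Gamma_gt0 : 0 < \det Gamma0. Proof. exact: PD_det_gt0. Qed.

Lemma itg_density : itg f.
Proof. by apply: ge0_itg => //; rewrite f_dens ltry. Qed.

Lemma int_density : int f = 1.
Proof. by rewrite /int /Rintegral f_dens. Qed.

Lemma std_change (g : V -> R) : itg g ->
  itg (fun z => g (Gamma0 *m z + mu0)) /\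
  int g = \det Gamma0 * int (fun z => g (Gamma0 *m z + mu0)).
Proof.
move=> ig; have [h1 h2] := int_affine k_gt0 hlam mu0 uGamma ig; split => //.
by rewrite h2 gtr0_norm// det_Gamma_gt0.
Qed.

Lemma q_ge0 z : 0 <= q z. Proof. exact: f_ge0. Qed.
Lemma itg_q : itg q. Proof. by have [] := std_change itg_density. Qed.
Lemma std_exp1 : J (fun=> 1) = 1.
Proof.
have [_] := std_change itg_density; rewrite int_density => E; rewrite [RHS]E.
by congr (_ * int _); apply/funext => z; rewrite mul1r.
Qed.

Lemma PRintE (g : V -> R) : PRint lam f g = int (fun x => g x * f x).
Proof. by []. Qed.

Lemma PRint_std (g : V -> R) : itg (fun x => g x * f x) ->
  itg (fun z => g (Gamma0 *m z + mu0) * q z) /\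
  PRint lam f g = J (fun z => g (Gamma0 *m z + mu0)).
Proof. by move=> ig; rewrite PRintE; exact: (std_change ig). Qed.

Lemma itg_unstd (h : V -> R) : itg (fun z => h z * q z) ->
  itg (fun x => h (invmx Gamma0 *m (x - mu0)) * f x).
Proof.
move=> ih; have uV : invmx Gamma0 \in unitmx by rewrite unitmx_inv uGamma.
have [+ _] := int_affine k_gt0 hlam (- (invmx Gamma0 *m mu0)) uV ih.
congr itg; apply/funext => x; rewrite /std_density.
by rewrite -mulmxBr mulmxA mulmxV ?uGamma// mul1mx subrK.
Qed.

Lemma itgq_bounded (h : V -> R) M : mea h -> (forall z, `|h z| <= M) ->
  itg (fun z => h z * q z).
Proof. by move=> mh hM; apply: (itgM_bounded mh itg_q (M := M)) => z _. Qed.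

Lemma le_std_exp (g h : V -> R) : itg (fun z => g z * q z) -> itg (fun z => h z * q z) ->
  (forall z, g z <= h z) -> J g <= J h.
Proof.
move=> ig ih gh; rewrite ler_pM2l ?det_Gamma_gt0//; apply: le_int => // z.
by rewrite ler_wpM2r// q_ge0.
Qed.

Lemma std_expD (g h : V -> R) : itg (fun z => g z * q z) -> itg (fun z => h z * q z) ->
  J (fun z => g z + h z) = J g + J h.
Proof.
move=> ig ih; rewrite /std_exp -mulrDr -intD//; congr (_ * int _).
by apply/funext => z; rewrite mulrDl.
Qed.

Lemma std_expB (g h : V -> R) : itg (fun z => g z * q z) -> itg (fun z => h z * q z) ->
  J (fun z => g z - h z) = J g - J h.
Proof.
move=> ig ih; rewrite /std_exp -mulrBr -intB//; congr (_ * int _).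
by apply/funext => z; rewrite mulrBl.
Qed.

Lemma std_expZ c (h : V -> R) : itg (fun z => h z * q z) ->
  J (fun z => c * h z) = c * J h.
Proof.
move=> ih; rewrite /std_exp [RHS]mulrCA; congr (_ * _).
rewrite -intZ//; congr int.
by apply/funext => z; rewrite mulrA.
Qed.

Lemma std_exp_sum I (s : seq I) (g : I -> V -> R) : (forall i, itg (fun z => g i z * q z)) ->
  J (fun z => \sum_(i <- s) g i z) = \sum_(i <- s) J (g i).
Proof.
move=> ig; rewrite /std_exp -mulr_sumr -int_sum//; congr (_ * int _).
by apply/funext => z; rewrite mulr_suml.
Qed.

Section Sphere.
Variables (rho : R) (rho_gt0 : 0 < rho).
Hypothesis (q_cont : forall w, enorm w = rho -> {for w, continuous q}).
Hypothesis (q_pos : forall w, enorm w = rho -> 0 < q w).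

(** The origin is sent to itself, off the sphere, so it is treated apart throughout, mostly as a
    null set. *)
Definition radial (z : V) : V := (rho / enorm z) *: z.

Lemma radialZ c z : 0 < c -> radial (c *: z) = radial z.
Proof.
move=> c0; rewrite /radial enormZ gtr0_norm// scalerA; congr (_ *: _).
have [->|z0] := eqVneq (enorm z) 0; first by rewrite !mulr0 invr0 !mulr0 mul0r.
by field; rewrite z0 gt_eqF.
Qed.

Lemma enorm_radial z : z != 0 -> enorm (radial z) = rho.
Proof.
move=> z0; rewrite /radial enormZ ger0_norm; last by rewrite divr_ge0 ?enorm_ge0// ltW.
by rewrite divfK// enorm_eq0.
Qed.

Lemma radial0 : radial 0 = 0. Proof. exact: scaler0. Qed.

Lemma enorm_radial_le z : enorm (radial z) <= rho.
Proof.
by have [->|/enorm_radial ->//] := eqVneq z 0; rewrite radial0 enorm0 ltW.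
Qed.

Lemma enorm_radialB z : z != 0 -> enorm (z - radial z) = `|enorm z - rho|.
Proof.
move=> z0; have e0 : 0 < enorm z by rewrite lt_def enorm_eq0 z0 enorm_ge0.
rewrite /radial -[X in X - _]scale1r -scalerBl enormZ -[X in _ * X](gtr0_norm e0) -normrM.
by congr `| _ |; field; rewrite gt_eqF.
Qed.

Lemma meaV_radial : meaV radial.
Proof.
apply: meaVZ; last exact: meaV_id.
apply: meaM; first exact: mea_cst.
by apply: mea_inv; [apply: mea_enorm; exact: meaV_id|move=> x; exact: enorm_ge0].
Qed.

Lemma q_radial_bounded : exists2 M, 0 <= M & forall z, q (radial z) <= M.
Proof.
have [M M0 hM] := sphere_bounded q_cont.
(* The term q 0 covers z = 0, where [radial] misses the sphere. *)
exists (M + q 0); first by rewrite addr_ge0 ?q_ge0.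
move=> z; have [->|z0] := eqVneq z 0; first by rewrite radial0 lerDr.
rewrite (le_trans (ler_norm _))// (le_trans (hM _ (enorm_radial z0)))// lerDl q_ge0//.
Qed.

Lemma q_near_sphere eps : 0 < eps -> exists2 d, 0 < d <= rho &
  forall z, `|enorm z - rho| < d -> `|q z - q (radial z)| <= eps.
Proof.
move=> /(sphere_uniform q_cont) [d d0 hd].
(* A distance below [rho] from the sphere keeps z away from the origin. *)
exists (Num.min d rho); first by rewrite lt_min d0 rho_gt0 ge_min lexx orbT.
move=> z; rewrite lt_min => /andP[zd zr].
have z0 : z != 0.
  by apply: contraTneq zr => ->; rewrite enorm0 sub0r normrN gtr0_norm// ltxx.
by apply: hd; rewrite ?enorm_radial// enorm_radialB.
Qed.

Lemma q_shell_bounded : exists2 d, 0 < d <= rho & exists2 M, 0 <= M &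
  forall z, `|enorm z - rho| < d -> q z <= M.
Proof.
have [M M0 hM] := q_radial_bounded.
have [d d0 hd] := q_near_sphere ltr01.
exists d => //; exists (M + 1); first by rewrite addr_ge0.
move=> z zd; have := hd z zd; have := hM z; rewrite ler_norml => h1 /andP[_ h2]; lra.
Qed.

Definition cdf (s : R) := J (fun z => (enorm z <= s)%R%:R).

Lemma itgq_ball s : itg (fun z => (enorm z <= s)%R%:R * q z).
Proof.
by apply: (itgq_bounded (M := 1)) => [|z]; [exact: mea_ball|rewrite normr_nat lern1 leq_b1].
Qed.

(** The sphere carries no mass: [q] is bounded near it and thin shells have small volume. *)
Lemma cdf_continuous eps : 0 < eps ->
  exists2 e, 0 < e < rho & cdf (rho + e) - cdf (rho - e) <= eps.
Proof.
move=> eps0; have [d /andP[d0 dr] [M M0 hM]] := q_shell_bounded.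
pose C := \det Gamma0 * (M * (k%:R * 3 ^+ k * 2 * ball_vol lam rho)).
have C0 : 0 <= C.
  rewrite mulr_ge0 ?(ltW det_Gamma_gt0)// mulr_ge0// mulr_ge0 ?mulr_ge0 ?exprn_ge0//.
  exact: int_ge0.
pose eta := Num.min (4^-1) (Num.min (d / rho / 2) (eps / (C + 1))).
have eta0 : 0 < eta.
  by rewrite !lt_min invr_gt0 ltr0n !divr_gt0// ltr_wpDl.
have eta1 : eta <= 4^-1 by rewrite ge_min lexx.
have eta2 : rho * eta < d.
  have : eta <= d / rho / 2 by rewrite !ge_min lexx orbT.
  rewrite -(ler_pM2l rho_gt0).
  by rewrite (_ : rho * (d / rho / 2) = d / 2); [lra|field; rewrite gt_eqF].
have eta3 : C * eta <= eps.
  have : eta <= eps / (C + 1) by rewrite !ge_min lexx !orbT.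
  rewrite ler_pdivlMr ?ltr_wpDl// mulrDr mulr1 => h; rewrite mulrC.
  by apply: le_trans h; rewrite lerDl ltW.
exists (rho * eta).
  by rewrite mulr_gt0//= -[ltRHS]mulr1 ltr_pM2l//; lra.
rewrite /cdf -std_expB; [|exact: itgq_ball..].
apply: le_trans eta3.
have := @thin_shell R k k_gt0 lam hlam (fun=> 1) rho eta (mea_cst _) (fun _ _ _ => erefl) rho_gt0.
have h1 : 0 <= eta <= 2^-1 by rewrite ltW//=; lra.
have h2 (x : V) : eta <= (1 : R) <= 3 / 2 by apply/andP; split; lra.
move=> /(_ h1 h2) h3.
have h4 : M * int (fun x : V => (enorm x <= rho * (1 + eta))%R%:R -
    (enorm x <= rho * (1 - eta))%R%:R) <= M * (k%:R * 3 ^+ k * 2 * ball_vol lam rho) * eta.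
  rewrite -[leRHS]mulrA; apply: (ler_wpM2l M0); apply: (le_trans h3).
  by rewrite le_eqVlt; apply/orP; left; apply/eqP; ring.
rewrite /C -[leRHS]mulrA ler_pM2l ?det_Gamma_gt0//; apply: le_trans h4.
rewrite mulrDr mulrBr mulr1 -intZ; last by apply: itgB; exact: itg_ball.
apply: le_int.
- have := itgB (itgq_ball (rho + rho * eta)) (itgq_ball (rho - rho * eta)).
  by congr itg; apply/funext => z; rewrite mulrBl.
- by apply: itgZ; apply: itgB; exact: itg_ball.
move=> z; clear h2.
case: (lerP (enorm z) (rho - rho * eta)) => h5.
  have -> : enorm z <= rho + rho * eta by apply: (le_trans h5); have := mulr_gt0 rho_gt0 eta0; lra.
  by rewrite subrr mul0r mulr0.
case: (lerP (enorm z) (rho + rho * eta)) => h6; last by rewrite subrr mul0r mulr0.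
rewrite subr0 mul1r mulr1; apply: hM; apply: le_lt_trans eta2.
by rewrite ler_norml; apply/andP; split; lra.
Qed.

End Sphere.
End Standardized.

(** * Moments of the MCD ball *)

Section Moments.
Variables (R : realType) (k : nat) (k_gt0 : (0 < k)%N).
Notation V := 'cV[R]_k.
Variables (lam : {measure set (k.-tuple R) -> \bar R}) (hlam : is_lebesgue lam).
Local Notation itg := (itg lam).
Local Notation int := (int lam).
Variables (f : V -> R) (f_ge0 : forall x, 0 <= f x).
Hypothesis (f_meas : measurable_fun setT (f \o @tup2cV R k)).
Hypothesis (f_dens : (\int[lam]_t (f (tup2cV t))%:E)%E = 1%E).
Variables (mu0 : V) (Gamma0 Sigma0 : 'M[R]_k) (hG : is_PD Gamma0).
Hypothesis (hGS : Gamma0 *m Gamma0 = Sigma0).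
Local Notation q := (std_density f mu0 Gamma0).
Local Notation J := (std_exp lam f mu0 Gamma0).
Local Notation A := (invmx Gamma0).

Let uG : Gamma0 \in unitmx := uGamma hG.
Let AG : A *m Gamma0 = 1%:M. Proof. exact: mulVmx. Qed.
Let GA : Gamma0 *m A = 1%:M. Proof. exact: mulmxV. Qed.
Let symA : A^T = A. Proof. by rewrite trmx_inv hG.1. Qed.

Lemma invmx_sqr : invmx Sigma0 = A *m A.
Proof.
have uS : Sigma0 \in unitmx by rewrite -hGS unitmx_mul uG.
have : A *m A *m Sigma0 = 1%:M by rewrite -hGS mulmxA -(mulmxA A) AG mulmx1 AG.
by move=> h; rewrite -[RHS]mulmx1 -(mulmxV uS) mulmxA h mul1mx.
Qed.

Lemma mahalanobis x : ((x - mu0)^T *m invmx Sigma0 *m (x - mu0)) 0 0 =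
  enorm (A *m (x - mu0)) ^+ 2.
Proof.
by rewrite invmx_sqr sqr_enorm dotE trmx_mul symA !mulmxA.
Qed.

Lemma EllE s x : 0 <= s -> Ell mu0 Sigma0 s x = (enorm (A *m (x - mu0)) <= s) :> Prop.
Proof.
by move=> s0; rewrite /Ell/= mahalanobis ler_sqr ?nnegrE ?enorm_ge0.
Qed.

Let affK z : A *m (Gamma0 *m z + mu0 - mu0) = z.
Proof. by rewrite addrK mulmxA AG mul1mx. Qed.

Lemma Pmeas_Ell s : 0 <= s -> Pmeas lam f (Ell mu0 Sigma0 s) = (cdf lam f mu0 Gamma0 s)%:E.
Proof.
move=> s0.
have ib := itg_unstd k_gt0 hlam hG
  (itgq_ball k_gt0 hlam f_ge0 f_meas f_dens mu0 hG s).
have [_ E] := std_change k_gt0 hlam mu0 hG ib.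
have -> : cdf lam f mu0 Gamma0 s = int (fun x => (enorm (A *m (x - mu0)) <= s)%R%:R * f x).
  by rewrite E; congr (_ * int _); apply/funext => z; rewrite affK.
rewrite EFin_int// /Pmeas integral_mkcond; apply: eq_integral => t _.
rewrite /patch; case: ifPn => [|]; rewrite ?inE notin_setE /preimage /= || rewrite inE /preimage/=.
  by rewrite EllE// => ->; rewrite mul1r.
by rewrite EllE// => /negP/negbTE ->; rewrite mul0r.
Qed.

Section Rho.
Variables (gamma : R) (gamma_gt0 : 0 < gamma) (rho : R) (rho_gt0 : 0 < rho).
Hypothesis hrho : rho = inf [set s : R | 0 < s /\
                         (gamma%:E <= Pmeas lam f (Ell mu0 Sigma0 s))%E].
Hypothesis (q_cont : forall w, enorm w = rho -> {for w, continuous q}).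

Local Notation cdf := (cdf lam f mu0 Gamma0).

Lemma cdf_mono s t : s <= t -> cdf s <= cdf t.
Proof.
move=> st; apply: (le_std_exp f_ge0 hG); [exact: itgq_ball..|].
by move=> z; rewrite ler_nat; case: (lerP (enorm z) s) => // h; rewrite (le_trans h).
Qed.

(** The infimum gives mass at least gamma for every larger radius and less than gamma for every
    smaller positive one; absence of mass on the sphere closes the gap. *)
Lemma cdf_rho : cdf rho = gamma.
Proof.
pose S := [set s : R | 0 < s /\ gamma <= cdf s].
have SE : rho = inf S.
  rewrite hrho; congr inf; apply/seteqP; split => s /= [s0 h]; split => //;
  by move: h; rewrite Pmeas_Ell ?lee_fin// ltW.
(* The infimum of the empty set is 0 by convention, while [rho] is positive. *)
have S0 : S !=set0.
  by apply/set0P; apply: contraTneq rho_gt0 => h; rewrite SE h inf0 ltxx.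
have lS : has_lbound S by exists 0 => s [s0 _]; exact: ltW.
have up e : 0 < e -> gamma <= cdf (rho + e).
  move=> e0; have [s [_ hs] sr] := inf_adherent e0 (conj S0 lS).
  by rewrite (le_trans hs)// cdf_mono// SE ltW.
have lo s : 0 < s -> s < rho -> cdf s < gamma.
  move=> s0 sr; rewrite ltNge; apply/negP => h.
  have : inf S <= s by apply: ge_inf.
  by rewrite -SE leNgt sr.
apply/eqP; rewrite eq_le; apply/andP; split; apply/ler_addgt0Pr => e e0;
have [d /andP[d0 dr] h] := cdf_continuous k_gt0 hlam f_ge0 f_meas f_dens hG rho_gt0 q_cont e0.
  have h1 : cdf rho <= cdf (rho + d) by apply: cdf_mono; rewrite lerDl ltW.
  have h2 : cdf (rho - d) < gamma by apply: lo; lra.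
  lra.
have h1 : cdf (rho - d) <= cdf rho by apply: cdf_mono; lra.
have := up d d0; lra.
Qed.

Local Notation B := (fun z : V => (enorm z <= rho)%R%:R).

Lemma itgq_on_ball (h : V -> R) M : mea h -> (forall z, enorm z <= rho -> `|h z| <= M) ->
  itg (fun z => h z * B z * q z).
Proof.
move=> mh hM; apply: (@itgq_bounded _ _ k_gt0 _ hlam _ f_ge0 f_meas f_dens mu0 _ hG _ `|M|).
  by apply: meaM => //; exact: mea_ball.
move=> z; rewrite normrM normr_nat; case: (lerP (enorm z) rho) => h0; last by rewrite mulr0.
by rewrite mulr1 (le_trans (hM _ h0))// ler_norm.
Qed.

Variable phi : V -> R.
Hypothesis phi_min : MCD_minimizer lam f gamma phi.
Hypotheses (T_phi : TP lam f phi = mu0) (C_phi : CP lam f phi = Sigma0).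

Let mphi : mea phi. Proof. by case: phi_min => -[]. Qed.
Let phi01 x : 0 <= phi x <= 1. Proof. by case: phi_min => -[_ h _ _] _; exact: h. Qed.
Let itgf : itg f := itg_density f_ge0 f_meas f_dens.
Let iphi : itg (fun x => phi x * f x).
Proof.
apply: (itgM_bounded (M := 1)) => // x _.
by have /andP[h1 h2] := phi01 x; rewrite ger0_norm.
Qed.
Let a := PRint lam f phi.
Let a_ge : gamma <= a.
Proof.
case: phi_min => -[_ _ h _] _; move: h.
by rewrite /Pint -(EFin_int iphi) lee_fin.
Qed.
Let a_gt0 : 0 < a. Proof. exact: lt_le_trans a_ge. Qed.

Let iphi2 : itg (fun x => enorm x ^+ 2 * phi x * f x).
Proof.
case: phi_min => -[_ _ _ h] _; apply: ge0_itg => //.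
  apply: meaM; last exact: f_meas.
  by apply: meaM => //; apply: meaX; apply: mea_enorm; exact: meaV_id.
move=> x; have /andP[h1 h2] := phi01 x.
by rewrite !mulr_ge0// enorm_ge0.
Qed.

Let itg_quadratic (p : V -> R) C : mea p -> (forall x, `|p x| <= C * (1 + enorm x ^+ 2)) ->
  itg (fun x => p x * phi x * f x).
Proof.
move=> mp hp; apply: (itg_dom (h := fun x => C * (phi x * f x) + C * (enorm x ^+ 2 * phi x * f x))).
- by apply: meaM => //; exact: meaM.
- by apply: itgD; exact: itgZ.
move=> x; have /andP[h1 h2] := phi01 x.
rewrite !normrM (ger0_norm h1) (ger0_norm (f_ge0 x)).
have := ler_wpM2r (mulr_ge0 h1 (f_ge0 x)) (hp x).
by rewrite !mulrA mulrDr mulr1 !mulrDl !mulrA.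
Qed.

Let ip i j : itg (fun x => (x - mu0) i 0 * (x - mu0) j 0 * phi x * f x).
Proof.
have mc l : mea (fun x : V => (x - mu0) l 0).
  rewrite (_ : (fun x => _) = fun x : V => x l 0 - mu0 l 0); last by apply/funext => x; rewrite !mxE.
  by apply: meaB; [exact: mea_coord|exact: mea_cst].
(* From (s + m)^2 <= 2 s^2 + 2 m^2 <= (2 + 2 m^2)(1 + s^2). *)
apply: (itg_quadratic (C := 2 + 2 * enorm mu0 ^+ 2)); first exact: meaM.
move=> x; rewrite normrM.
have h l := le_coord_enorm (x - mu0) l.
apply: le_trans (ler_pM _ _ (h i) (h j)) _ => //.
have h1 := enormB x mu0; have := enorm_ge0 (x - mu0).
have := enorm_ge0 x; have := enorm_ge0 mu0.
move: (enorm (x - mu0)) (enorm x) (enorm mu0) h1 => n s m h1 m0 s0 n0.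
have : n * n <= (s + m) * (s + m) by apply: ler_pM.
rewrite !expr2; have := sqr_ge0 (s - m); rewrite expr2.
have : 0 <= (m * m) * (s * s) by rewrite !mulr_ge0.
by nra.
Qed.

Let ent i j : int (fun x => (x - mu0) i 0 * (x - mu0) j 0 * phi x * f x) = a * Sigma0 i j.
Proof.
move: C_phi => /matrixP/(_ i j); rewrite mxE T_phi => <-.
rewrite mulrC divfK ?gt_eqF//.
Qed.

Let d x := enorm (A *m (x - mu0)) ^+ 2.

Let dE x : d x = \sum_i \sum_j invmx Sigma0 i j * ((x - mu0) i 0 * (x - mu0) j 0).
Proof. by rewrite -quad_sum /quad mahalanobis. Qed.

Let dphiE : (fun x => d x * phi x * f x) = (fun x => \sum_i \sum_j
    invmx Sigma0 i j * ((x - mu0) i 0 * (x - mu0) j 0 * phi x * f x)).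
Proof.
apply/funext => x; rewrite dE !mulr_suml; apply: eq_bigr => i _.
by rewrite !mulr_suml; apply: eq_bigr => j _; rewrite !mulrA.
Qed.

Let idphi : itg (fun x => d x * phi x * f x).
Proof. by rewrite dphiE; apply: itg_sum => i; apply: itg_sum => j; apply: itgZ; exact: ip. Qed.

(** The mean squared Mahalanobis distance under the MCD weight is tr(Sigma0^-1 Sigma0) = k. *)
Let int_dphi : int (fun x => d x * phi x * f x) = a * k%:R.
Proof.
rewrite dphiE int_sum; last by move=> i; apply: itg_sum => j; apply: itgZ; exact: ip.
have uS : Sigma0 \in unitmx by rewrite -hGS unitmx_mul uG.
have symS : Sigma0^T = Sigma0 by rewrite -hGS trmx_mul hG.1.
rewrite -(mxtrace1 R k) -(mulVmx uS) /mxtrace mulr_sumr; apply: eq_bigr => i _.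
rewrite int_sum; last by move=> j; apply: itgZ; exact: ip.
rewrite mxE mulr_sumr; apply: eq_bigr => j _.
have <- : Sigma0 i j = Sigma0 j i by rewrite -[in RHS]symS mxE.
by rewrite intZ ?ent// mulrCA.
Qed.

Let psi x : R := (enorm (A *m (x - mu0)) <= rho)%R%:R.

Let md : mea (fun x => enorm (A *m (x - mu0))).
Proof.
apply: mea_enorm; apply: meaV_mul; apply: meaVD; first exact: meaV_id.
exact: meaV_cst.
Qed.

Let ball_std (h : V -> R) : itg (fun z => h z * B z * q z) ->
  itg (fun x => h (A *m (x - mu0)) * psi x * f x) /\
  int (fun x => h (A *m (x - mu0)) * psi x * f x) = J (fun z => h z * B z).
Proof.
move=> ih; have ih' := itg_unstd k_gt0 hlam hG ih.
split => //; have [_ ->] := std_change k_gt0 hlam mu0 hG ih'.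
by congr (_ * int _); apply/funext => z; rewrite affK.
Qed.

Let ib1 : itg (fun z => 1 * B z * q z).
Proof. by apply: (itgq_on_ball (M := 1)) => [|z _]; [exact: mea_cst|rewrite normr1]. Qed.

Let J1 : J (fun z => 1 * B z) = gamma.
Proof.
by rewrite -[RHS]cdf_rho; congr (_ * int _); apply/funext => z; rewrite mul1r.
Qed.

Let ib2 : itg (fun z => enorm z ^+ 2 * B z * q z).
Proof.
apply: (itgq_on_ball (M := rho ^+ 2)).
  by apply: meaX; apply: mea_enorm; exact: meaV_id.
move=> z zr; rewrite ger0_norm ?sqr_ge0// lerXn2r ?nnegrE ?enorm_ge0//.
exact: ltW.
Qed.

(* The average of [d] over a mass at least [gamma] is smallest on the ellipsoid. *)
Let second_moment_le : J (fun z => enorm z ^+ 2 * B z) <= gamma * k%:R.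
Proof.
have [i2 <-] := ball_std ib2; have [i1 e1] := ball_std ib1.
rewrite J1 in e1.
rewrite -/(d _) in i2 *.
set m2 := int _.
(* A Neyman-Pearson comparison: [g] equals (d - rho^2)(phi / a - psi / gamma) f. Inside the
   ellipsoid both factors are at most 0, as a >= gamma and phi <= 1; outside, both are at least
   0. *)
pose g x := (a^-1 * (d x * phi x * f x) - gamma^-1 * (d x * psi x * f x))
   - rho ^+ 2 * (a^-1 * (phi x * f x) - gamma^-1 * (1 * psi x * f x)).
have : 0 <= int g.
  apply: int_ge0 => x.
  have -> : g x = (d x - rho ^+ 2) * (a^-1 * phi x - gamma^-1 * psi x) * f x by rewrite /g; ring.
  apply: mulr_ge0 => //; have /andP[p0 p1] := phi01 x.
  have ia : a^-1 <= gamma^-1 by rewrite lef_pV2 ?posrE.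
  rewrite /psi; case: (lerP (enorm (A *m (x - mu0))) rho) => h.
    have d1 : d x <= rho ^+ 2 by apply: lerXn2r; rewrite ?nnegrE ?enorm_ge0 ?(ltW rho_gt0).
    rewrite mulr1 -mulrNN; apply: mulr_ge0; rewrite oppr_ge0 subr_le0//.
    apply: le_trans ia; rewrite ler_piMr// invr_ge0 ltW//.
  have d1 : rho ^+ 2 <= d x by apply: lerXn2r; rewrite ?nnegrE ?enorm_ge0 ?(ltW rho_gt0) ?(ltW h).
  by rewrite mulr0 subr0 !mulr_ge0 ?subr_ge0// invr_ge0 ltW.
have j1 := itgZ a^-1 idphi; have j2 := itgZ gamma^-1 i2.
have j3 := itgZ a^-1 iphi; have j4 := itgZ gamma^-1 i1.
have E : int g = a^-1 * (a * k%:R) - gamma^-1 * m2 - rho ^+ 2 * (a^-1 * a - gamma^-1 * gamma).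
  rewrite [LHS](intB (itgB j1 j2) (itgZ (rho ^+ 2) (itgB j3 j4))).
  rewrite (intB j1 j2) (intZ _ (itgB j3 j4)) (intB j3 j4).
  by rewrite (intZ _ idphi) (intZ _ i2) (intZ _ iphi) (intZ _ i1) int_dphi e1.
rewrite E !mulVf ?gt_eqF// subrr mulr0 subr0.
by rewrite mulKf ?gt_eqF// subr_ge0 ler_pdivrMl.
Qed.

(** [t] and [C] are the mean and covariance of the ellipsoid indicator in the coordinates z.
    Uniqueness of the MCD functional will give t = 0 and C = I. *)
Let t : V := \col_l (J (fun z => z l 0 * B z) / gamma).
Let C : 'M[R]_k := \matrix_(l, m) (J (fun z => (z - t) l 0 * (z - t) m 0 * B z) / gamma).

Let mt l : mea (fun z : V => (z - t) l 0).
Proof.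
rewrite (_ : (fun x => _) = fun x : V => x l 0 - t l 0); last by apply/funext => x; rewrite !mxE.
by apply: meaB; [exact: mea_coord|exact: mea_cst].
Qed.

Let ibc l : itg (fun z => z l 0 * B z * q z).
Proof.
apply: (itgq_on_ball (M := rho)); first exact: mea_coord.
by move=> z zr; rewrite (le_trans (le_coord_enorm _ _)).
Qed.

Let boundt z l : enorm z <= rho -> `|(z - t) l 0| <= rho + enorm t.
Proof.
move=> zr; rewrite (le_trans (le_coord_enorm _ _))// (le_trans (enormB _ _))// lerD2r//.
Qed.

Let ibt l m : itg (fun z => (z - t) l 0 * (z - t) m 0 * B z * q z).
Proof.
apply: (itgq_on_ball (M := (rho + enorm t) * (rho + enorm t))); first exact: meaM.
by move=> z zr; rewrite normrM ler_pM// boundt.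
Qed.

Let quadC x : quad C x = J (fun z => dot x (z - t) ^+ 2 * B z) / gamma.
Proof.
rewrite quad_sum.
have -> : (fun z => dot x (z - t) ^+ 2 * B z) = (fun z => \sum_i \sum_j
   (x i 0 * x j 0) * ((z - t) i 0 * (z - t) j 0 * B z)).
  apply/funext => z; rewrite expr2 /dot big_distrlr /= mulr_suml; apply: eq_bigr => i _.
  by rewrite mulr_suml; apply: eq_bigr => j _; ring.
have iz i j : itg (fun z => x i 0 * x j 0 * ((z - t) i 0 * (z - t) j 0 * B z) * q z).
  have := itgZ (x i 0 * x j 0) (ibt i j).
  by congr itg; apply/funext => z; rewrite !mulrA.
rewrite std_exp_sum; last first.
  move=> i; have := itg_sum (index_enum 'I_k) (iz i).
  by congr itg; apply/funext => z; rewrite mulr_suml.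
rewrite mulr_suml; apply: eq_bigr => i _.
rewrite std_exp_sum//; rewrite mulr_suml; apply: eq_bigr => j _.
by rewrite (std_expZ _ (ibt i j)) mxE; ring.
Qed.

Let psdC : is_psd C.
Proof.
split; first by apply/matrixP => i j; rewrite !mxE; congr (_ / _); congr (_ * int _);
  apply/funext => z; ring.
move=> x; rewrite quadC divr_ge0 ?(ltW gamma_gt0)// mulr_ge0 ?(ltW (det_Gamma_gt0 hG))//.
by apply: int_ge0 => z; apply: mulr_ge0; [rewrite mulr_ge0 ?sqr_ge0|exact: f_ge0].
Qed.

(** Centring subtracts |t|^2 from the mean of |z|^2, which is already at most k. *)
Let trC : \tr C <= k%:R.
Proof.
have -> : \tr C = J (fun z => enorm z ^+ 2 * B z) / gamma - enorm t ^+ 2.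
  rewrite /mxtrace.
  have E l : C l l = J (fun z => z l 0 ^+ 2 * B z) / gamma - t l 0 ^+ 2.
    rewrite mxE.
    have il : itg (fun z => z l 0 ^+ 2 * B z * q z).
      apply: (itgq_on_ball (M := rho ^+ 2)); first by apply: meaX; exact: mea_coord.
      move=> z zr; rewrite normrX lerXn2r ?nnegrE ?(ltW rho_gt0)//.
      exact: le_trans (le_coord_enorm _ _) zr.
    have -> : (fun z => (z - t) l 0 * (z - t) l 0 * B z) =
       (fun z => (z l 0 ^+ 2 * B z - (2 * t l 0) * (z l 0 * B z)) + t l 0 ^+ 2 * (1 * B z)).
      by apply/funext => z; rewrite !mxE; ring.
    have ib1' c : itg (fun z => c * (1 * B z) * q z).
      by have := itgZ c ib1; congr itg; apply/funext => z; rewrite !mulrA.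
    have ibc' c : itg (fun z => c * (z l 0 * B z) * q z).
      by have := itgZ c (ibc l); congr itg; apply/funext => z; rewrite !mulrA.
    have ilb : itg (fun z => (z l 0 ^+ 2 * B z - 2 * t l 0 * (z l 0 * B z)) * q z).
      by have := itgB il (ibc' (2 * t l 0)); congr itg; apply/funext => z; rewrite mulrBl.
    rewrite std_expD// std_expB// (std_expZ _ (ibc l)) (std_expZ _ ib1) J1.
    have -> : J (fun z => z l 0 * B z) = t l 0 * gamma by rewrite mxE divfK// gt_eqF.
    by field; rewrite gt_eqF.
  rewrite (eq_bigr _ (fun l _ => E l)) big_split /= sumrN -mulr_suml; congr (_ / _ - _); last first.
    by rewrite sqr_enorm /dot; apply: eq_bigr => l _; rewrite expr2.
  rewrite -std_exp_sum.
    congr (_ * int _); apply/funext => z; congr (_ * _); rewrite -mulr_suml sqr_enorm /dot; congr (_ * _).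
  move=> l; apply: (itgq_on_ball (M := rho ^+ 2)); first by apply: meaX; exact: mea_coord.
  move=> z zr; rewrite normrX lerXn2r ?nnegrE ?(ltW rho_gt0)//.
  exact: le_trans (le_coord_enorm _ _) zr.
rewrite lerBlDr ler_pdivrMr// mulrDl; apply: (le_trans second_moment_le).
by rewrite mulrC lerDl mulr_ge0 ?sqr_ge0// ltW.
Qed.

Let PRint_psi (h : V -> R) M : mea h ->
  (forall z, enorm z <= rho -> `|h (Gamma0 *m z + mu0)| <= M) ->
  PRint lam f (fun x => h x * psi x) = J (fun z => h (Gamma0 *m z + mu0) * B z).
Proof.
move=> mh hM.
have mh' : mea (fun z => h (Gamma0 *m z + mu0)).
  apply: mea_comp => //; apply: meaVD; last exact: meaV_cst.
  by apply: meaV_mul; exact: meaV_id.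
have [_ <-] := ball_std (itgq_on_ball mh' hM).
rewrite PRintE; congr int; apply/funext => x.
by rewrite mulmxA GA mul1mx subrK.
Qed.

Let PRpsi : PRint lam f psi = gamma.
Proof.
have n1 (z : V) : enorm z <= rho -> `|1 : R| <= 1 by rewrite normr1.
rewrite -[RHS]J1 -(@PRint_psi (fun=> 1) 1 (mea_cst _) n1).
by rewrite !PRintE; congr int; apply/funext => x; rewrite mul1r.
Qed.

Let bound_aff z i : enorm z <= rho -> `|(Gamma0 *m z) i 0| <= msum Gamma0 * rho.
Proof.
move=> zr; rewrite (le_trans (le_coord_enorm _ _))// (le_trans (enorm_mulmx _ _))//.
by rewrite ler_wpM2l// msum_ge0.
Qed.

Let TPpsi : TP lam f psi = Gamma0 *m t + mu0.
Proof.
apply/colP => i; rewrite [LHS]mxE PRpsi.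
rewrite (@PRint_psi (fun x => x i 0) (msum Gamma0 * rho + `|mu0 i 0|)); last first.
- by move=> z zr; rewrite mxE (le_trans (ler_normD _ _))// lerD2r bound_aff.
- exact: mea_coord.
have -> : (fun z => (Gamma0 *m z + mu0) i 0 * B z) =
   (fun z => \sum_l Gamma0 i l * (z l 0 * B z) + mu0 i 0 * (1 * B z)).
  apply/funext => z; rewrite !mxE mulrDl mul1r mulr_suml; congr (_ + _).
  by apply: eq_bigr => l _; rewrite mulrA.
have ib1' c : itg (fun z => c * (1 * B z) * q z).
  by have := itgZ c ib1; congr itg; apply/funext => z; rewrite !mulrA.
have ibc' c l : itg (fun z => c * (z l 0 * B z) * q z).
  by have := itgZ c (ibc l); congr itg; apply/funext => z; rewrite !mulrA.
rewrite std_expD//; last first.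
  have := itg_sum (index_enum 'I_k) (fun l => ibc' (Gamma0 i l) l).
  by congr itg; apply/funext => z; rewrite mulr_suml.
rewrite std_exp_sum// (std_expZ _ ib1) J1 mulrDl mulfK ?gt_eqF// !mxE; congr (_ + _).
rewrite mulr_suml; apply: eq_bigr => l _; rewrite (std_expZ _ (ibc l)) mxE; ring.
Qed.

Let CPpsi : CP lam f psi = Gamma0 *m C *m Gamma0.
Proof.
apply/matrixP => i j; rewrite [LHS]mxE PRpsi TPpsi.
have e z l : (Gamma0 *m z + mu0 - (Gamma0 *m t + mu0)) l 0 = \sum_m Gamma0 l m * (z - t) m 0.
  by rewrite opprD addrACA subrr addr0 -mulmxBr mxE.
rewrite (@PRint_psi (fun x => (x - (Gamma0 *m t + mu0)) i 0 * (x - (Gamma0 *m t + mu0)) j 0)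
   ((msum Gamma0 * (rho + enorm t)) ^+ 2)); last first.
- move=> z zr; rewrite normrM expr2.
  have h l : `|(Gamma0 *m z + mu0 - (Gamma0 *m t + mu0)) l 0| <= msum Gamma0 * (rho + enorm t).
    rewrite opprD addrACA subrr addr0 -mulmxBr (le_trans (le_coord_enorm _ _))//.
    rewrite (le_trans (enorm_mulmx _ _))// ler_wpM2l ?msum_ge0//.
    by rewrite (le_trans (enormB _ _))// lerD2r.
  exact: ler_pM.
- have m1 l : mea (fun x => (x - (Gamma0 *m t + mu0)) l 0).
    rewrite (_ : (fun x => _) = fun x : V => x l 0 - (Gamma0 *m t + mu0) l 0).
      by apply: meaB; [exact: mea_coord|exact: mea_cst].
    by apply/funext => x; rewrite mxE [X in _ + X = _]mxE.
  exact: meaM.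
have -> : (fun z => (Gamma0 *m z + mu0 - (Gamma0 *m t + mu0)) i 0 *
    (Gamma0 *m z + mu0 - (Gamma0 *m t + mu0)) j 0 * B z) =
  (fun z => \sum_l \sum_m (Gamma0 i l * Gamma0 j m) * ((z - t) l 0 * (z - t) m 0 * B z)).
  apply/funext => z; rewrite !e big_distrlr /= mulr_suml; apply: eq_bigr => l _.
  by rewrite mulr_suml; apply: eq_bigr => m _; ring.
have iz l m c : itg (fun z => c * ((z - t) l 0 * (z - t) m 0 * B z) * q z).
  by have := itgZ c (ibt l m); congr itg; apply/funext => z; rewrite !mulrA.
rewrite std_exp_sum; last first.
  move=> l; have := itg_sum (index_enum 'I_k) (fun m => iz l m (Gamma0 i l * Gamma0 j m)).
  by congr itg; apply/funext => z; rewrite mulr_suml.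
rewrite -mulmxA mxE mulr_suml; apply: eq_bigr => l _.
rewrite std_exp_sum// mulr_suml mxE mulr_sumr; apply: eq_bigr => m _.
have <- : Gamma0 j m = Gamma0 m j by rewrite -[in RHS]hG.1 mxE.
by rewrite (std_expZ _ (ibt l m)) [C l m]mxE; ring.
Qed.

Let psi_adm : admissible lam f gamma psi.
Proof.
have mpsi : mea psi by apply: mea_le => //; exact: mea_cst.
have ipsi : itg (fun x => psi x * f x).
  apply: (itgM_bounded (M := 1)) => // x _.
  by rewrite normr_nat lern1 leq_b1.
have psi_in x : psi x != 0 -> enorm x <= msum Gamma0 * rho + enorm mu0.
  rewrite /psi; case: (lerP (enorm (A *m (x - mu0))) rho) => [h _|]; last by rewrite eqxx.
  have -> : x = Gamma0 *m (A *m (x - mu0)) + mu0 by rewrite mulmxA GA mul1mx subrK.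
  rewrite (le_trans (enormD _ _))// lerD2r (le_trans (enorm_mulmx _ _))//.
  by rewrite ler_wpM2l// msum_ge0.
split => //.
- by move=> x; rewrite ler0n lern1 leq_b1.
- by rewrite /Pint -(EFin_int ipsi) lee_fin -[int _]/(PRint lam f psi) PRpsi.
- rewrite /Pint; apply: (@itg_lty _ _ _ (fun x => enorm x ^+ 2 * psi x * f x)).
  apply: (itgM_bounded (M := (msum Gamma0 * rho + enorm mu0) ^+ 2)) => // [|x _].
    by apply: meaM => //; apply: meaX; apply: mea_enorm; exact: meaV_id.
  have p0 : 0 <= msum Gamma0 * rho + enorm mu0.
    by rewrite addr_ge0 ?enorm_ge0// mulr_ge0 ?msum_ge0// ltW.
  have [->|h] := eqVneq (psi x) 0; first by rewrite mulr0 normr0 sqr_ge0.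
  have h1 := psi_in x h.
  rewrite normrM normr_nat normrX (ger0_norm (enorm_ge0 _)).
  apply: (@le_trans _ _ (enorm x ^+ 2)); first by rewrite ler_piMr ?sqr_ge0// lern1 leq_b1.
  by rewrite lerXn2r ?nnegrE ?enorm_ge0.
Qed.

(** The ratio of the two determinants is det C, at most 1 by the trace bound. *)
Let detC : \det (CP lam f psi) <= \det (CP lam f phi).
Proof.
rewrite CPpsi C_phi -hGS !det_mulmx mulrAC ler_piMr//; last exact: det_le1_of_trace.
by rewrite mulr_ge0 ?(ltW (det_Gamma_gt0 hG)).
Qed.

Hypothesis hMCD : unique_MCD lam f gamma mu0 Sigma0.

Let psi_unique : Gamma0 *m t + mu0 = mu0 /\ Gamma0 *m C *m Gamma0 = Sigma0.
Proof.
rewrite -TPpsi -CPpsi; apply: hMCD.2; split; first exact: psi_adm.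
by move=> chi hchi; apply: (le_trans detC); exact: phi_min.2.
Qed.

Lemma std_moments0 : (forall l, J (fun z => z l 0 * B z) = 0) /\
  (forall l m, J (fun z => z l 0 * z m 0 * B z) = gamma * (l == m)%:R).
Proof.
have t0 : t = 0.
  have /(congr1 (fun v => A *m (v - mu0))) := psi_unique.1.
  by rewrite affK subrr mulmx0.
have C1 : C = 1%:M.
  have := psi_unique.2; rewrite -hGS => /(congr1 (fun M => A *m M *m A)).
  by rewrite /= !mulmxA AG !mul1mx -!mulmxA GA !mulmx1 => ->.
split=> [l|l m].
  have := congr1 (fun v : V => v l 0) t0; rewrite !mxE => /eqP.
  by rewrite mulf_eq0 invr_eq0 [gamma == 0]gt_eqF// orbF => /eqP.
have := congr1 (fun M : 'M[R]_k => M l m) C1; rewrite !mxE t0 => <-.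
rewrite mulrC divfK ?gt_eqF//; congr (_ * int _); apply/funext => z.
by rewrite subr0.
Qed.

End Rho.
End Moments.

(** * First-order motion of the sphere *)

Section ShellGeometry.
Variables (R : realType) (k : nat) (rho : R) (rho_gt0 : 0 < rho).
Notation V := 'cV[R]_k.
Local Notation radial := (radial rho).

Definition ell (K : 'M[R]_k) (b : V) (t : R) (w : V) : R :=
  t + (dot w (K *m w) + dot w b) / rho.

(* For a perturbation of size [kap], the perturbed and unperturbed balls differ only
   within distance [shell_C1 * kap] of the sphere, and [shell_C6 * kap ^+ 2] bounds the
   relative error of the first-order radius of the perturbed one. *)
Definition shell_C1 : R := rho + 3.
Definition shell_C2 : R := 4 * rho + 3.
Definition shell_C5 : R :=
  4 * rho * shell_C2 + shell_C2 ^+ 2 + 2 * (shell_C1 * (1 + 3 * rho)).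
Definition shell_C6 : R := (shell_C5 + 1 + 2 * (2 + rho) ^+ 2) / rho ^+ 2.

Lemma shell_C5_ge0 : 0 <= shell_C5.
Proof.
have r0 := ltW rho_gt0.
by rewrite /shell_C5 /shell_C2 /shell_C1 !addr_ge0 ?sqr_ge0 ?mulr_ge0 ?addr_ge0// mulr_ge0.
Qed.

Lemma shell_C6_gt0 : 0 < shell_C6.
Proof.
apply: divr_gt0; last by rewrite exprn_gt0.
have := shell_C5_ge0; have := sqr_ge0 (2 + rho); lra.
Qed.

Section Perturbation.
Variables (K : 'M[R]_k) (b : V) (t kap : R) (z w : V).
Hypotheses (Kk : msum K <= kap) (bk : enorm b <= kap) (tk : `|t| <= kap).
Hypotheses (kap0 : 0 <= kap) (kap_half : kap <= 2^-1).
Hypothesis wE : w + K *m w = z - b.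

Lemma enorm_K x : enorm (K *m x) <= kap * enorm x.
Proof. by rewrite (le_trans (enorm_mulmx _ _))// ler_wpM2r// enorm_ge0. Qed.

Let wzE : w - z = - (b + K *m w).
Proof.
have e : w = z - b - K *m w by rewrite -wE addrK.
rewrite {1}e; move: (K *m w) => u.
by apply/colP => i; rewrite !mxE; ring.
Qed.

Lemma enorm_wz : enorm (w - z) <= kap * (1 + enorm w).
Proof.
rewrite wzE enormN (le_trans (enormD _ _))// mulrDr mulr1.
by rewrite lerD// enorm_K.
Qed.

Lemma enorm_w_le : enorm w <= 2 * (enorm z + kap).
Proof.
have kh := kap_half; have k0 := kap0.
have h1 := enorm_wz; have h2 := enormD (w - z) z; rewrite subrK in h2.
have h3 := enorm_ge0 w.
have : kap * enorm w <= 2^-1 * enorm w by rewrite ler_wpM2r.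
lra.
Qed.

Lemma enorm_z_le : enorm z <= enorm w + kap * (1 + enorm w).
Proof.
have kh := kap_half; have k0 := kap0.
have h1 := enorm_wz; have h2 := enormB w (w - z); rewrite subKr in h2; lra.
Qed.

(** The displacement is exactly -(b + K w), so replacing w by z costs -K (w - z), which is of second
    order. *)
Lemma enorm_wz_remainder : enorm (w - z + (b + K *m z)) <= kap * enorm (w - z).
Proof.
rewrite (_ : _ + _ = - (K *m (w - z))) ?enormN ?enorm_K//.
by rewrite {1}wzE mulmxBr opprB opprD addrACA addNr add0r addrC.
Qed.

Lemma normr_ell x : enorm x <= rho -> `|ell K b t x| <= (2 + rho) * kap.
Proof.
move=> xr; rewrite /ell (le_trans (ler_normD _ _))//.
have : `|(dot x (K *m x) + dot x b) / rho| <= (rho + 1) * kap.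
  rewrite normrM normfV (gtr0_norm rho_gt0) ler_pdivrMr//.
  rewrite (le_trans (ler_normD _ _))//.
  have h1 : `|dot x (K *m x)| <= rho * (kap * rho).
    rewrite (le_trans (normr_dot_le _ _))// ler_pM ?enorm_ge0//.
    by rewrite (le_trans (enorm_K _))// ler_wpM2l.
  have h2 : `|dot x b| <= rho * kap by rewrite (le_trans (normr_dot_le _ _))// ler_pM ?enorm_ge0.
  lra.
by move=> h; rewrite (_ : (2 + rho) * kap = kap + (rho + 1) * kap) ?lerD//; ring.
Qed.

Hypotheses (kap_rho : shell_C1 * kap <= rho) (kap_eta : shell_C6 * kap ^+ 2 <= 2^-1).

Local Notation lam := (ell K b t (radial z) / rho).
Local Notation eta := (shell_C6 * kap ^+ 2).

Let rholam : rho * lam = ell K b t (radial z).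
Proof. by rewrite mulrC divfK// gt_eqF. Qed.

Let lam_le : `|rho * lam| <= (2 + rho) * kap.
Proof. by rewrite rholam normr_ell// enorm_radial_le. Qed.

(** Origin of [shell_C1]: the radius grows by at most kap, and passing from w to z adds at most kap
    (1 + rho + kap) with kap <= 1. *)
Lemma shell_far_out : enorm w <= rho + t -> enorm z <= rho + shell_C1 * kap.
Proof.
have kh := kap_half; have k0 := kap0; have r0 := rho_gt0; have kr := kap_rho.
move=> h; apply: (le_trans enorm_z_le).
move: tk; rewrite ler_norml => /andP[t1 t2].
have hw : enorm w <= rho + kap by lra.
have : kap * (1 + enorm w) <= kap * (1 + (rho + kap)) by rewrite ler_wpM2l// lerD2l.
have : kap * kap <= kap * 1 by rewrite ler_wpM2l//; lra.
rewrite /shell_C1; lra.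
Qed.

Lemma shell_far_in : enorm z < rho - shell_C1 * kap -> enorm w <= rho + t.
Proof.
have kh := kap_half; have k0 := kap0; have r0 := rho_gt0; have kr := kap_rho.
move=> h; rewrite /shell_C1 in h.
move: tk; rewrite ler_norml => /andP[t1 t2].
have h1 := enorm_wz; have h2 := enormD (w - z) z; rewrite subrK in h2.
have k1 : 0 < 1 - kap by lra.
have : (1 - kap) * enorm w <= (1 - kap) * (rho + t).
  have : kap * (rho + t) <= kap * (rho + kap) by rewrite ler_wpM2l//; lra.
  have : kap * kap <= kap * 1 by rewrite ler_wpM2l//; lra.
  lra.
by rewrite ler_pM2l.
Qed.

(** |w|^2 - |z|^2 = 2 z.(w - z) + |w - z|^2, with w - z replaced by -(b + K z) and then z by its
    radial projection; [ell] is built so that the outcome is 2 rho (ell - t). The summands of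
    [shell_C5] are the bounds [e1] to [e4]. *)
Let near_estimate : `|enorm z - rho| <= shell_C1 * kap ->
  `|enorm w ^+ 2 - enorm z ^+ 2 + 2 * (rho * (rho * lam) - rho * t)| <= shell_C5 * kap ^+ 2.
Proof.
have kh := kap_half; have k0 := kap0; have r0 := rho_gt0; have kr := kap_rho.
move=> zr.
have z2 : enorm z <= 2 * rho by move: zr; rewrite ler_norml => /andP[_ h]; lra.
have ww : enorm w <= 4 * rho + 2 by have := enorm_w_le; lra.
have wz : enorm (w - z) <= kap * shell_C2.
  apply: (le_trans enorm_wz); rewrite ler_wpM2l// /shell_C2; lra.
have z0 : z != 0 \/ z = 0 by case: eqVneq => h; [right|left].
pose om := radial z.
have omr : enorm om <= rho by exact: enorm_radial_le.
have zom : enorm (z - om) <= shell_C1 * kap.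
  rewrite /om; have [->|zn] := eqVneq z 0; last by rewrite enorm_radialB.
  rewrite radial0 subr0 enorm0 mulr_ge0// /shell_C1 addr_ge0// ltW//.
rewrite rholam /ell -/om.
have -> : rho * (t + (dot om (K *m om) + dot om b) / rho) - rho * t =
   dot om (K *m om) + dot om b by field; rewrite gt_eqF.
have wsq : enorm w ^+ 2 = enorm z ^+ 2 + 2 * dot z (w - z) + enorm (w - z) ^+ 2.
  have -> : enorm w = enorm (z + (w - z)) by rewrite addrC subrK.
  move: (w - z) => u; rewrite !sqr_enorm dotDl !dotDr (dotC u z); ring.
have dzE : dot z (w - z) = dot z (w - z + (b + K *m z)) - dot z (b + K *m z).
  by rewrite (dotDr (w - z) (b + K *m z) z) addrK.
have C20 : 0 <= shell_C2 by rewrite /shell_C2 addr_ge0 ?mulr_ge0// ltW.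
have e1 : `|2 * dot z (w - z + (b + K *m z))| <= 4 * rho * shell_C2 * kap ^+ 2.
  rewrite normrM (ger0_norm (_ : 0 <= 2))//.
  apply: (@le_trans _ _ (2 * (2 * rho * (kap * (kap * shell_C2))))); last first.
    by rewrite le_eqVlt; apply/orP; left; apply/eqP; ring.
  rewrite ler_wpM2l//; apply: le_trans (normr_dot_le _ _) _.
  rewrite ler_pM ?enorm_ge0//; apply: (le_trans enorm_wz_remainder).
  by rewrite ler_wpM2l.
have e2 : `|enorm (w - z) ^+ 2| <= shell_C2 ^+ 2 * kap ^+ 2.
  rewrite ger0_norm ?sqr_ge0// -exprMn mulrC.
  by apply: lerXn2r; rewrite ?nnegrE ?enorm_ge0// mulr_ge0.
have e3 : `|dot z b - dot om b| <= shell_C1 * kap ^+ 2.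
  rewrite -dotNl -dotDl (le_trans (normr_dot_le _ _))// expr2 mulrA.
  by rewrite ler_pM ?enorm_ge0.
have e4 : `|dot z (K *m z) - dot om (K *m om)| <= shell_C1 * (3 * rho) * kap ^+ 2.
  have -> : dot z (K *m z) - dot om (K *m om) = dot (z - om) (K *m z) + dot om (K *m (z - om)).
    by rewrite dotDl dotNl mulmxBr dotDr dotNr; ring.
  rewrite (le_trans (ler_normD _ _))//.
  have f1 : `|dot (z - om) (K *m z)| <= shell_C1 * kap * (kap * (2 * rho)).
    rewrite (le_trans (normr_dot_le _ _))// ler_pM ?enorm_ge0//.
    by rewrite (le_trans (enorm_K _))// ler_wpM2l.
  have f2 : `|dot om (K *m (z - om))| <= rho * (kap * (shell_C1 * kap)).
    rewrite (le_trans (normr_dot_le _ _))// ler_pM ?enorm_ge0//.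
    by rewrite (le_trans (enorm_K _))// ler_wpM2l.
  by apply: le_trans (lerD f1 f2) _; rewrite le_eqVlt; apply/orP; left; apply/eqP; ring.
rewrite wsq dzE.
set X := dot z (w - z + _) in e1 *; rewrite (dotDr b (K *m z) z).
set Y := enorm (w - z) ^+ 2 in e2 *.
have -> : enorm z ^+ 2 + 2 * (X - (dot z b + dot z (K *m z))) + Y - enorm z ^+ 2 +
  2 * (dot om (K *m om) + dot om b) = 2 * X + Y - 2 * (dot z b - dot om b)
  - 2 * (dot z (K *m z) - dot om (K *m om)) by ring.
move: e1 e2 e3 e4; rewrite /shell_C5.
move: (2 * X) Y (dot z b - dot om b) (dot z (K *m z) - dot om (K *m om)) => x y u v.
rewrite !ler_norml => /andP[? ?] /andP[? ?] /andP[? ?] /andP[? ?].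
by apply/andP; split; lra.
Qed.

Let eta_ge0 : 0 <= eta. Proof. by rewrite mulr_ge0 ?sqr_ge0// ltW// shell_C6_gt0. Qed.

(** The three summands absorb, in order, the error of [near_estimate], the square of t in
    [shell_upper], and the square of the first-order displacement in [shell_lower]. *)
Let eta_big : rho ^+ 2 * eta = (shell_C5 + 1 + 2 * (2 + rho) ^+ 2) * kap ^+ 2.
Proof. by rewrite /shell_C6 mulrA [X in X * _]mulrC divfK// expf_neq0// gt_eqF. Qed.

Let tsq : t ^+ 2 <= kap ^+ 2.
Proof.
by rewrite -real_normK ?num_real//; apply: lerXn2r; rewrite ?nnegrE.
Qed.

Lemma shell_upper : enorm w <= rho + t -> enorm z <= rho * (1 + lam + eta).
Proof.
have kh := kap_half; have k0 := kap0; have r0 := rho_gt0; have kr := kap_rho.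
move=> h; have h1 := shell_far_out h.
move: (lam_le); rewrite ler_norml => /andP[l1 l2].
have C1E : shell_C1 * kap = (2 + rho) * kap + kap by rewrite /shell_C1; ring.
have re0 : 0 <= rho * eta by rewrite mulr_ge0// ltW.
(* Deep inside there is nothing to prove: the first-order radius moves by at most (2 + rho) kap,
   less than [shell_C1 * kap]. *)
case: (lerP (rho - shell_C1 * kap) (enorm z)) => h2; last first.
  by rewrite !mulrDr mulr1; lra.
have zr : `|enorm z - rho| <= shell_C1 * kap by rewrite ler_norml; apply/andP; split; lra.
have := near_estimate zr; rewrite ler_norml => /andP[n1 n2].
have p0 : 0 <= rho * (1 + lam + eta) by rewrite !mulrDr mulr1; lra.
rewrite -ler_sqr ?nnegrE ?enorm_ge0//.
have wt : enorm w ^+ 2 <= (rho + t) ^+ 2.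
  by apply: lerXn2r; rewrite ?nnegrE ?enorm_ge0// (le_trans (enorm_ge0 w)).
have -> : (rho * (1 + lam + eta)) ^+ 2 =
  rho ^+ 2 + 2 * (rho * (rho * lam)) + 2 * (rho ^+ 2 * eta) + (rho * lam + rho * eta) ^+ 2 by ring.
have := sqr_ge0 (rho * lam + rho * eta); rewrite eta_big.
have := sqr_ge0 kap; have := mulr_ge0 shell_C5_ge0 (sqr_ge0 kap).
have := mulr_ge0 (sqr_ge0 (2 + rho)) (sqr_ge0 kap).
move: wt; rewrite sqrrD => wt; move: tsq; lra.
Qed.

Lemma shell_lower : enorm z <= rho * (1 + lam - eta) -> enorm w <= rho + t.
Proof.
have kh := kap_half; have k0 := kap0; have r0 := rho_gt0; have kr := kap_rho.
move=> h.
move: (lam_le); rewrite ler_norml => /andP[l1 l2].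
have C1E : shell_C1 * kap = (2 + rho) * kap + kap by rewrite /shell_C1; ring.
have re0 : 0 <= rho * eta by rewrite mulr_ge0// ltW.
case: (lerP (rho - shell_C1 * kap) (enorm z)) => h2; last exact: shell_far_in.
have h' := h; rewrite mulrBr !mulrDr mulr1 in h'.
have zr : `|enorm z - rho| <= shell_C1 * kap by rewrite ler_norml; apply/andP; split; lra.
have := near_estimate zr; rewrite ler_norml => /andP[n1 n2].
have rt0 : 0 <= rho + t.
  move: tk; rewrite ler_norml => /andP[t1 t2].
  have : kap * 3 <= kap * shell_C1 by rewrite ler_wpM2l// /shell_C1; have := rho_gt0; lra.
  lra.
rewrite -ler_sqr ?nnegrE ?enorm_ge0//.
have zs : enorm z ^+ 2 <= (rho * (1 + lam - eta)) ^+ 2.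
  by apply: lerXn2r; rewrite ?nnegrE ?enorm_ge0// (le_trans (enorm_ge0 z)).
move: zs.
have -> : (rho * (1 + lam - eta)) ^+ 2 =
  rho ^+ 2 + 2 * (rho * (rho * lam)) - 2 * (rho ^+ 2 * eta) + (rho * lam - rho * eta) ^+ 2 by ring.
(* (x - y)^2 <= 2 x^2 + 2 y^2; the assumption eta <= 1/2 makes the square of rho eta at most half of
   rho^2 eta, so half of the available 2 rho^2 eta survives. *)
have sq2 : (rho * lam - rho * eta) ^+ 2 <= 2 * ((2 + rho) ^+ 2 * kap ^+ 2) + rho ^+ 2 * eta.
  have s1 : (rho * lam) ^+ 2 <= (2 + rho) ^+ 2 * kap ^+ 2.
    rewrite -exprMn -[leLHS]real_normK ?num_real//; apply: lerXn2r; rewrite ?nnegrE//.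
    by rewrite mulr_ge0// addr_ge0// ltW.
  have s2 : (rho * eta) ^+ 2 <= 2^-1 * (rho ^+ 2 * eta).
    move: eta_ge0 kap_eta; move: (shell_C6 * kap ^+ 2) => e e0 e1.
    by rewrite exprMn [leRHS]mulrCA ler_wpM2l ?sqr_ge0// expr2 ler_wpM2r.
  have := sqr_ge0 (rho * lam + rho * eta); rewrite sqrrD sqrrB; lra.
move: sq2; rewrite eta_big sqrrD.
have := sqr_ge0 kap; have := sqr_ge0 t; lra.
Qed.

End Perturbation.
End ShellGeometry.

Lemma exists_small (R : realType) (s : seq (R * R)) :
  (forall p, p \in s -> 0 <= p.1 /\ 0 < p.2) ->
  exists2 d, 0 < d & forall x, 0 <= x -> x < d -> forall p, p \in s -> p.1 * x <= p.2.
Proof.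
elim: s => [|p s IH] h; first by exists 1.
have [d d0 hd] := IH (fun p' ps => h p' (@mem_behead _ (p :: s) p' ps)).
have [p1 p2] := h p (mem_head _ _).
have p1' : 0 < p.1 + 1 by rewrite ltr_wpDl.
exists (Num.min d (p.2 / (p.1 + 1))); first by rewrite lt_min d0 divr_gt0.
move=> x x0; rewrite lt_min => /andP[xd xp] u; rewrite inE => /predU1P[->|]; last exact: hd.
move: xp; rewrite ltr_pdivlMr// mulrDr mulr1 mulrC; lra.
Qed.

(** Each induction step at most doubles the error and adds n x^2; the base 4 absorbs both. *)
Lemma expr1D_taylor (R : realType) (x : R) n : `|x| <= 1 ->
  `|(1 + x) ^+ n - 1 - n%:R * x| <= 4 ^+ n * x ^+ 2.
Proof.
move=> x1; elim: n => [|n IH]; first by rewrite expr0 mul0r subrr subr0 normr0 mul1r sqr_ge0.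
have -> : (1 + x) ^+ n.+1 - 1 - n.+1%:R * x =
  (1 + x) * ((1 + x) ^+ n - 1 - n%:R * x) + n%:R * x ^+ 2 by rewrite exprS -(natr1 n); ring.
rewrite (le_trans (ler_normD _ _))// normrM [`|n%:R * _|]ger0_norm; last first.
  by apply: mulr_ge0; rewrite ?sqr_ge0.
have h1 : `|1 + x| <= 2 by rewrite (le_trans (ler_normD _ _))// normr1; lra.
have h2 : `|1 + x| * `|(1 + x) ^+ n - 1 - n%:R * x| <= 2 * (4 ^+ n * x ^+ 2) by apply: ler_pM.
have h3 : n%:R <= 2 * 4 ^+ n :> R.
  rewrite -natrX -natrM ler_nat (leq_trans (ltnW (ltn_expl n (isT : 1 < 4)%N)))//.
  by rewrite leq_pmull.
have h4 : n%:R * x ^+ 2 <= 2 * 4 ^+ n * x ^+ 2 by rewrite ler_wpM2r ?sqr_ge0.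
rewrite (exprS 4 n); lra.
Qed.

(** * First-order expansion of integrals over the perturbed ball *)

Section Expansion.
Variables (R : realType) (k : nat) (k_gt0 : (0 < k)%N).
Notation V := 'cV[R]_k.
Variables (lam : {measure set (k.-tuple R) -> \bar R}) (hlam : is_lebesgue lam).
Local Notation itg := (itg lam).
Local Notation int := (int lam).
Variables (f : V -> R) (f_ge0 : forall x, 0 <= f x).
Hypothesis (f_meas : measurable_fun setT (f \o @tup2cV R k)).
Hypothesis (f_dens : (\int[lam]_t (f (tup2cV t))%:E)%E = 1%E).
Variables (mu0 : V) (Gamma0 : 'M[R]_k) (hG : is_PD Gamma0).
Local Notation q := (std_density f mu0 Gamma0).
Local Notation J := (std_exp lam f mu0 Gamma0).
Variables (rho : R) (rho_gt0 : 0 < rho).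
Hypothesis (q_cont : forall w, enorm w = rho -> {for w, continuous q}).
Local Notation radial := (radial rho).
Local Notation B := (fun z : V => (enorm z <= rho)%R%:R).

Let iq : itg q := itg_q k_gt0 hlam f_ge0 f_meas f_dens mu0 hG.
Let mq : mea q := itg_mea iq.

Lemma itg_homogeneous_ball (g : V -> R) M : mea g -> (forall z, `|g z| <= M) ->
  itg (fun z => g z * B z).
Proof.
move=> mg gM; apply: (@itg_bounded_ball _ _ _ hlam _ M rho).
  by apply: meaM => //; exact: mea_ball.
by move=> z; rewrite normrM normr_nat ler_wpM2r.
Qed.

(** The origin is invariant under dilation by 2, so its volume equals 2^k times itself. *)
Lemma ball0_null : int (fun z : V => (enorm z <= 0)%R%:R) = 0.
Proof.
have [_] := int_scale k_gt0 hlam (ltr0n R 2 : 0 < 2) (itg_ball hlam 0).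
have -> : (fun x : V => (enorm (2 *: x) <= 0)%R%:R : R) = (fun x => (enorm x <= 0)%R%:R).
  by apply/funext => x; rewrite enormZ gtr0_norm// pmulr_rle0.
move=> /eqP; rewrite -subr_eq0 -[X in X - _]mul1r -mulrBl mulf_eq0 => /orP[|/eqP//].
rewrite subr_eq0 eq_sym => /eqP h; have : (1 : R) < 2 ^+ k by rewrite exprn_egt1// ?lt0n_neq0// ltr1n.
by rewrite h ltxx.
Qed.

(** The cone formula omits the origin; adding this null point gives an integral over the whole
    ball. *)
Lemma sphere_intE (g : V -> R) M : mea (fun z => g (radial z)) ->
  (forall z, `|g (radial z)| <= M) ->
  sphere_int lam rho g = k%:R / rho * int (fun z => g (radial z) * B z).
Proof.
move=> mg gM; rewrite /sphere_int; congr (_ * _).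
pose g1 z := g (radial z) * B z - g (radial z) * (enorm z <= 0)%R%:R.
have i1 := itg_homogeneous_ball mg gM.
have m0 : mea (fun z => g (radial z) * (enorm z <= 0)%R%:R) by apply: meaM => //; exact: mea_ball.
have i0 : itg (fun z => M * (enorm z <= 0)%R%:R) by apply: itgZ; exact: itg_ball.
have b0 z : `|g (radial z) * (enorm z <= 0)%R%:R| <= M * (enorm z <= 0)%R%:R.
  by rewrite normrM normr_nat ler_wpM2r.
have -> : int (fun z => g (radial z) * B z) = int g1.
  rewrite intB//; last exact: itg_dom b0.
  have : `|int (fun z => g (radial z) * (enorm z <= 0)%R%:R)| <= 0.
    by apply: le_trans (normr_int_le m0 i0 b0) _; rewrite intZ ?ball0_null ?mulr0//; exact: itg_ball.
  by rewrite normr_le0 => /eqP ->; rewrite subr0.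
rewrite /int /Rintegral; congr fine; rewrite [LHS]integral_mkcond; apply: eq_integral => t _.
rewrite /patch /g1 -mulrBr.
have -> : (enorm (tup2cV t) <= rho)%R%:R - (enorm (tup2cV t) <= 0)%R%:R =
  (0 < enorm (tup2cV t) <= rho)%R%:R :> R.
  case: (lerP (enorm (tup2cV t)) 0) => h /=; last by rewrite subr0.
  by rewrite (le_trans h (ltW rho_gt0)) subrr.
case: ifPn => h.
  by rewrite inE /= in h; rewrite h mulr1.
by rewrite notin_setE /= in h; move/negP/negbTE: h => ->; rewrite mulr0.
Qed.

Section Functional.
(** [G] is a test function and [DG z] its differential at z. The radius 4 rho + 2 contains every
    [w z] with |z| <= 2 rho and kap <= 1/4, by [enorm_w_le]. *)
Variables (G : V -> R) (DG : V -> V -> R) (M : R).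
Hypotheses (M_ge0 : 0 <= M) (mG : mea G).
Hypothesis G_bound : forall x, enorm x <= 4 * rho + 2 -> `|G x| <= M.
Hypothesis G_lip : forall x y, enorm x <= 4 * rho + 2 -> enorm y <= 4 * rho + 2 ->
  `|G x - G y| <= M * enorm (x - y).
Hypothesis G_taylor : forall z w, enorm z <= rho -> enorm w <= 4 * rho + 2 ->
  `|G w - G z - DG z (w - z)| <= M * enorm (w - z) ^+ 2.
Hypothesis DGD : forall z u v, DG z (u + v) = DG z u + DG z v.
Hypothesis DG_bound : forall z v, enorm z <= rho -> `|DG z v| <= M * enorm v.
Hypothesis mDG : forall F, meaV F -> mea (fun z => DG z (F z)).

Local Notation C1 := (shell_C1 rho).
Local Notation C2 := (shell_C2 rho).
Local Notation C6 := (shell_C6 rho).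
Local Notation vol := (ball_vol lam rho : R).
Local Notation K3 := (k%:R * 3 ^+ k : R).
Local Notation Dt := (\det Gamma0).

Let r0 : 0 < rho. Proof. exact: rho_gt0. Qed.
Let C1_gt0 : 0 < C1. Proof. by rewrite /shell_C1 addr_gt0. Qed.
Let C2_gt0 : 0 < C2. Proof. by rewrite /shell_C2 addr_gt0// mulr_gt0. Qed.
Let C6_gt0 : 0 < C6. Proof. exact: shell_C6_gt0. Qed.
Let vol_ge0 : 0 <= vol. Proof. exact: int_ge0. Qed.
Let Dt_gt0 : 0 < Dt. Proof. exact: det_Gamma_gt0. Qed.
Let q0 z : 0 <= q z. Proof. exact: f_ge0. Qed.

(** Volume bound, per unit of kap, for the shell of half-width 2 C1 kap around the sphere. *)
Definition thin_const : R := K3 * (2 * (2 * C1 / rho)) * vol.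
(** Gathers the coefficients of kap^2 in the bounds for the four pieces of the error; [Mq] bounds
    [q] on the sphere. *)
Definition quad_const (Mq : R) : R :=
  M * (C2 ^+ 2 + C2) + Dt * (M * (C1 + C2) * (Mq + 1) * thin_const
    + M * Mq * (K3 * (2 * C6) * vol) + M * Mq * 4 ^+ k * ((2 + rho) / rho) ^+ 2 * vol).

Lemma thin_const_ge0 : 0 <= thin_const.
Proof.
apply: mulr_ge0 => //; apply: mulr_ge0 => //; apply: mulr_ge0 => //.
by rewrite divr_ge0 ?mulr_ge0// ltW.
Qed.

Lemma quad_const_ge0 Mq : 0 <= Mq -> 0 <= quad_const Mq.
Proof.
move=> Mq0; apply: addr_ge0; first by rewrite mulr_ge0// addr_ge0 ?sqr_ge0// ltW.
apply: mulr_ge0; first exact: ltW.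
apply: addr_ge0; first apply: addr_ge0.
- apply: mulr_ge0; last exact: thin_const_ge0.
  by apply: mulr_ge0; rewrite ?addr_ge0// mulr_ge0// addr_ge0// ltW.
- apply: mulr_ge0; first exact: mulr_ge0.
  by apply: mulr_ge0 => //; apply: mulr_ge0 => //; rewrite mulr_ge0// ltW.
- apply: mulr_ge0 => //; apply: mulr_ge0; last exact: sqr_ge0.
  by rewrite mulr_ge0 ?exprn_ge0// mulr_ge0.
Qed.

Section Perturbed.
Variables (Mq d e1 : R).
Hypotheses (Mq_ge0 : 0 <= Mq) (hMq : forall z, q (radial z) <= Mq).
Hypotheses (e1_gt0 : 0 < e1) (e1_le1 : e1 <= 1).
Hypothesis hd : forall z, `|enorm z - rho| < d -> `|q z - q (radial z)| <= e1.
Variables (K : 'M[R]_k) (b : V) (t kap : R) (w : V -> V).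
Hypotheses (Kk : msum K <= kap) (bk : enorm b <= kap) (tk : `|t| <= kap) (kap0 : 0 < kap).
Hypotheses (mw : meaV w) (wE : forall z, w z + K *m w z = z - b).
Hypotheses (k4 : kap <= 4^-1) (k_rho : C1 * kap <= rho / 8) (k_C6 : C6 * kap <= 4^-1).
Hypotheses (k_d : C1 * kap < d) (k_l : (2 + rho) / rho * kap <= 4^-1).

Let hk0 : 0 <= kap. Proof. exact: ltW. Qed.
Let k2 : kap <= 2^-1. Proof. by have := k4; lra. Qed.
Let ksq : kap ^+ 2 <= kap.
Proof. by rewrite expr2 ler_piMr//; have := k4; lra. Qed.

Local Notation eta := (C6 * kap ^+ 2).
Let eta0 : 0 <= eta. Proof. by rewrite mulr_ge0 ?sqr_ge0// ltW. Qed.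
Let eta4 : eta <= 4^-1.
Proof. by apply: le_trans k_C6; rewrite ler_wpM2l// ltW. Qed.
Let kap_eta : eta <= 2^-1. Proof. by apply: le_trans eta4 _; lra. Qed.
Let kap_rho : C1 * kap <= rho. Proof. by have := k_rho; have := r0; lra. Qed.

Let la z := ell rho K b t (radial z) / rho.
Let la_le z : `|la z| <= (2 + rho) / rho * kap.
Proof.
rewrite /la normrM normfV (gtr0_norm r0) mulrAC ler_wpM2r ?invr_ge0 ?(ltW r0)//.
exact: (normr_ell r0 Kk bk tk hk0 (enorm_radial_le r0 z)).
Qed.
Let mrad : meaV (radial : V -> V). Proof. exact: meaV_radial. Qed.
Let mla : mea la.
Proof.
apply: meaM; last exact: mea_cst.
apply: meaD; first exact: mea_cst.
apply: meaM; last exact: mea_cst.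
apply: meaD; apply: mea_dot => //; first exact: meaV_mul.
exact: meaV_cst.
Qed.
Let hla : homogeneous0 la. Proof. by move=> c z c0; rewrite /la radialZ. Qed.
Let a z := 1 + la z.
Let ma : mea a. Proof. by apply: meaD => //; exact: mea_cst. Qed.
Let ha : homogeneous0 a. Proof. by move=> c z c0; rewrite /a hla. Qed.
Let la4 z : - 4^-1 <= la z <= 4^-1.
Proof. by rewrite -ler_norml (le_trans (la_le z)). Qed.
Let a_bounds z : eta <= a z <= 3 / 2.
Proof.
have e4 := eta4; have /andP[l1 l2] := la4 z.
by rewrite /a; move: (la z) l1 l2 => x l1 l2; apply/andP; split; lra.
Qed.
Let a02 z : 0 <= a z <= 2.
Proof.
have /andP[l1 l2] := la4 z.
by rewrite /a; move: (la z) l1 l2 => x l1 l2; apply/andP; split; lra.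
Qed.

Let D (z : V) : R := (enorm (w z) <= rho + t)%R%:R.
Let B' (z : V) : R := (enorm z <= rho * a z)%R%:R.
Let T (z : V) : R := (enorm z <= rho * (a z + eta))%R%:R - (enorm z <= rho * (a z - eta))%R%:R.
Let mD : mea D. Proof. by apply: mea_le; [exact: mea_enorm|exact: mea_cst]. Qed.
Let mB : mea B. Proof. exact: mea_ball. Qed.
Let mB' : mea B'. Proof. exact: mea_star_set. Qed.

(** The perturbed ball and the star set with the first-order radius differ only in a shell of
    relative half-width eta, of order kap^2. *)
Let DB' z : `|D z - B' z| <= T z.
Proof.
have ra1 : rho * (a z - eta) <= rho * a z by rewrite ler_pM2l// gerBl.
have ra2 : rho * a z <= rho * (a z + eta) by rewrite ler_pM2l// lerDl.
have up : enorm (w z) <= rho + t -> enorm z <= rho * (a z + eta).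
  exact: (shell_upper r0 Kk bk tk hk0 k2 (wE z) kap_rho).
have lo : enorm z <= rho * (a z - eta) -> enorm (w z) <= rho + t.
  exact: (shell_lower r0 Kk bk tk hk0 k2 (wE z) kap_rho kap_eta).
rewrite /D /B' /T.
case: (lerP (enorm z) (rho * (a z - eta))) => h1.
  by rewrite (lo h1) (le_trans h1 ra1) (le_trans h1 (le_trans ra1 ra2)) !subrr normr0.
rewrite subr0; case: (lerP (enorm z) (rho * (a z + eta))) => h2.
  by case: (_ <= rho + t); case: (_ <= rho * a z);
    rewrite ?subrr ?subr0 ?sub0r ?normrN ?normr0 ?normr1 ?ler01 ?lexx.
have -> : (enorm (w z) <= rho + t) = false by apply/negP => /up; rewrite leNgt h2.
have -> : (enorm z <= rho * a z) = false.
  by apply/negP => h3; move: (le_trans h3 ra2); rewrite leNgt h2.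
by rewrite subrr normr0.
Qed.

Local Notation eta2 := (2 * C1 / rho * kap).
Let eta2E : rho * eta2 = 2 * (C1 * kap). Proof. by field; rewrite gt_eqF. Qed.
Let eta2_ge0 : 0 <= eta2. Proof. by rewrite mulr_ge0// divr_ge0 ?mulr_ge0// ltW. Qed.
Let eta24 : eta2 <= 4^-1.
Proof. by rewrite -(ler_pM2l r0) eta2E; have := k_rho; lra. Qed.
(** This shell excludes its inner sphere; doubling the half-width C1 kap keeps all points at
    distance at most C1 kap inside it. *)
Let Sh (z : V) : R := (enorm z <= rho * (1 + eta2))%R%:R - (enorm z <= rho * (1 - eta2))%R%:R.
Let C1k : 0 < C1 * kap. Proof. by rewrite mulr_gt0. Qed.

Let far z : `|enorm z - rho| <= C1 * kap \/ D z = B z.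
Proof.
have ck := C1k; have r0' := r0.
case: (lerP `|enorm z - rho| (C1 * kap)) => h; [by left|right].
rewrite /D; move: h; rewrite ltNge ler_norml negb_and -!ltNge => /orP[h|h].
  have h1 : enorm z < rho - C1 * kap by lra.
  rewrite (shell_far_in r0 Kk bk tk hk0 k2 (wE z) kap_rho h1).
  by have -> : enorm z <= rho by lra.
have -> : (enorm (w z) <= rho + t) = false.
  by apply/negP => /(shell_far_out r0 Kk bk tk hk0 k2 (wE z) kap_rho) h1; lra.
by have -> : (enorm z <= rho) = false by apply/negP => h1; lra.
Qed.

Let near_w z : enorm z <= 2 * rho ->
  enorm (w z) <= 4 * rho + 2 /\ enorm (w z - z) <= C2 * kap.
Proof.
move=> z2; have h1 := enorm_w_le Kk bk hk0 k2 (wE z).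
have h2 : enorm (w z) <= 4 * rho + 2 by have := k4; lra.
split => //; apply: le_trans (enorm_wz Kk bk (wE z)) _.
by rewrite mulrC; apply: ler_wpM2r => //; rewrite /shell_C2; lra.
Qed.

Let u z := G (radial z) * q (radial z).
Let rad_in (z : V) : enorm (radial z) <= 4 * rho + 2.
Proof. by apply: le_trans (enorm_radial_le r0 z) _; have := r0; lra. Qed.
Let mGr : mea (fun z : V => G (radial z)). Proof. exact: mea_comp. Qed.
Let mqr : mea (fun z : V => q (radial z)). Proof. exact: mea_comp. Qed.
Let mu : mea u. Proof. exact: meaM. Qed.
Let uM z : `|u z| <= M * Mq.
Proof. by rewrite normrM (ger0_norm (q0 _)); apply: ler_pM => //; exact: G_bound. Qed.
Let hu : homogeneous0 u. Proof. by move=> c z c0; rewrite /u radialZ. Qed.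
Let MMq0 : 0 <= M * Mq. Proof. exact: mulr_ge0. Qed.

Let X0 z := D z * G (w z) * q z.
Let X1 z := B z * G z * q z.
Let X2 z := B z * DG z (- (b + K *m z)) * q z.

Let mF : meaV (fun z => - (b + K *m z)).
Proof.
rewrite (_ : (fun z => _) = (fun z => (-1) *: (b + K *m z))).
  apply: meaVZ; first exact: mea_cst.
  apply: meaVD; first exact: meaV_cst.
  by apply: meaV_mul; exact: meaV_id.
by apply/funext => z; rewrite scaleN1r.
Qed.
Let mGw : mea (fun z => G (w z)). Proof. exact: mea_comp. Qed.

Lemma itg_perturbed : itg X0.
Proof.
apply: (itgM_bounded (M := M)) => // [|z _]; first exact: meaM.
rewrite normrM normr_nat; case: (lerP (enorm (w z)) (rho + t)) => h; last by rewrite mul0r.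
have r0' := r0; have k4' := k4.
rewrite mul1r; apply: G_bound; move: tk; rewrite ler_norml => /andP[_ t2]; lra.
Qed.

Let iX1 : itg X1.
Proof.
apply: (itgM_bounded (M := M)) => // [|z _]; first exact: meaM.
rewrite normrM normr_nat; case: (lerP (enorm z) rho) => h; last by rewrite mul0r.
have r0' := r0.
rewrite mul1r; apply: G_bound; lra.
Qed.

Let bK z : enorm z <= rho -> enorm (- (b + K *m z)) <= kap * (1 + rho).
Proof.
move=> zr; rewrite enormN (le_trans (enormD _ _))// mulrDr mulr1 lerD//.
by rewrite (le_trans (enorm_K Kk z))// ler_wpM2l.
Qed.

Let iX2 : itg X2.
Proof.
apply: (itgM_bounded (M := M * (kap * (1 + rho)))) => // [|z _].
  by apply: meaM => //; exact: mDG.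
rewrite normrM normr_nat; case: (lerP (enorm z) rho) => h; last first.
  by rewrite mul0r mulr_ge0// mulr_ge0// addr_ge0// ltW.
by rewrite mul1r (le_trans (DG_bound _ h))// ler_wpM2l// bK.
Qed.

(** Four sources of error: [I1] linearizes the integrand on the fixed ball, [I2] freezes [G] and [q]
    at their sphere values where the two balls differ, [I3] replaces the perturbed ball by its
    first-order star set, and [I4] compares that set with the ball and carries the surface
    integral. *)
Let I1 z := B z * (G (w z) - G z - DG z (- (b + K *m z))) * q z.
Let I2 z := (D z - B z) * (G (w z) * q z - u z).
Let I3 z := (D z - B' z) * u z.
Let I4 z := (B' z - B z) * u z.

Let decomp : (fun z => X0 z - X1 z - X2 z) = (fun z => I1 z + I2 z + (I3 z + I4 z)).
Proof. by apply/funext => z; rewrite /X0 /X1 /X2 /I1 /I2 /I3 /I4; ring. Qed.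

Let b1 z : `|I1 z| <= M * (C2 ^+ 2 + C2) * kap ^+ 2 * q z.
Proof.
rewrite /I1 normrM (ger0_norm (q0 z)) ler_wpM2r// normrM normr_nat.
case: (lerP (enorm z) rho) => h; last first.
  by rewrite mul0r; apply: mulr_ge0 (sqr_ge0 _); rewrite mulr_ge0// addr_ge0 ?sqr_ge0// ltW.
have z2 : enorm z <= 2 * rho by have := r0; lra.
rewrite mul1r; have [w1 w2] := near_w z2.
have -> : G (w z) - G z - DG z (- (b + K *m z)) =
   (G (w z) - G z - DG z (w z - z)) + DG z (w z - z + (b + K *m z)).
  have := DGD z (w z - z + (b + K *m z)) (- (b + K *m z)); rewrite addrK => ->; ring.
rewrite (le_trans (ler_normD _ _))//.
have f1 : `|G (w z) - G z - DG z (w z - z)| <= M * (C2 * kap) ^+ 2.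
  rewrite (le_trans (G_taylor h w1))// ler_wpM2l//.
  by apply: lerXn2r => //; rewrite nnegrE ?enorm_ge0// mulr_ge0// ltW.
have f2 : `|DG z (w z - z + (b + K *m z))| <= M * (kap * (C2 * kap)).
  rewrite (le_trans (DG_bound _ h))// ler_wpM2l//.
  by rewrite (le_trans (enorm_wz_remainder Kk (wE z)))// ler_wpM2l.
by apply: le_trans (lerD f1 f2) _; rewrite le_eqVlt; apply/orP; left; apply/eqP; ring.
Qed.
Let mI1 : mea I1.
Proof.
by apply: meaM => //; apply: meaM => //; apply: meaB; [apply: meaB|exact: mDG].
Qed.
Let iI1 : itg I1. Proof. exact: (itg_dom mI1 (itgZ _ iq) b1). Qed.

Local Notation e2 := (M * (C1 + C2) * kap * (Mq + 1) + M * e1).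
Let e2_ge0 : 0 <= e2.
Proof.
apply: addr_ge0; last by rewrite mulr_ge0// ltW.
apply: mulr_ge0; last by rewrite addr_ge0.
by apply: mulr_ge0 => //; rewrite mulr_ge0// addr_ge0// ltW.
Qed.

Let Sh_ge0 z : 0 <= Sh z.
Proof.
rewrite /Sh subr_ge0 ler_nat; case: (lerP (enorm z) (rho * (1 - eta2))) => // h.
by rewrite (le_trans h)// ler_pM2l// lerD2l (le_trans _ eta2_ge0)// oppr_le0.
Qed.

Let Sh1 z : `|enorm z - rho| <= C1 * kap -> Sh z = 1.
Proof.
have ck := C1k.
rewrite /Sh (mulrDr rho 1 eta2) (mulrBr rho 1 eta2) !mulr1 eta2E ler_norml => /andP[z1 z2].
have -> : enorm z <= rho + 2 * (C1 * kap) by lra.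
have -> : (enorm z <= rho - 2 * (C1 * kap)) = false by apply/negP => h; lra.
by rewrite subr0.
Qed.

(** The two balls differ only near the sphere, where moving to the radial projection changes [G] by
    O(kap) and [q] by at most [e1]. This is the only term that uses the continuity of [q]. *)
Let b2 z : `|I2 z| <= e2 * Sh z.
Proof.
rewrite /I2; case: (far z) => [zr|->]; last first.
  by rewrite subrr mul0r normr0 mulr_ge0.
rewrite Sh1// mulr1 normrM.
have DB1 : `|D z - B z| <= 1.
  rewrite /D; case: (_ <= rho + t); case: (_ <= rho);
    by rewrite ?subrr ?subr0 ?sub0r ?normrN ?normr0 ?normr1 ?ler01 ?lexx.
apply: (@le_trans _ _ (1 * `|G (w z) * q z - u z|)); first by rewrite ler_wpM2r.
have r0' := r0; have kr := k_rho.
rewrite mul1r /u.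
have zn0 : z != 0.
  by apply: contraTneq zr => ->; rewrite enorm0 sub0r normrN (gtr0_norm r0) -ltNge; lra.
have zd : `|enorm z - rho| < d by exact: (le_lt_trans zr).
have qn := hd zd.
have z2 : enorm z <= 2 * rho by move: zr; rewrite ler_norml => /andP[_ ?]; lra.
have [w1 w2] := near_w z2.
have wr : enorm (w z - radial z) <= (C1 + C2) * kap.
  rewrite (_ : w z - radial z = (w z - z) + (z - radial z)); last by rewrite addrA subrK.
  rewrite (le_trans (enormD _ _))// enorm_radialB// addrC mulrDl.
  exact: lerD.
have gG : `|G (w z) - G (radial z)| <= M * ((C1 + C2) * kap).
  by rewrite (le_trans (G_lip w1 (rad_in z)))// ler_wpM2l.
have qz : q z <= Mq + 1.
  by have := hMq z; have := e1_le1; move: qn; rewrite ler_norml => /andP[_ ?] ? ?; lra.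
have -> : G (w z) * q z - G (radial z) * q (radial z) =
  (G (w z) - G (radial z)) * q z + G (radial z) * (q z - q (radial z)) by ring.
rewrite (le_trans (ler_normD _ _))// !normrM (ger0_norm (q0 z)); apply: lerD.
  by rewrite -[M * _ * kap]mulrA; apply: ler_pM.
by apply: ler_pM => //; exact: G_bound.
Qed.
Let mI2 : mea I2.
Proof. by apply: meaM; [exact: meaB|apply: meaB => //; exact: meaM]. Qed.
Let iball s : itg (fun z : V => (enorm z <= s)%R%:R). Proof. exact: itg_ball. Qed.
Let iSh : itg Sh. Proof. by apply: itgB; exact: iball. Qed.
Let iI2 : itg I2. Proof. exact: (itg_dom mI2 (itgZ _ iSh) b2). Qed.

Let iT : itg T.
Proof.
have mp : mea (fun x => a x + eta) by apply: meaD => //; exact: mea_cst.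
have mm : mea (fun x => a x - eta) by apply: meaB => //; exact: mea_cst.
by have e4 := eta4; have e0 := eta0; apply: itgB; apply: itg_star_set => // z;
  have /andP[_] := a_bounds z; move: (a z) => x; lra.
Qed.
Let mI3 : mea I3. Proof. by apply: meaM => //; exact: meaB. Qed.
Let b3 z : `|I3 z| <= (M * Mq) * T z.
Proof. by rewrite /I3 normrM mulrC; apply: ler_pM. Qed.
Let iI3 : itg I3. Proof. exact: (itg_dom mI3 (itgZ _ iT) b3). Qed.

Let iB'u : itg (fun z => u z * B' z).
Proof.
apply: (@itg_bounded_ball _ _ _ hlam _ (M * Mq) (rho * 2)); first exact: meaM.
move=> z; rewrite normrM normr_nat; apply: ler_pM => //.
have /andP[a0 a2] := a02 z; rewrite ler_nat.
by rewrite /B'; case: (lerP (enorm z) (rho * a z)) => // h; rewrite (le_trans h)// ler_pM2l.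
Qed.
Let iBu : itg (fun z => u z * B z). Proof. exact: itg_homogeneous_ball uM. Qed.
Let I4E : I4 = (fun z => u z * B' z - u z * B z).
Proof. by apply/funext => z; rewrite /I4; ring. Qed.
Let iI4 : itg I4. Proof. by rewrite I4E; exact: itgB. Qed.
Let iau : itg (fun z => u z * a z ^+ k * B z).
Proof.
apply: (@itg_homogeneous_ball (fun z => u z * a z ^+ k) (M * Mq * 2 ^+ k)).
  by apply: meaM => //; exact: meaX.
move=> z; rewrite normrM normrX; have /andP[a0 a2] := a02 z; rewrite (ger0_norm a0).
by apply: ler_pM; rewrite ?exprn_ge0//; apply: lerXn2r; rewrite ?nnegrE.
Qed.
Let iul : itg (fun z => u z * la z * B z).
Proof.
apply: (@itg_homogeneous_ball (fun z => u z * la z) (M * Mq * 4^-1)); first exact: meaM.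
by move=> z; rewrite normrM; apply: ler_pM => //; rewrite ler_norml la4.
Qed.

Let int_I4 : int I4 = int (fun z => u z * a z ^+ k * B z) - int (fun z => u z * B z).
Proof.
rewrite I4E intB//; congr (_ - _).
exact: (int_star k_gt0 hlam mu hu uM ma ha a02 r0).
Qed.

Let sphE : sphere_int lam rho (fun x => G x * ell rho K b t x * q x) =
  k%:R * int (fun z => u z * la z * B z).
Proof.
have E z : G (radial z) * ell rho K b t (radial z) * q (radial z) = rho * (u z * la z).
  by rewrite /u /la; field; rewrite gt_eqF.
rewrite (@sphere_intE _ (rho * (M * Mq * 4^-1))).
- rewrite -mulrA; congr (_ * _).
  have -> : (fun z => G (radial z) * ell rho K b t (radial z) * q (radial z) * B z) =
      (fun z => rho * (u z * la z * B z)).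
    by apply/funext => z; rewrite E -mulrA.
  by rewrite intZ// mulKf// gt_eqF.
- rewrite (_ : (fun z => _) = (fun z => rho * (u z * la z))); last exact/funext.
  by apply: meaM; [exact: mea_cst|exact: meaM].
- move=> z; rewrite E normrM (gtr0_norm r0) ler_pM2l// normrM.
  by apply: ler_pM => //; rewrite ler_norml la4.
Qed.

(** By polar coordinates [I4] integrates u ((1 + la)^k - 1) over the ball; its linear part k u la is
    the surface integral of [sphE]. *)
Let b4 : `|int I4 - k%:R * int (fun z => u z * la z * B z)| <=
  M * Mq * 4 ^+ k * ((2 + rho) / rho) ^+ 2 * vol * kap ^+ 2.
Proof.
rewrite int_I4 -intZ// -intB// -intB; [|exact: itgB|exact: itgZ].
pose lb := (2 + rho) / rho * kap.
have lb0 : 0 <= lb by rewrite mulr_ge0// divr_ge0 ?addr_ge0// ltW.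
have i5 : itg (fun z => M * Mq * 4 ^+ k * lb ^+ 2 * B z) by apply: itgZ; exact: iball.
apply: (@le_trans _ _ (int (fun z => M * Mq * 4 ^+ k * lb ^+ 2 * B z))); last first.
  rewrite intZ; last exact: iball.
  by rewrite le_eqVlt /lb /ball_vol; apply/orP; left; apply/eqP; ring.
apply: normr_int_le => // [|z].
  by apply: (@itg_mea _ _ lam); apply: itgB; [exact: itgB|exact: itgZ].
have -> : u z * a z ^+ k * B z - u z * B z - k%:R * (u z * la z * B z) =
   u z * (a z ^+ k - 1 - k%:R * la z) * B z by ring.
rewrite normrM normr_nat ler_wpM2r// normrM -mulrA; apply: ler_pM => //.
have l1 : `|la z| <= 1 by rewrite (le_trans (la_le z))// (le_trans k_l)// invf_le1// ler1n.
rewrite (le_trans (expr1D_taylor k l1))// ler_wpM2l ?exprn_ge0//.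
rewrite -real_normK ?num_real//; apply: lerXn2r; rewrite ?nnegrE//; exact: la_le.
Qed.

Let c1 : Dt * `|int I1| <= M * (C2 ^+ 2 + C2) * kap ^+ 2.
Proof.
have := normr_int_le mI1 (itgZ _ iq) b1; rewrite intZ// => h.
have hq : Dt * int q = 1.
  rewrite -(std_exp1 k_gt0 hlam f_ge0 f_meas f_dens mu0 hG) /std_exp; congr (_ * int _).
  by apply/funext => z; rewrite mul1r.
by have := ler_wpM2l (ltW Dt_gt0) h; rewrite [X in _ <= X]mulrCA hq mulr1.
Qed.

Let c2 : `|int I2| <= (M * (C1 + C2) * (Mq + 1) * thin_const * kap + M * thin_const * e1) * kap.
Proof.
have := normr_int_le mI2 (itgZ _ iSh) b2; rewrite intZ// => h; apply: (le_trans h).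
have e24 := eta24; have e20 := eta2_ge0.
have h3 : 0 <= eta2 <= 2^-1 by apply/andP; split; lra.
have h1 : eta2 <= (1 : R) <= 3 / 2 by apply/andP; split; lra.
have h2 (x : V) : eta2 <= (1 : R) <= 3 / 2 by exact: h1.
have h4 := thin_shell k_gt0 hlam (mea_cst 1) (fun _ _ _ => erefl) r0 h3 h2.
apply: le_trans (ler_wpM2l e2_ge0 h4) _.
by rewrite le_eqVlt /thin_const; apply/orP; left; apply/eqP; ring.
Qed.

Let c3 : `|int I3| <= M * Mq * (K3 * (2 * C6) * vol) * kap ^+ 2.
Proof.
have := normr_int_le mI3 (itgZ _ iT) b3; rewrite intZ// => h; apply: (le_trans h).
have h3 : 0 <= eta <= 2^-1 by rewrite eta0 kap_eta.
have h4 := thin_shell k_gt0 hlam ma ha r0 h3 a_bounds.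
apply: le_trans (ler_wpM2l MMq0 h4) _.
by rewrite le_eqVlt; apply/orP; left; apply/eqP; ring.
Qed.

(** All errors are quadratic in kap except the one from the variation of [q] near the sphere, which
    is linear with the small factor [e1]. *)
Lemma perturbation_bound :
  `|J (fun z => (enorm (w z) <= rho + t)%R%:R * G (w z)) - J (fun z => B z * G z)
      - J (fun z => B z * DG z (- (b + K *m z)))
      - Dt * sphere_int lam rho (fun x => G x * ell rho K b t x * q x)|
  <= quad_const Mq * kap ^+ 2 + Dt * (M * thin_const) * e1 * kap.
Proof.
have JE : J (fun z => (enorm (w z) <= rho + t)%R%:R * G (w z)) - J (fun z => B z * G z)
      - J (fun z => B z * DG z (- (b + K *m z))) =
   Dt * (int I1 + int I2 + (int I3 + int I4)).
  have iX0 := itg_perturbed.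
  have e1' : int (fun z => I1 z + I2 z + (I3 z + I4 z)) = int I1 + int I2 + (int I3 + int I4).
    by rewrite (intD (itgD iI1 iI2) (itgD iI3 iI4)) (intD iI1 iI2) (intD iI3 iI4).
  rewrite -e1' -decomp (intB (itgB iX0 iX1) iX2) (intB iX0 iX1).
  by rewrite !mulrBr.
rewrite JE sphE -mulrBr normrM (gtr0_norm Dt_gt0).
have b4' := b4; set s4 := int I4 - _ in b4'.
have -> : int I1 + int I2 + (int I3 + int I4) - k%:R * int (fun z => u z * la z * B z) =
  int I1 + int I2 + int I3 + s4 by rewrite /s4; ring.
have tri : `|int I1 + int I2 + int I3 + s4| <= `|int I1| + `|int I2| + `|int I3| + `|s4|.
  by do 3 (apply: (le_trans (ler_normD _ _)); apply: lerD => //).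
apply: (le_trans (ler_wpM2l (ltW Dt_gt0) tri)).
rewrite 3!mulrDr.
have d2 := ler_wpM2l (ltW Dt_gt0) c2; have d3 := ler_wpM2l (ltW Dt_gt0) c3.
have d4 := ler_wpM2l (ltW Dt_gt0) b4'.
apply: le_trans (lerD (lerD (lerD c1 d2) d3) d4) _.
by rewrite le_eqVlt /quad_const; apply/orP; left; apply/eqP; ring.
Qed.

End Perturbed.

Theorem functional_expansion eps : 0 < eps ->
  exists2 kap1, 0 < kap1 & forall (K : 'M[R]_k) (b : V) (t kap : R) (w : V -> V),
    msum K <= kap -> enorm b <= kap -> `|t| <= kap -> 0 < kap -> kap < kap1 ->
    meaV w -> (forall z, w z + K *m w z = z - b) ->
    itg (fun z => (enorm (w z) <= rho + t)%R%:R * G (w z) * q z) /\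
    `|J (fun z => (enorm (w z) <= rho + t)%R%:R * G (w z)) - J (fun z => B z * G z)
      - J (fun z => B z * DG z (- (b + K *m z)))
      - Dt * sphere_int lam rho (fun x => G x * ell rho K b t x * q x)|
    <= eps * kap.
Proof.
move=> eps0.
have [Mq Mq0 hMq] := q_radial_bounded f_ge0 rho_gt0 q_cont.
pose A2 := Dt * (M * thin_const).
have A20 : 0 <= A2 by rewrite mulr_ge0 ?(ltW Dt_gt0)// mulr_ge0// thin_const_ge0.
have A10 := quad_const_ge0 Mq0.
(* The tolerance for [q] is fixed first and uses half of [eps]; it determines the shell width [d],
   and only then is kap made small enough for the quadratic part. *)
pose e1 := Num.min 1 (eps / 2 / (A2 + 1)).
have e10 : 0 < e1 by rewrite lt_min ltr01 !divr_gt0// ltr_wpDl.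
have e1A : A2 * e1 <= eps / 2.
  have : e1 <= eps / 2 / (A2 + 1) by rewrite ge_min lexx orbT.
  rewrite ler_pdivlMr ?ltr_wpDl// mulrDr mulr1 mulrC; apply: le_trans.
  by rewrite lerDl ltW.
have e11 : e1 <= 1 by rewrite ge_min lexx.
have [d /andP[d0 dr] hd] := q_near_sphere rho_gt0 q_cont e10.
pose constraints := [:: (1, 4^-1); (C1, rho / 8); (C6, 4^-1); (C1, d / 2);
  ((2 + rho) / rho, 4^-1); (quad_const Mq, eps / 2)].
have r2 : 0 <= (2 + rho) / rho by rewrite divr_ge0 ?addr_ge0// ltW.
case: (@exists_small R constraints) => [p|kap1 kap10 hkap].
  rewrite !inE => /or4P[/eqP->|/eqP->|/eqP->|/or3P[/eqP->|/eqP->|/eqP->]] /=;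
    by split; rewrite ?(ltW C1_gt0) ?(ltW C6_gt0) ?r2 ?A10 ?ler01 ?divr_gt0 ?invr_gt0.
exists kap1 => // K b t kap w Kk bk tk kap0 kapk mw wE.
have H p : p \in constraints -> p.1 * kap <= p.2 by apply: hkap => //; exact: ltW.
have k4 : kap <= 4^-1 by rewrite -[leLHS]mul1r; apply: (H (1, 4^-1)); rewrite !inE eqxx.
have k_rho : C1 * kap <= rho / 8 by apply: (H (C1, rho / 8)); rewrite !inE eqxx ?orbT.
have k_C6 : C6 * kap <= 4^-1 by apply: (H (C6, 4^-1)); rewrite !inE eqxx ?orbT.
have k_d : C1 * kap < d.
  apply: (@le_lt_trans _ _ (d / 2)); last by rewrite ltr_pdivrMr// ltr_pMr// ltr1n.
  by apply: (H (C1, d / 2)); rewrite !inE eqxx ?orbT.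
have k_l : (2 + rho) / rho * kap <= 4^-1.
  by apply: (H ((2 + rho) / rho, 4^-1)); rewrite !inE eqxx ?orbT.
have k_A1 : quad_const Mq * kap <= eps / 2.
  by apply: (H (quad_const Mq, eps / 2)); rewrite !inE eqxx ?orbT.
split; first exact: (itg_perturbed tk mw k4).
apply: le_trans (perturbation_bound Mq0 hMq e10 e11 hd Kk bk tk kap0 mw wE k4 k_rho k_C6 k_d k_l) _.
rewrite -/A2 expr2 mulrA -mulrDl ler_pM2r// [leRHS](splitr eps).
exact: lerD.
Qed.

End Functional.
End Expansion.

(** * Surface integrals *)

Section SurfaceMeasure.
Variables (R : realType) (k : nat) (k_gt0 : (0 < k)%N).
Notation V := 'cV[R]_k.
Variables (lam : {measure set (k.-tuple R) -> \bar R}) (hlam : is_lebesgue lam).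
Local Notation itg := (itg lam).
Local Notation int := (int lam).

Lemma ball_vol_gt0 (rho : R) : 0 < rho -> 0 < ball_vol lam rho.
Proof.
move=> r0; rewrite -lte_fin EFin_int; last exact: itg_ball.
(* The cube of half-side rho / k lies in the ball, as the Euclidean norm is at most the sum of the
   coordinates' absolute values. *)
pose c := rho / k%:R; have k0 : 0 < k%:R :> R by rewrite ltr0n.
have c0 : 0 < c by rewrite divr_gt0.
pose a := [tuple - c | i < k]; pose b := [tuple c | i < k].
have bE := hlam (a := a) (b := b).
have ab i : tnth a i <= tnth b i by rewrite !tnth_mktuple; lra.
have bE2 := bE ab; pose S := [set x : k.-tuple R | forall i, tnth a i <= tnth x i <= tnth b i].
have mS : measurable S by exact: (measurable_box a b).
apply: (@lt_le_trans _ _ (lam S)).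
  rewrite [lam S]bE2 lte_fin; apply: prodr_gt0 => i _; rewrite !tnth_mktuple; lra.
rewrite -[S]setIT -integral_indic//; apply: ge0_le_integral => //.
- by apply/measurable_EFinP; exact: measurable_indic.
- by apply/measurable_EFinP; have := itg_mea (itg_ball hlam rho).
move=> x _; rewrite lee_fin indicE; case: (boolP (x \in S)) => //; rewrite inE => xS.
suff -> : enorm (tup2cV x) <= rho by [].
apply: le_trans (enorm_le_sum _) _; apply: (@le_trans _ _ (\sum_(i < k) c)).
  by apply: ler_sum => i _; rewrite mxE ler_norml; have := xS i; rewrite !tnth_mktuple.
by rewrite sumr_const card_ord -[leLHS]mulr_natr divfK// gt_eqF.
Qed.

Variables (f : V -> R) (f_ge0 : forall x, 0 <= f x).
Hypothesis (f_meas : measurable_fun setT (f \o @tup2cV R k)).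
Hypothesis (f_dens : (\int[lam]_t (f (tup2cV t))%:E)%E = 1%E).
Variables (mu0 : V) (Gamma0 : 'M[R]_k) (hG : is_PD Gamma0).
Local Notation q := (std_density f mu0 Gamma0).
Variables (rho : R) (rho_gt0 : 0 < rho).
Hypothesis (q_cont : forall w, enorm w = rho -> {for w, continuous q}).
Local Notation rad := (radial rho).
Local Notation B := (fun z : V => (enorm z <= rho)%R%:R).
Local Notation nu := (nu_int lam f mu0 Gamma0 rho).

(** A class closed under sums and products and containing the coordinates, hence all polynomials; on
    it [nu] is linear. Boundedness on the ball, not just the sphere, also covers the value of
    [radial] at the origin. *)
Definition bounded_on_ball (h : V -> R) :=
  mea h /\ exists M, forall z, enorm z <= rho -> `|h z| <= M.

Lemma bounded_on_ball_cst c : bounded_on_ball (fun=> c).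
Proof. by split; [exact: mea_cst|exists `|c|]. Qed.

Lemma bounded_on_ball_coord i : bounded_on_ball (fun z => z i 0).
Proof.
split; first exact: mea_coord.
by exists rho => z; apply: le_trans; exact: le_coord_enorm.
Qed.

Lemma bounded_on_ballD g h : bounded_on_ball g -> bounded_on_ball h ->
  bounded_on_ball (fun z => g z + h z).
Proof.
move=> [mg [M hM]] [mh [N hN]]; split; first exact: meaD.
by exists (M + N) => z zr; rewrite (le_trans (ler_normD _ _))// lerD ?hM ?hN.
Qed.

Lemma bounded_on_ballM g h : bounded_on_ball g -> bounded_on_ball h ->
  bounded_on_ball (fun z => g z * h z).
Proof.
move=> [mg [M hM]] [mh [N hN]]; split; first exact: meaM.
by exists (M * N) => z zr; rewrite normrM ler_pM ?hM ?hN.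
Qed.

Lemma bounded_on_ballZ c g : bounded_on_ball g -> bounded_on_ball (fun z => c * g z).
Proof. by move=> hg; apply: bounded_on_ballM => //; exact: bounded_on_ball_cst. Qed.

Lemma bounded_on_ball_sum I (s : seq I) (g : I -> V -> R) :
  (forall i, bounded_on_ball (g i)) -> bounded_on_ball (fun z => \sum_(i <- s) g i z).
Proof.
move=> hg; elim: s => [|i s IH].
  by under eq_fun do rewrite big_nil; exact: bounded_on_ball_cst.
by under eq_fun do rewrite big_cons; exact: bounded_on_ballD.
Qed.

Let mqr : mea (fun z : V => q (rad z)).
Proof.
apply: mea_comp; last exact: meaV_radial.
exact: (itg_mea (itg_q k_gt0 hlam f_ge0 f_meas f_dens mu0 hG)).
Qed.

Lemma itg_sphere h : bounded_on_ball h ->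
  mea (fun z => h (rad z) * q (rad z)) /\
  exists M, forall z, `|h (rad z) * q (rad z)| <= M.
Proof.
move=> [mh [M hM]].
have [N N0 hN] := q_radial_bounded f_ge0 rho_gt0 q_cont.
split; first by apply: meaM => //; apply: mea_comp => //; exact: meaV_radial.
exists (M * N) => z; rewrite normrM ler_pM ?hM//; first exact: enorm_radial_le.
by rewrite ger0_norm//; exact: f_ge0.
Qed.

Lemma itg_sphere_ball h : bounded_on_ball h ->
  itg (fun z => h (rad z) * q (rad z) * B z).
Proof. by move=> /itg_sphere[m [M hM]]; exact: (itg_homogeneous_ball hlam rho m hM). Qed.

Lemma nu_intE h : bounded_on_ball h ->
  nu h = \det Gamma0 * (k%:R / rho) * int (fun z => h (rad z) * q (rad z) * B z).
Proof.
move=> /itg_sphere[m [M hM]]; rewrite /nu_int -mulrA; congr (_ * _).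
by rewrite (sphere_intE k_gt0 hlam rho_gt0 (g := fun w => h w * q w) m hM).
Qed.

Lemma nu_intD g h : bounded_on_ball g -> bounded_on_ball h ->
  nu (fun z => g z + h z) = nu g + nu h.
Proof.
move=> hg hh; rewrite !nu_intE//; last exact: bounded_on_ballD.
rewrite -mulrDr -(intD (itg_sphere_ball hg) (itg_sphere_ball hh)).
by congr (_ * int _); apply/funext => z; rewrite mulrDl mulrDl.
Qed.

Lemma nu_intZ c g : bounded_on_ball g -> nu (fun z => c * g z) = c * nu g.
Proof.
move=> hg; rewrite !nu_intE//; last exact: bounded_on_ballZ.
rewrite [RHS]mulrCA -(intZ c (itg_sphere_ball hg)).
by congr (_ * int _); apply/funext => z; rewrite !mulrA.
Qed.

Lemma nu_int_sum I (s : seq I) (g : I -> V -> R) : (forall i, bounded_on_ball (g i)) ->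
  nu (fun z => \sum_(i <- s) g i z) = \sum_(i <- s) nu (g i).
Proof.
move=> hg; elim: s => [|i s IH].
  under eq_fun do rewrite big_nil; rewrite big_nil.
  rewrite -[0 in X in nu X](mul0r 0) nu_intZ ?mul0r//; exact: bounded_on_ball_cst.
under eq_fun do rewrite big_cons.
by rewrite big_cons nu_intD ?IH//; exact: bounded_on_ball_sum.
Qed.

Lemma nu_int1_gt0 : (forall w, enorm w = rho -> 0 < q w) -> 0 < nu (fun=> 1).
Proof.
move=> q_pos; rewrite nu_intE; last exact: bounded_on_ball_cst.
have [c c0 hc] := sphere_pos_lb q_cont q_pos.
apply: mulr_gt0.
  by rewrite mulr_gt0 ?divr_gt0 ?ltr0n//; exact: det_Gamma_gt0.
have i1 := itgZ c (itg_ball hlam rho); have i0 := itgZ c (itg_ball hlam 0).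
apply: (@lt_le_trans _ _ (int (fun z : V => c * B z - c * (enorm z <= 0)%R%:R))).
  rewrite (intB i1 i0) (intZ c (itg_ball hlam 0)) (intZ c (itg_ball hlam rho)).
  by rewrite ball0_null// mulr0 subr0 mulr_gt0//; exact: ball_vol_gt0.
apply: le_int; [exact: itgB|exact: (itg_sphere_ball (bounded_on_ball_cst 1))|move=> z].
rewrite mul1r; have [->|z0] := eqVneq z 0.
  by rewrite enorm0 lexx (ltW rho_gt0) subrr mulr1; exact: f_ge0.
have -> : enorm z <= 0 = false.
  by apply/negbTE; rewrite -ltNge lt_def enorm_ge0 enorm_eq0 z0.
by rewrite mulr0 subr0 ler_wpM2r// hc// enorm_radial.
Qed.

Section Flip.
Hypothesis q_sym : forall i w, enorm w = rho -> q (flip i w) = q w.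

Definition flip_mx (i : 'I_k) : 'M[R]_k := diag_mx (\row_j (if j == i then -1 else 1)).

Lemma flip_mxE i w : flip_mx i *m w = flip i w.
Proof.
apply/colP => j; rewrite mul_diag_mx !mxE.
by case: (j == i); rewrite ?mulN1r ?mul1r.
Qed.

Lemma normr_det_flip i : `|\det (flip_mx i)| = 1.
Proof.
rewrite det_diag normr_prod big1// => j _; rewrite mxE.
by case: (j == i); rewrite ?normrN normr1.
Qed.

Lemma enorm_flip i (w : V) : enorm (flip i w) = enorm w.
Proof.
rewrite /enorm; congr Num.sqrt; apply: eq_bigr => j _; rewrite mxE.
by case: (j == i); rewrite ?sqrrN.
Qed.

Lemma radial_flip i (w : V) : rad (flip i w) = flip i (rad w).
Proof.
rewrite /radial enorm_flip; apply/colP => j; rewrite !mxE.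
by case: (j == i); rewrite ?mulrN.
Qed.

Lemma nu_int_flip i h : bounded_on_ball h -> nu (fun w => h (flip i w)) = nu h.
Proof.
move=> hh.
have hf : bounded_on_ball (fun w => h (flip i w)).
  case: hh => mh [M hM]; split; last by exists M => z zr; rewrite hM// enorm_flip.
  have -> : (fun w => h (flip i w)) = h \o (fun w => flip_mx i *m w).
    by apply/funext => w /=; rewrite flip_mxE.
  by apply: mea_comp => //; apply: meaV_mul; exact: meaV_id.
rewrite !nu_intE//; congr (_ * _).
have uF : flip_mx i \in unitmx.
  by rewrite unitmxE unitfE -normr_eq0 normr_det_flip oner_eq0.
have [_ ->] := int_affine k_gt0 hlam 0 uF (itg_sphere_ball hh).
rewrite normr_det_flip mul1r; congr int; apply/funext => z.
rewrite addr0 flip_mxE radial_flip enorm_flip.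
(* Symmetry of [q] is given on the sphere only; at the origin the reflection fixes the point
   itself. *)
have [->|z0] := eqVneq z 0; last by rewrite q_sym// enorm_radial.
have r0 : rad 0 = 0 :> V by rewrite /radial scaler0.
have -> : flip i (rad 0) = rad 0; last by [].
by rewrite r0; apply/colP => j; rewrite !mxE oppr0 if_same.
Qed.

Lemma nu_int_odd i h : bounded_on_ball h -> (forall w, h (flip i w) = - h w) -> nu h = 0.
Proof.
move=> hh odd; have := nu_int_flip i hh.
have -> : (fun w => h (flip i w)) = (fun w => -1 * h w).
  by apply/funext => w; rewrite odd mulN1r.
rewrite nu_intZ// mulN1r => /eqP; rewrite eq_sym -addr_eq0 -mulr2n mulrn_eq0 /=.
by move=> /eqP.
Qed.

End Flip.
End SurfaceMeasure.

(** * Surface moments and injectivity of the linear system *)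

Section SphereMoments.
Variables (R : realType) (k : nat) (k_gt0 : (0 < k)%N).
Notation V := 'cV[R]_k.
Variables (lam : {measure set (k.-tuple R) -> \bar R}) (hlam : is_lebesgue lam).
Local Notation itg := (itg lam).
Local Notation int := (int lam).
Variables (f : V -> R) (f_ge0 : forall x, 0 <= f x).
Hypothesis (f_meas : measurable_fun setT (f \o @tup2cV R k)).
Hypothesis (f_dens : (\int[lam]_t (f (tup2cV t))%:E)%E = 1%E).
Variables (mu0 : V) (Gamma0 : 'M[R]_k) (hG : is_PD Gamma0).
Local Notation q := (std_density f mu0 Gamma0).
Variables (rho : R) (rho_gt0 : 0 < rho).
Hypothesis (q_cont : forall w, enorm w = rho -> {for w, continuous q}).
Local Notation rad := (radial rho).
Local Notation nu := (nu_int lam f mu0 Gamma0 rho).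
Local Notation bdd := (@bounded_on_ball R k rho).

Let nuD := nu_intD k_gt0 hlam f_ge0 f_meas f_dens hG rho_gt0 q_cont.
Let nuZ := nu_intZ k_gt0 hlam f_ge0 f_meas f_dens hG rho_gt0 q_cont.
Let nu_sum := nu_int_sum k_gt0 hlam f_ge0 f_meas f_dens hG rho_gt0 q_cont.
Let nuE := nu_intE k_gt0 hlam f_ge0 f_meas f_dens hG rho_gt0 q_cont.
Let itgs := itg_sphere_ball k_gt0 hlam f_ge0 f_meas f_dens hG rho_gt0 q_cont.

(** The radial integrands can differ only at the origin, which is a null set. *)
Lemma nu_int_eq g h : bdd g -> bdd h -> (forall w, enorm w = rho -> g w = h w) -> nu g = nu h.
Proof.
move=> hg hh gh; rewrite !nuE//; congr (_ * _); apply/eqP.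
rewrite -subr_eq0 -(intB (itgs hg) (itgs hh)) -normr_le0.
pose c := `|g 0 * q 0 - h 0 * q 0|.
have i0 := itgZ c (itg_ball hlam 0).
have <- : int (fun z : V => c * (enorm z <= 0)%R%:R) = 0.
  by rewrite (intZ c (itg_ball hlam 0)) ball0_null// mulr0.
apply: normr_int_le => [|//|z]; first exact: (@itg_mea _ _ lam _ (itgB (itgs hg) (itgs hh))).
have [->|z0] := eqVneq z 0.
  by rewrite enorm0 lexx (ltW rho_gt0) !mulr1 /radial scaler0.
by rewrite gh ?enorm_radial// subrr normr0 mulr_ge0// normr_ge0.
Qed.

Lemma ellE (K : 'M[R]_k) (b : V) t w : ell rho K b t w =
  t + rho^-1 * (\sum_l \sum_m K l m * (w l 0 * w m 0) + \sum_l b l 0 * w l 0).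
Proof.
rewrite /ell [_ / rho]mulrC /dot; congr (_ + _ * (_ + _)).
  apply: eq_bigr => l _; rewrite mxE mulr_sumr; apply: eq_bigr => m _; ring.
by apply: eq_bigr => l _; rewrite mulrC.
Qed.

Lemma bounded_on_ball_coordM l m : bdd (fun w : V => w l 0 * w m 0).
Proof. by apply: bounded_on_ballM; exact: bounded_on_ball_coord. Qed.

Lemma bounded_on_ball_ell K b t : bdd (ell rho K b t).
Proof.
have -> : ell rho K b t = fun w => t + rho^-1 *
    (\sum_l \sum_m K l m * (w l 0 * w m 0) + \sum_l b l 0 * w l 0).
  by apply/funext => w; exact: ellE.
apply: bounded_on_ballD; first exact: bounded_on_ball_cst.
apply: bounded_on_ballZ; apply: bounded_on_ballD.
  apply: bounded_on_ball_sum => l; apply: bounded_on_ball_sum => m.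
  by apply: bounded_on_ballZ; exact: bounded_on_ball_coordM.
by apply: bounded_on_ball_sum => l; apply: bounded_on_ballZ; exact: bounded_on_ball_coord.
Qed.

Definition shell_int (G : V -> R) K b t := nu (fun w : V => G w * ell rho K b t w).

Lemma shell_int_linear G c K1 b1 t1 K2 b2 t2 : bdd G ->
  shell_int G (c *: K1 + K2) (c *: b1 + b2) (c * t1 + t2) =
  c * shell_int G K1 b1 t1 + shell_int G K2 b2 t2.
Proof.
move=> hG'; rewrite /shell_int.
have h1 := bounded_on_ballM hG' (bounded_on_ball_ell K1 b1 t1).
have h2 := bounded_on_ballM hG' (bounded_on_ball_ell K2 b2 t2).
rewrite -(nuZ c h1) -(nuD (bounded_on_ballZ c h1) h2); congr nu; apply/funext => w.
rewrite /ell mulmxDl -scalemxAl !dotDr !dotZr; ring.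
Qed.

Lemma shell_intE G K b t : bdd G -> shell_int G K b t = t * nu G +
  rho^-1 * (\sum_l \sum_m K l m * nu (fun w : V => G w * (w l 0 * w m 0))
            + \sum_l b l 0 * nu (fun w : V => G w * w l 0)).
Proof.
move=> hG'; rewrite /shell_int.
have h2 l m : bdd (fun w : V => G w * (w l 0 * w m 0)).
  by apply: bounded_on_ballM => //; exact: bounded_on_ball_coordM.
have h1 l : bdd (fun w : V => G w * w l 0).
  by apply: bounded_on_ballM => //; exact: bounded_on_ball_coord.
have -> : (fun w : V => G w * ell rho K b t w) = (fun w : V => t * G w +
  rho^-1 * (\sum_l \sum_m K l m * (G w * (w l 0 * w m 0)) + \sum_l b l 0 * (G w * w l 0))).
  apply/funext => w; rewrite ellE mulrDr [G w * t]mulrC [G w * (_ * _)]mulrCA mulrDr.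
  congr (_ + _ * (_ + _)); rewrite mulr_sumr; apply: eq_bigr => l _; last by rewrite mulrCA.
  by rewrite mulr_sumr; apply: eq_bigr => m _; rewrite mulrCA.
have s2 l : bdd (fun w : V => \sum_m K l m * (G w * (w l 0 * w m 0))).
  by apply: bounded_on_ball_sum => m; exact: bounded_on_ballZ.
have s1 : bdd (fun w : V => \sum_l b l 0 * (G w * w l 0)).
  by apply: bounded_on_ball_sum => l; exact: bounded_on_ballZ.
have s3 : bdd (fun w : V => \sum_l \sum_m K l m * (G w * (w l 0 * w m 0))).
  exact: bounded_on_ball_sum.
rewrite (nuD (bounded_on_ballZ t hG') (bounded_on_ballZ _ (bounded_on_ballD s3 s1))).
rewrite (nuZ t hG') (nuZ _ (bounded_on_ballD s3 s1)) (nuD s3 s1) (nu_sum _ s2).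
rewrite nu_sum => [|l]; last exact: bounded_on_ballZ.
congr (_ + _ * (_ + _)); apply: eq_bigr => l _; last exact: nuZ.
rewrite nu_sum => [|m]; last exact: bounded_on_ballZ.
by apply: eq_bigr => m _; exact: nuZ.
Qed.

Section Symmetric.
Hypothesis q_sym : forall i w, enorm w = rho -> q (flip i w) = q w.

Let odd0 i h := @nu_int_odd _ _ k_gt0 _ hlam _ f_ge0 f_meas f_dens _ _ hG _ rho_gt0 q_cont q_sym i h.

Let coord i : bdd (fun w => w i 0) := @bounded_on_ball_coord R k rho i.

Lemma moment1 i : nu (fun w : V => w i 0) = 0.
Proof. by apply: (odd0 (i := i)) => // w; rewrite mxE eqxx. Qed.

Lemma moment2 i j : nu (fun w : V => w i 0 * w j 0) = (i == j)%:R * nu (fun w : V => w i 0 ^+ 2).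
Proof.
have [->|ij] := eqVneq i j; first by rewrite mul1r.
rewrite mul0r; apply: (odd0 (i := i)) => [|w]; first exact: bounded_on_ballM.
by rewrite !mxE eqxx eq_sym (negbTE ij) mulNr.
Qed.

Lemma moment3 i l m : nu (fun w : V => w i 0 * (w l 0 * w m 0)) = 0.
Proof.
have h : bdd (fun w : V => w i 0 * (w l 0 * w m 0)) by do !apply: bounded_on_ballM.
(* Among three indices one occurs an odd number of times; reflecting that coordinate changes the
   sign. *)
pose p := if l == m then i else if i == l then m else l.
apply: (odd0 (i := p)) => // w; rewrite !mxE /p.
have [<-|lm] := eqVneq l m; first by rewrite eqxx; case: ifP => _; ring.
have [->|il] := eqVneq i l; first by rewrite (negbTE lm) eqxx; ring.
rewrite (negbTE il) eqxx eq_sym (negbTE lm); ring.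
Qed.

Lemma moment4_diag i l m : nu (fun w : V => w i 0 * w i 0 * (w l 0 * w m 0)) =
  (l == m)%:R * nu (fun w : V => w i 0 ^+ 2 * w l 0 ^+ 2).
Proof.
have [<-|lm] := eqVneq l m; first by rewrite mul1r.
rewrite mul0r; apply: (odd0 (i := l)) => [|w]; first by do !apply: bounded_on_ballM.
rewrite !mxE eqxx [m == l]eq_sym (negbTE lm); case: (i == l); ring.
Qed.

Lemma moment4_offdiag i j l m : i != j -> nu (fun w : V => w i 0 * w j 0 * (w l 0 * w m 0)) =
  ((l == i) && (m == j) || (l == j) && (m == i))%:R * nu (fun w : V => w i 0 ^+ 2 * w j 0 ^+ 2).
Proof.
move=> ij; have hb : bdd (fun w : V => w i 0 * w j 0 * (w l 0 * w m 0)).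
  by apply: bounded_on_ballM; apply: bounded_on_ballM.
(* The exclusive or says that p occurs an odd number of times among the four indices. *)
have oddi p : (p == i) (+) (p == j) (+) (p == l) (+) (p == m) ->
    nu (fun w : V => w i 0 * w j 0 * (w l 0 * w m 0)) = 0.
  move=> hp; apply: (odd0 (i := p)) => // w; rewrite !mxE.
  move: hp; rewrite !(eq_sym _ p).
  by case: (p == i); case: (p == j); case: (p == l); case: (p == m) => //= _; ring.
have [li|li] := eqVneq l i.
  have [mj|mj] := eqVneq m j.
    by rewrite li mj mul1r; congr nu; apply/funext => w; ring.
  have lj : (l == j) = false by rewrite li (negbTE ij).
  rewrite lj mul0r; apply: (oddi j).
  by rewrite li eqxx [j == m]eq_sym (negbTE mj) [j == i]eq_sym (negbTE ij).
have [lj|lj] := eqVneq l j; last first.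
  rewrite mul0r.
  have [lm|lm] := eqVneq l m; last by apply: (oddi l); rewrite eqxx (negbTE li) (negbTE lj) (negbTE lm).
  by apply: (oddi i); rewrite eqxx -lm (negbTE ij) [i == l]eq_sym (negbTE li).
have [mi|mi] := eqVneq m i.
  by rewrite lj mi mul1r; congr nu; apply/funext => w; ring.
rewrite mul0r; apply: (oddi i).
by rewrite lj eqxx (negbTE ij) [i == m]eq_sym (negbTE mi).
Qed.

Section Injectivity.
Variables (gamma : R) (gamma_gt0 : 0 < gamma) (K : 'M[R]_k) (b : V) (t : R).
Hypothesis q_pos : forall w, enorm w = rho -> 0 < q w.
Hypothesis ha : forall i : 'I_k, nu (fun w : V => w i 0 ^+ 2) != gamma * rho.
Hypothesis hb : forall i j : 'I_k, i != j ->
  nu (fun w : V => w i 0 ^+ 2 * w j 0 ^+ 2) != gamma * rho.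
Hypothesis hc : forall x : V,
  Mmat lam f gamma mu0 Gamma0 rho *m x = 0 -> \sum_i x i 0 = 0 -> x = 0.
Local Notation N G := (shell_int G K b t).
Hypothesis e1 : forall i, N (fun w : V => w i 0) = gamma * b i 0.
Hypothesis e2 : forall i j, N (fun w : V => w i 0 * w j 0) - (i == j)%:R * N (fun=> 1 : R) =
  gamma * (K i j + K j i).
Hypothesis e3 : N (fun=> 1 : R) = 0.

Let nu1 : 0 < nu (fun=> 1 : R).
Proof. exact: nu_int1_gt0. Qed.

Let rho0 : rho != 0. Proof. by rewrite gt_eqF. Qed.

Let sum_pair (F : 'I_k -> 'I_k -> R) (P : 'I_k -> 'I_k -> R) c :
  (forall l m, F l m = P l m * c) -> \sum_l \sum_m K l m * F l m = (\sum_l \sum_m K l m * P l m) * c.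
Proof.
move=> h; rewrite mulr_suml; apply: eq_bigr => l _; rewrite mulr_suml.
by apply: eq_bigr => m _; rewrite h mulrA.
Qed.

(** With odd moments gone, the i-th equation reads b_i (nu(w_i^2) - gamma rho) = 0. *)
Lemma shell_inj_location : b = 0.
Proof.
apply/colP => i; have := e1 i; rewrite shell_intE//.
rewrite moment1 mulr0 add0r [X in X + _]big1 => [|l _]; last first.
  by rewrite big1// => m _; rewrite moment3 mulr0.
rewrite add0r (bigD1 i)//= [X in _ + X]big1 => [|l li]; last first.
  by rewrite moment2 eq_sym (negbTE li) mul0r mulr0.
rewrite moment2 eqxx mul1r addr0 mxE => h.
have /eqP : b i 0 * (nu (fun w : V => w i 0 ^+ 2) - gamma * rho) = 0.
  by have := congr1 ( *%R rho) h; rewrite mulVKf// mulrBr => ->; ring.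
by rewrite mulf_eq0 subr_eq0 (negbTE (ha i)) orbF => /eqP.
Qed.

(** Only the index pairs (i, j) and (j, i) survive, leaving (K_ij + K_ji)(nu(w_i^2 w_j^2) - gamma
    rho) = 0. *)
Lemma shell_inj_offdiag i j : i != j -> K i j + K j i = 0.
Proof.
move=> ij; have := e2 i j; rewrite (negbTE ij) mul0r subr0 shell_intE; last exact: bounded_on_ballM.
rewrite moment2 (negbTE ij) mul0r mulr0 add0r.
rewrite [X in _ * (_ + X)]big1 => [|l _]; last first.
  rewrite (_ : nu _ = 0) ?mulr0//; rewrite -[RHS](moment3 l i j); congr nu; apply/funext => w; ring.
rewrite addr0 (sum_pair (fun l m => moment4_offdiag l m ij)).
have -> : \sum_l \sum_m K l m * ((l == i) && (m == j) || (l == j) && (m == i))%:R = K i j + K j i.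
  have ji : j != i by rewrite eq_sym.
  rewrite (bigD1 i)//= (bigD1 j ji)/=.
  rewrite [X in _ + (_ + X)]big1 => [|l /andP[li lj]]; last first.
    by rewrite big1// => m _; rewrite (negbTE li) (negbTE lj) mulr0.
  rewrite addr0; congr (_ + _).
    rewrite (bigD1 j)//= !eqxx mulr1 big1 ?addr0// => m mj.
    by rewrite (negbTE mj) (negbTE ij) mulr0.
  rewrite (bigD1 i)//= !eqxx orbT mulr1 big1 ?addr0// => m mi.
  by rewrite (negbTE mi) eq_sym (negbTE ij) mulr0.
move=> h; have /eqP : (K i j + K j i) * (nu (fun w : V => w i 0 ^+ 2 * w j 0 ^+ 2) - gamma * rho) = 0.
  by have := congr1 ( *%R rho) h; rewrite mulVKf// mulrBr => ->; ring.
by rewrite mulf_eq0 subr_eq0 (negbTE (hb ij)) orbF => /eqP.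
Qed.

Let trace_eq : t * nu (fun=> 1 : R) + rho^-1 * \sum_l K l l * nu (fun w : V => w l 0 ^+ 2) = 0.
Proof.
rewrite -[RHS]e3 shell_intE; last exact: bounded_on_ball_cst.
congr (_ + _ * _); rewrite [X in _ + X]big1 => [|l _]; last first.
  rewrite (_ : nu _ = 0) ?mulr0//; rewrite -[RHS](moment1 l); congr nu; apply/funext => w; ring.
rewrite addr0; apply: eq_bigr => l _; rewrite (bigD1 l)//= big1 => [|m ml]; last first.
  rewrite (_ : nu _ = 0) ?mulr0//; transitivity (nu (fun w : V => w l 0 * w m 0)).
    by congr nu; apply/funext => w; rewrite mul1r.
  by rewrite moment2 eq_sym (negbTE ml) mul0r.
by rewrite addr0; congr (_ * nu _); apply/funext => w; rewrite mul1r.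
Qed.

Let diag_eq i : t * nu (fun w : V => w i 0 ^+ 2) +
  rho^-1 * \sum_l K l l * nu (fun w : V => w i 0 ^+ 2 * w l 0 ^+ 2) = 2 * gamma * K i i.
Proof.
have := e2 i i; rewrite e3 mulr0 subr0 shell_intE; last exact: bounded_on_ballM.
rewrite [X in _ * (_ + X)]big1 => [|l _]; last first.
  rewrite (_ : nu _ = 0) ?mulr0//; rewrite -[RHS](moment3 i i l); congr nu; apply/funext => w; ring.
rewrite addr0 => h; rewrite -[RHS]mulrA [RHS]mulrCA mulr_natl mulr2n -h; congr (_ + _ * _).
apply: eq_bigr => l _; rewrite (bigD1 l)//= moment4_diag eqxx mul1r big1 ?addr0// => m ml.
by rewrite moment4_diag eq_sym (negbTE ml) mul0r mulr0.
Qed.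

(** Summing the diagonal equations replaces the w_i^2 by their constant sum rho^2 on the sphere, so
    the left side is a multiple of [e3] and vanishes. This is the side condition of (c). *)
Let trace0 : \sum_l K l l = 0.
Proof.
have h2 i : bdd (fun w : V => w i 0 * w i 0 * ell rho K b t w).
  by apply: bounded_on_ballM; [exact: bounded_on_ballM|exact: bounded_on_ball_ell].
have : \sum_i N (fun w : V => w i 0 * w i 0) = 2 * gamma * \sum_l K l l.
  rewrite mulr_sumr; apply: eq_bigr => i _.
  by have := e2 i i; rewrite e3 mulr0 subr0 => ->; ring.
rewrite /shell_int -nu_sum//.
rewrite (@nu_int_eq _ (fun w : V => rho ^+ 2 * (1 * ell rho K b t w))) => [||| w wr].
- rewrite nuZ; last by apply: bounded_on_ballM; [exact: bounded_on_ball_cst|exact: bounded_on_ball_ell].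
  rewrite [nu _]e3 mulr0 => /esym/eqP; rewrite mulf_eq0 mulf_eq0 pnatr_eq0/= gt_eqF//=.
  by move=> /eqP.
- exact: bounded_on_ball_sum.
- apply: bounded_on_ballZ; apply: bounded_on_ballM; first exact: bounded_on_ball_cst.
  exact: bounded_on_ball_ell.
by rewrite -mulr_suml -wr sqr_enorm mul1r.
Qed.

(** Eliminating [t] from the diagonal equations by [trace_eq] produces exactly the rank-one
    correction in [Mmat], so the diagonal of [K] lies in its kernel. *)
Lemma shell_inj_diag i : K i i = 0.
Proof.
have : \col_l K l l = 0.
  apply: hc; last by rewrite -[RHS]trace0; apply: eq_bigr => l _; rewrite mxE.
  apply/colP => l; rewrite !mxE.
  under eq_bigr => j _ do rewrite !mxE !mulrBl.
  rewrite big_split/= big_split/= !sumrN.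
  have -> : \sum_j 2 * gamma * rho * (l == j)%:R * K j j = rho * (2 * gamma * K l l).
    rewrite (bigD1 l)//= eqxx mulr1 big1 => [|j jl]; first by ring.
    by rewrite eq_sym (negbTE jl) mulr0 mul0r.
  have -> : \sum_j nu (fun w : V => w l 0 ^+ 2) * nu (fun w : V => w j 0 ^+ 2) / nu (fun=> 1 : R) * K j j =
     nu (fun w : V => w l 0 ^+ 2) / nu (fun=> 1 : R) * \sum_j K j j * nu (fun w : V => w j 0 ^+ 2).
    by rewrite mulr_sumr; apply: eq_bigr => j _; ring.
  rewrite -diag_eq.
  have -> : \sum_j K j j * nu (fun w : V => w j 0 ^+ 2) = - (rho * t * nu (fun=> 1 : R)).
    apply/eqP; rewrite -addr_eq0; apply/eqP.
    have := congr1 ( *%R rho) trace_eq; rewrite mulr0 mulrDr mulVKf// => h; rewrite -[RHS]h; ring.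
  have -> : \sum_j nu (fun w : V => w l 0 ^+ 2 * w j 0 ^+ 2) * K j j =
     \sum_j K j j * nu (fun w : V => w l 0 ^+ 2 * w j 0 ^+ 2).
    by apply: eq_bigr => j _; rewrite mulrC.
  by field; rewrite rho0 gt_eqF.
by move=> /colP/(_ i); rewrite !mxE.
Qed.

Lemma shell_inj_radius : t = 0.
Proof.
have := trace_eq; rewrite big1 => [|l _]; last by rewrite shell_inj_diag mul0r.
by rewrite mulr0 addr0 => /eqP; rewrite mulf_eq0 orbC gt_eqF//= => /eqP.
Qed.

End Injectivity.
End Symmetric.
End SphereMoments.

(** Twice tr(H A H) is tr(H (A H + H A)) = 0, while tr(H A H) is the sum of the form of [A] over the
    columns of [H], so every column is zero. *)
Lemma PD_anticomm0 (R : realType) n (A H : 'M[R]_n) : is_PD A -> is_sym H ->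
  A *m H + H *m A = 0 -> H = 0.
Proof.
move=> [sA pA] sH e.
have col0 j : col j H = 0.
  apply/eqP/negPn/negP => /pA; apply/negP; rewrite -leNgt.
  have h0 : \tr (H *m A *m H) = 0.
    have /eqP : \tr (H *m A *m H) *+ 2 = 0.
      have -> : \tr (H *m A *m H) *+ 2 = \tr (H *m (A *m H + H *m A)).
        by rewrite mulmxDr mxtraceD mulmxA [\tr (H *m (H *m A))]mxtrace_mulC mulr2n.
      by rewrite e mulmx0 mxtrace0.
    by rewrite mulrn_eq0 => /eqP.
  rewrite -h0 /mxtrace.
  have E i : (H *m A *m H) i i = ((col i H)^T *m A *m col i H) 0 0.
    by rewrite tr_col sH -row_mul -!row_mul !mxE; apply: eq_bigr => l _; rewrite !mxE.
  rewrite (bigD1 j)//= -E lerDl; apply: sumr_ge0 => i _; rewrite E.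
  by have [->|/pA/ltW//] := eqVneq (col i H) 0; rewrite mulmx0 mxE.
by apply/matrixP => i j; have /colP/(_ i) := col0 j; rewrite !mxE.
Qed.

Lemma PD_inv (R : realType) n (A : 'M[R]_n) : is_PD A -> is_PD (invmx A).
Proof.
move=> hA; have uA := PD_unit hA; have sA : (invmx A)^T = invmx A by rewrite trmx_inv hA.1.
split => // x x0; have Ax : invmx A *m x != 0.
  by apply: contra_neq x0 => h; rewrite -[x](mulKVmx uA) h mulmx0.
by have := hA.2 _ Ax; rewrite trmx_mul sA -!mulmxA mulKVmx.
Qed.

(** * The derivative *)

Section MomentExpansion.
Variables (R : realType) (k : nat) (k_gt0 : (0 < k)%N).
Notation V := 'cV[R]_k.
Variables (lam : {measure set (k.-tuple R) -> \bar R}) (hlam : is_lebesgue lam).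
Local Notation itg := (itg lam).
Local Notation int := (int lam).
Variables (f : V -> R) (f_ge0 : forall x, 0 <= f x).
Hypothesis (f_meas : measurable_fun setT (f \o @tup2cV R k)).
Hypothesis (f_dens : (\int[lam]_t (f (tup2cV t))%:E)%E = 1%E).
Variables (mu0 : V) (Gamma0 : 'M[R]_k) (hG : is_PD Gamma0).
Local Notation q := (std_density f mu0 Gamma0).
Local Notation J := (std_exp lam f mu0 Gamma0).
Variables (rho : R) (rho_gt0 : 0 < rho).
Hypothesis (q_cont : forall w, enorm w = rho -> {for w, continuous q}).
Local Notation B := (fun z : V => (enorm z <= rho)%R%:R).
Variable gamma : R.
Hypothesis mom0 : J B = gamma.
Hypothesis mom1 : forall l, J (fun z => z l 0 * B z) = 0.
Hypothesis mom2 : forall l m, J (fun z => z l 0 * z m 0 * B z) = gamma * (l == m)%:R.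

(** [c K b] is the volume part of the derivative in closed form. Integrability is included because
    rewriting [Lambda] in the coordinates z requires it. *)
Definition expansion_at (G : V -> R) (c : 'M[R]_k -> V -> R) (eps kap : R) :=
  forall (K : 'M[R]_k) (b : V) (t : R) (w : V -> V),
    msum K <= kap -> enorm b <= kap -> `|t| <= kap -> 0 < kap ->
    meaV w -> (forall z, w z + K *m w z = z - b) ->
    itg (fun z => (enorm (w z) <= rho + t)%R%:R * G (w z) * q z) /\
    `|J (fun z => (enorm (w z) <= rho + t)%R%:R * G (w z)) - J (fun z => B z * G z)
      - c K b - shell_int lam f mu0 Gamma0 rho G K b t| <= eps * kap.

Let expand := functional_expansion k_gt0 hlam f_ge0 f_meas f_dens hG rho_gt0 q_cont.

Lemma expansion0 eps : 0 < eps ->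
  exists2 d, 0 < d & forall kap, kap < d -> expansion_at (fun=> 1) (fun _ _ => 0) eps kap.
Proof.
move=> e0; case: (@expand (fun=> 1) (fun _ _ => 0) 1 ler01 (mea_cst 1) _ _ _ _ _ _ eps e0)
  => [x _|x y _ _|z w _ _|z u v|z v _|F _|d d0 hd].
- by rewrite normr1.
- by rewrite subrr normr0 mul1r enorm_ge0.
- by rewrite subrr subr0 normr0 mul1r sqr_ge0.
- by rewrite addr0.
- by rewrite normr0 mul1r enorm_ge0.
- exact: mea_cst.
exists d => // kap kd K b t w Kk bk tk k0 mw wE.
have [hi hJ] := hd K b t kap w Kk bk tk k0 kd mw wE; split => //.
rewrite (_ : J (fun z => B z * 0) = 0) in hJ => //.
rewrite /std_exp (_ : (fun _ => _) = fun=> 0) ?int0 ?mulr0//.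
by apply/funext => z; rewrite mulr0 mul0r.
Qed.

Let rad4 : 2 <= 4 * rho + 2. Proof. by have := rho_gt0; lra. Qed.

(** The volume term is the integral of -(b + K z)_i over the ball: the constant part meets the mass
    gamma, the linear part the zero mean. *)
Lemma expansion1 i eps : 0 < eps ->
  exists2 d, 0 < d & forall kap, kap < d ->
    expansion_at (fun z => z i 0) (fun _ b => - (gamma * b i 0)) eps kap.
Proof.
move=> e0; have M0 : 0 <= 4 * rho + 2 by rewrite (le_trans _ rad4).
have M1 : 1 <= 4 * rho + 2 by rewrite (le_trans _ rad4)// ler1n.
have lip (v : V) : `|v i 0| <= (4 * rho + 2) * enorm v.
  by rewrite (le_trans (le_coord_enorm v i))// ler_peMl ?enorm_ge0.
case: (@expand (fun z => z i 0) (fun _ v => v i 0) _ M0 (mea_coord i) _ _ _ _ _ _ eps e0)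
  => [x|x y _ _|z w _ _|z u v|z v _|F|d d0 hd].
- by apply: le_trans; exact: le_coord_enorm.
- by have := lip (x - y); rewrite !mxE.
- by rewrite !mxE subrr normr0 mulr_ge0// sqr_ge0.
- by rewrite mxE.
- exact: lip.
- exact.
exists d => // kap kd K b t w Kk bk tk k0 mw wE.
have [hi hJ] := hd K b t kap w Kk bk tk k0 kd mw wE; split => //.
rewrite (_ : J (fun z => B z * (- (b + K *m z)) i 0) = - (gamma * b i 0)) in hJ => //.
have ib := itgq_ball k_gt0 hlam f_ge0 f_meas f_dens mu0 hG rho.
have ic l : itg (fun z => z l 0 * B z * q z).
  apply: (itgq_on_ball k_gt0 hlam f_ge0 f_meas f_dens mu0 hG (M := rho)); first exact: mea_coord.
  by move=> z; apply: le_trans; exact: le_coord_enorm.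
have ick l : itg (fun z => K i l * (z l 0 * B z) * q z).
  by under eq_fun do rewrite -mulrA; exact: itgZ.
have -> : (fun z => B z * (- (b + K *m z)) i 0) =
    (fun z => - b i 0 * B z - \sum_l K i l * (z l 0 * B z)).
  apply/funext => z; rewrite !mxE mulrC mulNr mulrDl mulr_suml opprD mulNr; congr (_ - _).
  by apply: eq_bigr => l _; rewrite mulrA.
rewrite std_expB; first last.
- by under eq_fun do rewrite mulr_suml; exact: itg_sum.
- by under eq_fun do rewrite -mulrA; exact: itgZ.
rewrite (std_expZ (h := B) _ ib) mom0 std_exp_sum// big1 => [|l _].
  by rewrite subr0; ring.
by rewrite (std_expZ (h := fun z => z l 0 * B z) _ (ic l)) mom1 mulr0.
Qed.

(** The volume term differentiates z_i z_j along -(b + K z): the terms in [b] meet the zero mean,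
    those in [K] the identity covariance. *)
Lemma expansion2 i j eps : 0 < eps ->
  exists2 d, 0 < d & forall kap, kap < d ->
    expansion_at (fun z => z i 0 * z j 0) (fun K _ => - (gamma * (K i j + K j i))) eps kap.
Proof.
move=> e0; set r := 4 * rho + 2.
have r0 : 0 <= r by rewrite (le_trans _ rad4).
have M0 : 0 <= r ^+ 2 by rewrite sqr_ge0.
(* Since r >= 2, the one constant r^2 dominates the sup bound r^2, the Lipschitz constant 2 r and
   the Taylor constant 1. *)
have r2 : 2 * r <= r ^+ 2 by rewrite expr2 ler_wpM2r.
have r1 : 1 <= r ^+ 2 by rewrite expr_ge1 ?(le_trans _ rad4)// ler1n.
have prod_le (x y : V) c d : enorm x <= c -> enorm y <= d -> `|x i 0 * y j 0| <= c * d.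
  move=> xc yd; rewrite normrM ler_pM//; apply: le_trans (le_coord_enorm _ _) _ => //.
case: (@expand (fun z => z i 0 * z j 0) (fun z v => v i 0 * z j 0 + z i 0 * v j 0) _ M0
  (meaM (mea_coord i) (mea_coord j)) _ _ _ _ _ _ eps e0)
  => [x xr|x y xr yr|z w _ _|z u v|z v zr|F mF|d d0 hd].
- by rewrite expr2; exact: prod_le.
- have -> : x i 0 * x j 0 - y i 0 * y j 0 = x i 0 * (x - y) j 0 + (x - y) i 0 * y j 0.
    by rewrite !mxE; ring.
  rewrite (le_trans (ler_normD _ _))//.
  apply: (@le_trans _ _ (r * enorm (x - y) + enorm (x - y) * r)).
    by apply: lerD; apply: prod_le.
  by rewrite [_ * r]mulrC -mulr2n -mulr_natl mulrA ler_wpM2r// enorm_ge0.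
- have -> : w i 0 * w j 0 - z i 0 * z j 0 - ((w - z) i 0 * z j 0 + z i 0 * (w - z) j 0) =
     (w - z) i 0 * (w - z) j 0 by rewrite !mxE; ring.
  rewrite (le_trans (prod_le _ _ _ _ (lexx _) (lexx _)))// -expr2.
  by rewrite ler_peMl// sqr_ge0.
- by rewrite !mxE; ring.
- rewrite (le_trans (ler_normD _ _))//.
  apply: (@le_trans _ _ (enorm v * rho + rho * enorm v)).
    by apply: lerD; apply: prod_le.
  have -> : enorm v * rho + rho * enorm v = 2 * rho * enorm v by ring.
  rewrite ler_wpM2r ?enorm_ge0// (le_trans _ r2)// /r; have := rho_gt0; lra.
- by apply: meaD; apply: meaM => //; exact: mea_coord.
exists d => // kap kd K b t w Kk bk tk k0 mw wE.
have [hi hJ] := hd K b t kap w Kk bk tk k0 kd mw wE; split => //.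
set X := J (fun z => B z * _) in hJ; set Y := J (fun z => B z * (_ + _)) in hJ.
have YE : Y = - (gamma * (K i j + K j i)); last by rewrite YE in hJ.
have ic l : itg (fun z => z l 0 * B z * q z).
  apply: (itgq_on_ball k_gt0 hlam f_ge0 f_meas f_dens mu0 hG (M := rho)); first exact: mea_coord.
  by move=> z; apply: le_trans; exact: le_coord_enorm.
have id l m : itg (fun z => z l 0 * z m 0 * B z * q z).
  apply: (itgq_on_ball k_gt0 hlam f_ge0 f_meas f_dens mu0 hG (M := rho * rho)).
    by apply: meaM; exact: mea_coord.
  by move=> z zr; rewrite normrM ler_pM// (le_trans (le_coord_enorm _ _)).
have iZ c (h : V -> R) : itg (fun z => h z * q z) -> itg (fun z => c * h z * q z).
  by move=> ih; under eq_fun do rewrite -mulrA; exact: itgZ.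
have iS m c : J (fun z => \sum_p c p * (z p 0 * z m 0 * B z)) = gamma * c m.
  rewrite std_exp_sum => [|p]; last exact: iZ.
  rewrite (bigD1 m)//= big1 => [|p pm].
    by rewrite (std_expZ _ (id m m)) mom2 eqxx mulr1 addr0 mulrC.
  by rewrite (std_expZ _ (id p m)) mom2 (negbTE pm) !mulr0.
have sumI m c : itg (fun z => (\sum_p c p * (z p 0 * z m 0 * B z) : R) * q z).
  by under eq_fun do rewrite mulr_suml; apply: itg_sum => p; exact: iZ.
have YE0 : (fun z => B z * ((- (b + K *m z)) i 0 * z j 0 + z i 0 * (- (b + K *m z)) j 0)) =
   (fun z => (- b i 0 * (z j 0 * B z) - b j 0 * (z i 0 * B z)) -
      ((\sum_p K i p * (z p 0 * z j 0 * B z)) + (\sum_p K j p * (z p 0 * z i 0 * B z)))).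
  apply/funext => z; rewrite !mxE.
  have sE l m : \sum_p K l p * (z p 0 * z m 0 * B z) = (\sum_p K l p * z p 0) * (z m 0 * B z).
    by rewrite mulr_suml; apply: eq_bigr => p _; rewrite !mulrA.
  by rewrite !sE; ring.
rewrite /Y YE0.
have i1 l c : itg (fun z => c * (z l 0 * B z) * q z) by exact: iZ.
have i2 : itg (fun z => (- b i 0 * (z j 0 * B z) - b j 0 * (z i 0 * B z)) * q z).
  by under eq_fun do rewrite mulrBl; exact: itgB.
have i3 : itg (fun z => ((\sum_p K i p * (z p 0 * z j 0 * B z)) +
    (\sum_p K j p * (z p 0 * z i 0 * B z))) * q z).
  by under eq_fun do rewrite mulrDl; exact: itgD.
rewrite (std_expB i2 i3) (std_expB (i1 j _) (i1 i _)).
rewrite (std_expD (sumI j _) (sumI i _)) !iS//.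
rewrite (std_expZ _ (ic i)) (std_expZ _ (ic j)) !mom1; ring.
Qed.

End MomentExpansion.

Lemma unitmx_inj (R : realType) n (A : 'M[R]_n) :
  (forall v : 'cV[R]_n, A *m v = 0 -> v = 0) -> A \in unitmx.
Proof.
move=> h; rewrite -unitmx_tr -row_free_unit -kermx_eq0.
apply/negPn/negP => /rowV0Pn [v]; rewrite sub_kermx => /eqP vA; apply/negP/negPn.
by rewrite -trmx_eq0; apply/eqP/h; rewrite -[A]trmxK -trmx_mul vA trmx0.
Qed.

Lemma finite_small (R : realType) (I : finType) (P : I -> R -> Prop) :
  (forall i, exists2 d, 0 < d & forall x, x < d -> P i x) ->
  exists2 d, 0 < d & forall x, x < d -> forall i, P i x.
Proof.
move=> h; suff [d d0 hd] : exists2 d, 0 < d & forall x, x < d -> forall i, i \in enum I -> P i x.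
  by exists d => // x xd i; apply: hd => //; rewrite mem_enum.
elim: (enum I) => [|i s [d d0 hd]]; first by exists 1.
have [e e0 he] := h i.
exists (Num.min d e) => [|x]; first by rewrite lt_min d0.
by rewrite lt_min => /andP[xd xe] j; rewrite inE => /predU1P[->|]; [exact: he|exact: hd].
Qed.

Section ThetaNorm.
Variables (R : realType) (k : nat).
Implicit Types (x : Theta R k).

Lemma Theta_norm_le x c : 0 <= c -> (forall i, `|x.1.1 i 0| <= c) ->
  (forall i j, `|x.1.2 i j| <= c) -> `|x.2| <= c -> `|x| <= c.
Proof.
move=> c0 h1 h2 h3; rewrite prod_normE ge_max h3 andbT prod_normE ge_max.
by apply/andP; split; apply: mx_norm_le => // i j; rewrite ?(ord1 j).
Qed.

Lemma Theta_norm_ge x : [/\ `|x.1.1| <= `|x|, `|x.1.2| <= `|x| & `|x.2| <= `|x|].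
Proof. by rewrite prod_normE prod_normE; split; rewrite !le_max lexx ?orbT. Qed.

End ThetaNorm.

(** * The map [Lambda] in standardized coordinates *)

Section LambdaStd.
Variables (R : realType) (k : nat) (k_gt0 : (0 < k)%N).
Notation V := 'cV[R]_k.
Variables (lam : {measure set (k.-tuple R) -> \bar R}) (hlam : is_lebesgue lam).
Local Notation itg := (itg lam).
Local Notation int := (int lam).
Variables (f : V -> R) (f_ge0 : forall x, 0 <= f x).
Hypothesis (f_meas : measurable_fun setT (f \o @tup2cV R k)).
Hypothesis (f_dens : (\int[lam]_t (f (tup2cV t))%:E)%E = 1%E).
Variables (mu0 : V) (Gamma0 : 'M[R]_k) (hG : is_PD Gamma0).
Local Notation q := (std_density f mu0 Gamma0).
Local Notation J := (std_exp lam f mu0 Gamma0).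
Variables (gamma : R) (th : Theta R k).
Hypothesis sym_th : is_sym th.1.2.
Variable w : V -> V.
Hypothesis wE : forall z, w z = invmx th.1.2 *m (Gamma0 *m z + mu0 - th.1.1).
Let W (y : V) := invmx th.1.2 *m (y - th.1.1).
Local Notation D := (fun z => (enorm (w z) <= th.2)%R%:R).
Hypothesis iG0 : itg (fun z => D z * 1 * q z).
Hypothesis iG1 : forall i, itg (fun z => D z * w z i 0 * q z).
Hypothesis iG2 : forall i j, itg (fun z => D z * (w z i 0 * w z j 0) * q z).

Let unstd (h : V -> R) : itg (fun z => h (w z) * q z) ->
  itg (fun y => h (W y) * f y) /\ PRint lam f (fun y => h (W y)) = J (fun z => h (w z)).
Proof.
move=> ih; have ih' : itg (fun y => h (W y) * f y).
  have := itg_unstd k_gt0 hlam hG ih.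
  congr itg; apply/funext => y.
  by rewrite wE mulKVmx ?uGamma// subrK.
split=> //; have [_ ->] := PRint_std k_gt0 hlam mu0 hG ih'.
by congr std_exp; apply/funext => z; rewrite wE.
Qed.

Lemma Lambda_std : Lambda lam f gamma th =
  (\col_i J (fun z => D z * w z i 0),
   \matrix_(i, j) (J (fun z => D z * (w z i 0 * w z j 0)) - (i == j)%:R * J (fun z => D z * 1)),
   J (fun z => D z * 1) - gamma).
Proof.
have [i0 E0] := unstd (h := fun x => (enorm x <= th.2)%R%:R * 1) iG0.
rewrite /Lambda; congr (_, _, _).
- apply/colP => i; rewrite !mxE.
  have [_ <-] := unstd (h := fun x => (enorm x <= th.2)%R%:R * x i 0) (iG1 i).
  congr PRint; apply/funext => y; rewrite /Psi1 /ind -/(W y).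
  by case: ifP => _; rewrite ?mul1r// mul0r mxE.
- apply/matrixP => i j; rewrite !mxE.
  have [i2 <-] := unstd (h := fun x => (enorm x <= th.2)%R%:R * (x i 0 * x j 0)) (iG2 i j).
  rewrite -E0 !PRintE -intZ// -intB//; last exact: itgZ.
  congr int; apply/funext => y; rewrite /Psi2 /ind -/(W y).
  (* Symmetry of the scatter parameter turns the matrix in [Psi2] into the outer product of [W y]
     with itself. *)
  have sA : (invmx th.1.2)^T = invmx th.1.2 by rewrite trmx_inv sym_th.
  have -> : W y *m (y - th.1.1)^T *m invmx th.1.2 = W y *m (W y)^T.
    by rewrite /W trmx_mul sA mulmxA.
  case: ifP => _; last by rewrite !mul0r mulr0 mxE mul0r subrr.
  by rewrite !mxE big_ord1 !mxE !mul1r mulrBl.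
rewrite -E0 !PRintE.
have ifd := itg_density f_ge0 f_meas f_dens.
have g1 : gamma = int (fun y => gamma * f y) by rewrite intZ// int_density// mulr1.
rewrite [X in _ = _ - X]g1 -intB//; last exact: itgZ.
by congr int; apply/funext => y; rewrite /Psi3 /ind -/(W y) mulr1 mulrBl.
Qed.

End LambdaStd.

Section Derivative.
Variables (R : realType) (k : nat) (k_gt0 : (0 < k)%N).
Notation V := 'cV[R]_k.
Variables (lam : {measure set (k.-tuple R) -> \bar R}) (hlam : is_lebesgue lam).
Local Notation itg := (itg lam).
Local Notation int := (int lam).
Variables (f : V -> R) (f_ge0 : forall x, 0 <= f x).
Hypothesis (f_meas : measurable_fun setT (f \o @tup2cV R k)).
Hypothesis (f_dens : (\int[lam]_t (f (tup2cV t))%:E)%E = 1%E).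
Variables (mu0 : V) (Gamma0 : 'M[R]_k) (hG : is_PD Gamma0).
Local Notation q := (std_density f mu0 Gamma0).
Local Notation J := (std_exp lam f mu0 Gamma0).
Local Notation A := (invmx Gamma0).
Variables (rho : R) (rho_gt0 : 0 < rho).
Hypothesis (q_cont : forall w, enorm w = rho -> {for w, continuous q}).
Local Notation B := (fun z : V => (enorm z <= rho)%R%:R).
Variable gamma : R.
Hypothesis mom0 : J B = gamma.
Hypothesis mom1 : forall l, J (fun z => z l 0 * B z) = 0.
Hypothesis mom2 : forall l m, J (fun z => z l 0 * z m 0 * B z) = gamma * (l == m)%:R.
Local Notation S := (shell_int lam f mu0 Gamma0 rho).
Local Notation La := (Lambda lam f gamma).
Local Notation th0 := ((mu0, Gamma0, rho) : Theta R k).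

(** Each entry is a volume term plus a surface term; the extra surface term on the diagonal of the
    matrix part comes from the -I in [Psi2]. *)
Definition Lambda_deriv (h : Theta R k) : Theta R k :=
  let K := A *m h.1.2 in let b := A *m h.1.1 in
  (\col_i (- (gamma * b i 0) + S (fun w => w i 0) K b h.2),
   \matrix_(i, j) (- (gamma * (K i j + K j i)) +
     (S (fun w => w i 0 * w j 0) K b h.2 - (i == j)%:R * S (fun=> 1) K b h.2)),
   S (fun=> 1) K b h.2).

Lemma Lambda_deriv_linear c u v :
  Lambda_deriv (c *: u + v) = c *: Lambda_deriv u + Lambda_deriv v.
Proof.
have bE : A *m (c *: u + v).1.1 = c *: (A *m u.1.1) + A *m v.1.1.
  by rewrite mulmxDr -scalemxAr.
have KE : A *m (c *: u + v).1.2 = c *: (A *m u.1.2) + A *m v.1.2.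
  by rewrite mulmxDr -scalemxAr.
rewrite /Lambda_deriv bE KE /=.
move: (A *m u.1.1) (A *m v.1.1) (A *m u.1.2) (A *m v.1.2) => bu bv Ku Kv.
have lin G (hb : bounded_on_ball rho G) := shell_int_linear k_gt0 hlam f_ge0 f_meas f_dens hG
  rho_gt0 q_cont c Ku bu u.2 Kv bv v.2 hb.
have l0 := lin _ (@bounded_on_ball_cst R k rho 1).
have l1 i := lin _ (@bounded_on_ball_coord R k rho i).
have l2 i j := lin _ (bounded_on_ballM (@bounded_on_ball_coord R k rho i)
  (@bounded_on_ball_coord R k rho j)).
apply/pair_equal_spec; split; last exact: l0.
apply/pair_equal_spec; split.
- apply/colP => i; rewrite !mxE [S _ _ _ _]l1; ring.
- apply/matrixP => i j; rewrite !mxE [S (fun w => w i 0 * w j 0) _ _ _]l2.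
  rewrite [S (fun=> 1) _ (_ + _) _]l0; ring.
Qed.

Lemma Lambda_center : La th0 = (\col_i J (fun z => B z * z i 0),
  \matrix_(i, j) (J (fun z => B z * (z i 0 * z j 0)) - (i == j)%:R * J (fun z => B z * 1)),
  J (fun z => B z * 1) - gamma).
Proof.
have wid z : z = invmx th0.1.2 *m (Gamma0 *m z + mu0 - th0.1.1).
  by rewrite /= addrK mulKmx// uGamma.
have ball (h : V -> R) M : mea h -> (forall z, enorm z <= rho -> `|h z| <= M) ->
    itg (fun z => B z * h z * q z).
  move=> mh hM; under eq_fun do rewrite [B _ * _]mulrC.
  exact: (itgq_on_ball k_gt0 hlam f_ge0 f_meas f_dens mu0 hG mh hM).
apply: (@Lambda_std _ _ k_gt0 _ hlam _ f_ge0 f_meas f_dens mu0 _ hG gamma th0 hG.1 id wid) => [|i|i j].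
- by apply: (ball _ 1) => [|z _]; [exact: mea_cst|rewrite normr1].
- apply: (ball _ rho) => [|z zr]; first exact: mea_coord.
  exact: le_trans (le_coord_enorm _ _) zr.
apply: (ball _ (rho * rho)) => [|z zr]; first by apply: meaM; exact: mea_coord.
by rewrite normrM ler_pM// (le_trans (le_coord_enorm _ _)).
Qed.

Section Small.
Variables (h : Theta R k) (kap eps : R).
Hypothesis hsub : in_sub h.
Let K := A *m h.1.2.
Let b := A *m h.1.1.
Hypotheses (Kk : msum K <= kap) (bk : enorm b <= kap) (tk : `|h.2| <= kap).
Hypotheses (kap_gt0 : 0 < kap) (kap_half : kap <= 2^-1).

Let th : Theta R k := th0 + h.
Let w (z : V) := invmx th.1.2 *m (Gamma0 *m z + mu0 - th.1.1).
Local Notation D := (fun z => (enorm (w z) <= rho + h.2)%R%:R).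

(** A kernel vector v satisfies v = -K v, hence |v| <= |v| / 2. *)
Lemma unit_perturbed : Gamma0 + h.1.2 \in unitmx.
Proof.
apply: unitmx_inj => v hv; have : v + K *m v = 0.
  have := congr1 (mulmx A) hv; rewrite mulmx0 mulmxDl mulmxDr mulKmx ?uGamma// mulmxA.
  exact.
move=> /eqP; rewrite addr_eq0 => /eqP vE.
have h1 : enorm v <= kap * enorm v by rewrite {1}vE enormN enorm_K.
apply/eqP; rewrite -enorm_eq0; have := enorm_ge0 v => v0.
have h2 : kap * enorm v <= 2^-1 * enorm v by rewrite ler_wpM2r.
by rewrite eq_le v0 andbT; lra.
Qed.

Lemma perturbed_eq z : w z + K *m w z = z - b.
Proof.
have -> : w z + K *m w z = A *m ((Gamma0 + h.1.2) *m w z).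
  by rewrite mulmxDl mulmxDr mulKmx ?uGamma// !mulmxA.
rewrite /w mulKVmx; last exact: unit_perturbed.
have -> : Gamma0 *m z + mu0 - th.1.1 = Gamma0 *m z - h.1.1 by rewrite /th/= opprD addrA addrK.
by rewrite mulmxBr mulKmx// uGamma.
Qed.

Lemma meaV_perturbed : meaV w.
Proof.
apply: meaV_mul; apply: meaVD; last exact: meaV_cst.
by apply: meaVD; [apply: meaV_mul; exact: meaV_id|exact: meaV_cst].
Qed.

Hypothesis ex0 : expansion_at lam f mu0 Gamma0 rho (fun=> 1) (fun _ _ => 0) eps kap.
Hypothesis ex1 : forall i, expansion_at lam f mu0 Gamma0 rho
  (fun z => z i 0) (fun _ b => - (gamma * b i 0)) eps kap.
Hypothesis ex2 : forall i j, expansion_at lam f mu0 Gamma0 rho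
  (fun z => z i 0 * z j 0) (fun K _ => - (gamma * (K i j + K j i))) eps kap.

(** The factor 2 comes from the diagonal matrix entries, which combine the expansion of z_i z_j with
    that of the constant 1. *)
Lemma Lambda_increment :
  `|La (th0 + h) - La th0 - Lambda_deriv h| <= 2 * (eps * kap).
Proof.
have mw := meaV_perturbed; have wE := perturbed_eq.
have [i0 b0] := ex0 Kk bk tk kap_gt0 mw wE.
have i1 i := (ex1 i Kk bk tk kap_gt0 mw wE).1.
have b1 i := (ex1 i Kk bk tk kap_gt0 mw wE).2.
have i2 i j := (ex2 i j Kk bk tk kap_gt0 mw wE).1.
have b2 i j := (ex2 i j Kk bk tk kap_gt0 mw wE).2.
have sth : is_sym th.1.2 by rewrite /is_sym /th/= linearD/= hG.1 hsub.
have e0 : 0 <= eps * kap by rewrite (le_trans _ b0).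
have e2 : eps * kap <= 2 * (eps * kap) by lra.
have LE := @Lambda_std _ _ k_gt0 _ hlam _ f_ge0 f_meas f_dens mu0 _ hG gamma th sth w
  (fun=> erefl) i0 i1 i2.
have sub1 (x y z : Theta R k) i : (x - y - z).1.1 i 0 = x.1.1 i 0 - y.1.1 i 0 - z.1.1 i 0.
  by rewrite !mxE.
have sub2 (x y z : Theta R k) i j : (x - y - z).1.2 i j = x.1.2 i j - y.1.2 i j - z.1.2 i j.
  by rewrite !mxE.
apply: Theta_norm_le => [|i|i j|]; first by rewrite mulr_ge0.
- apply: le_trans e2; apply: le_trans (b1 i).
  have -> : (La (th0 + h) - La th0 - Lambda_deriv h).1.1 i 0 = J (fun z => D z * w z i 0) -
      J (fun z => B z * z i 0) - (- (gamma * b i 0) + S (fun w => w i 0) K b h.2).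
    rewrite sub1; congr (_ - _ - _); last by rewrite mxE.
      by rewrite LE mxE.
    by rewrite Lambda_center mxE.
  by rewrite opprD addrA.
- have -> : (La (th0 + h) - La th0 - Lambda_deriv h).1.2 i j =
      (J (fun z => D z * (w z i 0 * w z j 0)) - (i == j)%:R * J (fun z => D z * 1)) -
      (J (fun z => B z * (z i 0 * z j 0)) - (i == j)%:R * J (fun z => B z * 1)) -
      (- (gamma * (K i j + K j i)) +
        (S (fun w => w i 0 * w j 0) K b h.2 - (i == j)%:R * S (fun=> 1) K b h.2)).
    rewrite sub2; congr (_ - _ - _); last by rewrite mxE.
      by rewrite LE mxE.
    by rewrite Lambda_center mxE.
  have hX0 := b0; have hX2 := b2 i j.
  set X0 := (X in `|X| <= _) in hX0; set X2 := (X in `|X| <= _) in hX2.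
  apply: (@le_trans _ _ `|X2 - (i == j)%:R * X0|).
    by rewrite le_eqVlt; apply/orP; left; apply/eqP; congr `|_|; rewrite /X0 /X2; ring.
  have -> : 2 * (eps * kap) = eps * kap + eps * kap by ring.
  rewrite (le_trans (ler_normB _ _))// lerD// normrM normr_nat.
  by case: (i == j); rewrite ?mul1r// mul0r.
apply: le_trans e2; apply: le_trans b0.
have -> : (La (th0 + h) - La th0 - Lambda_deriv h).2 =
    (J (fun z => D z * 1) - gamma) - (J (fun z => B z * 1) - gamma) - S (fun=> 1) K b h.2.
  rewrite [LHS](_ : _ = (La (th0 + h)).2 - (La th0).2 - (Lambda_deriv h).2)//.
  by rewrite LE Lambda_center.
by rewrite le_eqVlt; apply/orP; left; apply/eqP; congr `|_|; ring.
Qed.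

End Small.

Lemma Lambda_frechet : frechet_deriv_sub La th0 Lambda_deriv.
Proof.
split; first exact: Lambda_deriv_linear.
(* The three summands bound, in units of |h|, the sizes of K, of b and of the radius increment, so
   kap = C |h| is admissible for all three. *)
move=> eps eps0; pose C : R := k%:R ^+ 2 * msum A + k%:R * msum A + 1.
have mA : 0 <= msum A by exact: msum_ge0.
have t1 : 0 <= k%:R ^+ 2 * msum A by rewrite mulr_ge0// sqr_ge0.
have t2 : 0 <= k%:R * msum A by rewrite mulr_ge0.
have C0 : 0 < C by rewrite /C; lra.
pose e1 := eps / (2 * C).
have e10 : 0 < e1 by rewrite divr_gt0// mulr_gt0.
have [d0 d00 h0] := expansion0 k_gt0 hlam f_ge0 f_meas f_dens hG rho_gt0 q_cont e10.
have [d1 d10 h1] := finite_small (fun i =>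
  expansion1 k_gt0 hlam f_ge0 f_meas f_dens hG rho_gt0 q_cont mom0 mom1 i e10).
have [d2 d20 h2] := finite_small (fun ij : 'I_k * 'I_k =>
  expansion2 k_gt0 hlam f_ge0 f_meas f_dens hG rho_gt0 q_cont mom1 mom2 ij.1 ij.2 e10).
pose d := Num.min (Num.min d0 d1) (Num.min d2 2^-1).
have dd : 0 < d by rewrite !lt_min d00 d10 d20 invr_gt0 ltr0n.
exists (d / C) => [|h hs]; first exact: divr_gt0.
rewrite ltr_pdivlMr// mulrC => hd.
(* The expansions need kap > 0, so h = 0 is settled by linearity. *)
have [->|hn0] := eqVneq h 0.
  have L0 : Lambda_deriv 0 = 0.
    by have := Lambda_deriv_linear (-1) 0 0; rewrite scaler0 addr0 scaleN1r addNr.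
  by rewrite addr0 subrr L0 subr0 normr0 mulr0.
have kap0 : 0 < C * `|h| by rewrite mulr_gt0// normr_gt0.
have nh : 0 <= `|h| by exact: normr_ge0.
have [ha hH ht] := Theta_norm_ge h.
move: (hd); rewrite !lt_min => /andP[/andP[hd0 hd1] /andP[hd2 hd3]].
have hK : msum (A *m h.1.2) <= C * `|h|.
  apply: (@le_trans _ _ (k%:R ^+ 2 * msum A * `|h|)); last by rewrite ler_wpM2r// /C; lra.
  rewrite (le_trans (msum_le_norm _))// -mulrA ler_wpM2l ?sqr_ge0//.
  apply: mx_norm_le => [|i j]; first by rewrite mulr_ge0.
  rewrite mxE (le_trans (ler_norm_sum _ _ _))//.
  apply: (@le_trans _ _ (\sum_l `|A i l| * `|h|)).
    apply: ler_sum => l _; rewrite normrM ler_wpM2l// (le_trans _ hH)//.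
    exact: le_entry_mx_norm.
  rewrite -mulr_suml ler_wpM2r// /msum [leRHS](bigD1 i)//= lerDl.
  by apply: sumr_ge0 => l _; apply: sumr_ge0.
have hb : enorm (A *m h.1.1) <= C * `|h|.
  apply: (@le_trans _ _ (k%:R * msum A * `|h|)); last by rewrite ler_wpM2r// /C; lra.
  rewrite (le_trans (enorm_mulmx _ _))// [k%:R * _]mulrC -mulrA ler_wpM2l//.
  by rewrite (le_trans (enorm_le_norm _))// ler_wpM2l.
have ht' : `|h.2| <= C * `|h|.
  by apply: (le_trans ht); rewrite ler_peMl// /C; lra.
have := Lambda_increment hs hK hb ht' kap0 (ltW hd3) (h0 _ hd0) (fun i => h1 _ hd1 i)
  (fun i j => h2 _ hd2 (i, j)).
move=> /le_trans; apply; rewrite le_eqVlt; apply/orP; left; apply/eqP.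
by rewrite /e1; field; rewrite gt_eqF.
Qed.

End Derivative.

(** * The theorem *)

Section Boundary.
Variables (R : realType) (k : nat) (k_gt0 : (0 < k)%N).
Notation V := 'cV[R]_k.
Variables (f : V -> R) (mu0 : V) (Gamma0 Sigma0 : 'M[R]_k) (hG : is_PD Gamma0).
Hypothesis hGS : Gamma0 *m Gamma0 = Sigma0.
Variables (rho : R) (rho_gt0 : 0 < rho).

(** The point lies in the ellipsoid, while pushing w outwards by a factor 1 + e leaves it at
    arbitrarily small distance. *)
Lemma affine_sphere_boundary w : enorm w = rho ->
  (closure (Ell mu0 Sigma0 rho) `\` interior (Ell mu0 Sigma0 rho)) (Gamma0 *m w + mu0).
Proof.
move=> wr; have EE s := EllE mu0 hG hGS (Gamma0 *m s + mu0) (ltW rho_gt0).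
have affK s : invmx Gamma0 *m (Gamma0 *m s + mu0 - mu0) = s by rewrite addrK mulKmx// uGamma.
split; first by apply: subset_closure; rewrite EE affK wr.
move=> /(@nbhs_normP R V) [d /= d0 hd].
pose g := `|Gamma0 *m w| + 1.
have g0 : 0 < g by rewrite ltr_wpDl.
pose e := d / (2 * g).
have e0 : 0 < e by rewrite divr_gt0// mulr_gt0.
suff : Ell mu0 Sigma0 rho (Gamma0 *m ((1 + e) *: w) + mu0).
  rewrite EE affK enormZ wr ger0_norm ?addr_ge0 ?(ltW e0)//.
  by apply/negP; rewrite -ltNge ltr_pMl// ltrDl.
apply: hd => /=.
have -> : Gamma0 *m w + mu0 - (Gamma0 *m ((1 + e) *: w) + mu0) = - (e *: (Gamma0 *m w)).
  rewrite -scalemxAr scalerDl scale1r; move: (Gamma0 *m w) (e *: _) => u v.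
  by apply/colP => i; rewrite !mxE; ring.
rewrite normrN normrZ gtr0_norm// /e mulrAC ltr_pdivrMr ?mulr_gt0// ltr_pM2l// /g.
by have := normr_ge0 (Gamma0 *m w); lra.
Qed.

Lemma std_density_continuous w : {for Gamma0 *m w + mu0, continuous f} ->
  {for w, continuous (std_density f mu0 Gamma0)}.
Proof.
move=> /(mx_continuousP f) h; apply/mx_continuousP => e e0; have [d d0 hd] := h e e0.
pose c := k%:R * msum Gamma0 + 1.
have m0 : 0 <= k%:R * msum Gamma0 by rewrite mulr_ge0// msum_ge0.
have c0 : 0 < c by rewrite /c; lra.
exists (d / c) => [|z]; first exact: divr_gt0.
rewrite ltr_pdivlMr// => zd; apply: hd.
have -> : Gamma0 *m w + mu0 - (Gamma0 *m z + mu0) = Gamma0 *m (w - z).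
  by rewrite mulmxBr opprD addrACA subrr addr0.
apply: le_lt_trans zd; apply: mx_norm_le => [|i j]; first by rewrite mulr_ge0// ltW.
rewrite (ord1 j) (le_trans (le_coord_enorm _ _))// (le_trans (enorm_mulmx _ _))//.
apply: (@le_trans _ _ (msum Gamma0 * (k%:R * `|w - z|))).
  by rewrite ler_wpM2l ?msum_ge0// enorm_le_norm.
by rewrite mulrCA mulrA mulrC ler_wpM2l// /c; lra.
Qed.

End Boundary.

Lemma nu_int_rho0 (R : realType) (k : nat) (lam : {measure set (k.-tuple R) -> \bar R})
  f mu0 Gamma0 h : nu_int lam f mu0 Gamma0 0 h = 0.
Proof. by rewrite /nu_int /sphere_int invr0 mulr0 mul0r mulr0. Qed.

Lemma inf_pos_ge0 (R : realType) (P : R -> Prop) : 0 <= inf [set s : R | 0 < s /\ P s].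
Proof.
have [->|/set0P S0] := eqVneq [set s : R | 0 < s /\ P s] set0; first by rewrite inf0.
by apply: lb_le_inf => // s [/ltW].
Qed.

Theorem theorem3p4 (R : realType) (k : nat) (hk : (1 <= k)%N)
  (gamma : R) (hgamma : 0 < gamma <= 1)
  (lam : {measure set (k.-tuple R) -> \bar R}) (hlam : is_lebesgue lam)
  (f : 'cV[R]_k -> R) (f_ge0 : forall x, 0 <= f x)
  (f_meas : measurable_fun setT (f \o @tup2cV R k))
  (f_dens : (\int[lam]_t (f (tup2cV t))%:E)%E = 1%E)
  (mu0 : 'cV[R]_k) (Sigma0 Gamma0 : 'M[R]_k) (rho0 : R)
  (hMCD : unique_MCD lam f gamma mu0 Sigma0)
  (hSigma0 : is_PD Sigma0)
  (hGamma0 : is_PD Gamma0 /\ Gamma0 *m Gamma0 = Sigma0)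
  (hrho0 : rho0 = inf [set s : R | 0 < s /\
                         (gamma%:E <= Pmeas lam f (Ell mu0 Sigma0 s))%E])
  (hB : condB f mu0 Sigma0 rho0)
  (hsym : forall (i : 'I_k) (w : 'cV[R]_k), enorm w = rho0 ->
            f (Gamma0 *m flip i w + mu0) = f (Gamma0 *m w + mu0))
  (ha : forall i : 'I_k,
          nu_int lam f mu0 Gamma0 rho0 (fun w => w i 0 ^+ 2) != gamma * rho0)
  (hb : forall i j : 'I_k, i != j ->
          nu_int lam f mu0 Gamma0 rho0 (fun w => w i 0 ^+ 2 * w j 0 ^+ 2)
            != gamma * rho0)
  (hc : forall x : 'cV[R]_k,
          Mmat lam f gamma mu0 Gamma0 rho0 *m x = 0 ->
          \sum_i x i 0 = 0 -> x = 0) :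
  exists L : Theta R k -> Theta R k,
    frechet_deriv_sub (Lambda lam f gamma) (mu0, Gamma0, rho0) L /\
    (forall h : Theta R k, in_sub h -> L h = 0 -> h = 0).
Proof.
have g0 : 0 < gamma by case/andP: hgamma.
case: hGamma0 => hG hGS.
(* For rho0 = 0 the factor k / rho0 is 0 by convention, so all surface integrals vanish and (a)
   would assert 0 != 0; k >= 1 supplies an index. *)
have rho_gt0 : 0 < rho0.
  have r0 : 0 <= rho0 by rewrite hrho0; exact: inf_pos_ge0.
  rewrite lt_def r0 andbT; apply/eqP => rE.
  by have := ha (Ordinal hk); rewrite rE nu_int_rho0 mulr0 eqxx.
have [U [_ bU hU]] := hB.
have on_sphere w : enorm w = rho0 -> U (Gamma0 *m w + mu0).
  by move=> wr; apply: bU; exact: affine_sphere_boundary.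
have q_cont w : enorm w = rho0 -> {for w, continuous (std_density f mu0 Gamma0)}.
  by move=> /on_sphere/hU[c _]; exact: std_density_continuous.
have q_pos w : enorm w = rho0 -> 0 < std_density f mu0 Gamma0 w.
  by move=> /on_sphere/hU[].
have [[phi [phi_min phiT phiC]] _] := hMCD.
have m0 := cdf_rho hk hlam f_ge0 f_meas f_dens hG hGS rho_gt0 hrho0 q_cont.
have [m1 m2] := std_moments0 hk hlam f_ge0 f_meas f_dens hG hGS g0 rho_gt0 hrho0 q_cont
  phi_min phiT phiC hMCD.
exists (Lambda_deriv lam f mu0 Gamma0 rho0 gamma); split.
  exact: Lambda_frechet.
move=> h hs [] /colP L1 /matrixP L2 L3.
set K := invmx Gamma0 *m h.1.2 in L1 L2 L3; set b := invmx Gamma0 *m h.1.1 in L1 L2 L3.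
have e1 i : shell_int lam f mu0 Gamma0 rho0 (fun w => w i 0) K b h.2 = gamma * b i 0.
  have := L1 i; rewrite mxE [RHS]mxE => /eqP; rewrite addrC subr_eq0 => /eqP; exact.
have e2 i j : shell_int lam f mu0 Gamma0 rho0 (fun w => w i 0 * w j 0) K b h.2 -
    (i == j)%:R * shell_int lam f mu0 Gamma0 rho0 (fun=> 1) K b h.2 = gamma * (K i j + K j i).
  have := L2 i j; rewrite mxE [RHS]mxE => /eqP; rewrite addrC subr_eq0 => /eqP; exact.
have b0 := shell_inj_location hk hlam f_ge0 f_meas f_dens hG rho_gt0 q_cont hsym ha e1.
have off := shell_inj_offdiag hk hlam f_ge0 f_meas f_dens hG rho_gt0 q_cont hsym hb e2.
have dg := shell_inj_diag hk hlam f_ge0 f_meas f_dens hG rho_gt0 q_cont hsym g0 q_pos hc e2 L3.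
have t0 := shell_inj_radius hk hlam f_ge0 f_meas f_dens hG rho_gt0 q_cont hsym g0 q_pos hc e2 L3.
have KK : K + K^T = 0.
  apply/matrixP => i j; rewrite mxE [K^T i j]mxE [RHS]mxE.
  by have [<-|/off//] := eqVneq i j; rewrite dg addr0.
have H0 : h.1.2 = 0.
  apply: (PD_anticomm0 (PD_inv hG) hs).
  by rewrite -[RHS]KK /K trmx_mul hs trmx_inv hG.1.
have a0 : h.1.1 = 0 by rewrite -[LHS](mulKVmx (uGamma hG)) -/b b0 mulmx0.
by case: h a0 H0 t0 {hs L1 L2 L3 K b e1 e2 b0 off dg KK} => -[a H] t /= -> -> ->.
Qed.
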